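(* For all $M \in \mathcal M$, $$ R_0M \xrightarrow{d_0} R_1M \xrightarrow{d_1} R_2M \xrightarrow{d_2} \cdots$$ is a chain complex with $H_s(R_*M;d)$ naturally isomorphic to $\Omega^\infty_sM$.
   Context: $\mathcal A$ is the mod 2 Steenrod algebra. $\mathcal M$ is the category of locally finite right $\mathcal A$-modules ($Sq^i$ lowers degree by $i$; $x\cdot\mathcal A$ is finite for every $x$); $\Sigma:\mathcal M\to\mathcal M$ is suspension, $\sigma x$ denoting the suspension of $x$. $\mathcal U\subset\mathcal M$ is the full subcategory of modules with $xSq^i=0$ whenever $2i>|x|$. $\Omega^\infty:\mathcal M\to\mathcal U$ is the right adjoint of the inclusion ($\Omega^\infty M$ is the largest unstable submodule of $M$), and $\Omega^\infty_s$ are its right derived functors. For $M\in\mathcal M$, $\mathcal R_sM=\langle Q^Ix\mid l(I)=s,\ x\in M\rangle/(\text{unstable and Adem relations})$, where $Q^I=Q^{i_1}\cdots Q^{i_s}$, $i_j\in\mathbb Z$, $l(I)=s$, and $Q^i$ raises degree by $i$; the unstable relation is $Q^iz=0$ for $i<|z|$, the Adem relations are $Q^rQ^s=\sum_i\binom{i-s-1}{2i-r}Q^{r+s-i}Q^i$, and $\mathcal A$ acts via the Nishida relations $(Q^sx)Sq^r=\sum_i\binom{s-r}{r-2i}Q^{s-r+i}(xSq^i)$. Set $R_s=\Sigma\mathcal R_s\Sigma^{s-1}:\mathcal M\to\mathcal M$. The map $d_s:R_sM\to R_{s+1}M$ is given, for $x\in M$ and $l(I)=s$, by $$d_s(Q^Ix)=\sum_{i\ge0}Q^IQ^{i-1}(xSq^i)$$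 with suspensions suppressed, i.e. $d_s(\sigma Q^I(\sigma^{s-1}x))=\sum_{i\ge0}\sigma Q^IQ^{i-1}(\sigma^s(xSq^i))$. *)

(* Defs.v *)
From HB Require Import structures.
From mathcomp Require Import all_boot all_order all_algebra.
From mathcomp Require Import boolp classical_sets functions cardinality.
From mathcomp Require Import zify.

Set Implicit Arguments.
Unset Strict Implicit.
Unset Printing Implicit Defensive.

Import Order.TTheory GRing.Theory Num.Theory.

Local Open Scope ring_scope.

Definition window (N : nat) : seq int := [seq j%:Z - N%:Z | j <- iota 0 (N.*2.+1)].

Lemma mem_window N (n : int) : (n \in window N) = (`|n|%N <= N)%N.
Proof.
apply/mapP/idP => [[j]|h]; first by rewrite mem_iota => hj ->; lia.
by exists (absz (n + N%:Z)); [rewrite mem_iota; lia|lia].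
Qed.

Lemma window_uniq N : uniq (window N).
Proof. by rewrite map_inj_uniq ?iota_uniq // => i j; lia. Qed.

(* Z-graded F_2-vector spaces with linear operations Sq^i (i >= 0) lowering the
   degree by i, no relation between the Sq^i being imposed yet. An F_2-vector
   space is an abelian group in which x + x = 0, and the grading is internal:
   [grpr n] is the projection onto the summand of degree n. *)
Record sqspace := SqSpace {
  car :> zmodType;
  grpr : int -> {additive car -> car};
  Sq : nat -> {additive car -> car};
  addxx : forall x : car, x + x = 0;
  prpr : forall m n x, grpr m (grpr n x) = if m == n then grpr n x else 0;
  prsum : forall x, exists2 s : seq int, uniq s & x = \sum_(n <- s) grpr n x;
  prSq : forall i n x, grpr (n - i%:Z) (Sq i x) = Sq i (grpr n x) }.

Arguments grpr {s} n : rename.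
Arguments Sq {s} i : rename.

Lemma prsum_of (V : zmodType) (p : int -> {additive V -> V})
    (pp : forall m n x, p m (p n x) = if m == n then p n x else 0)
    (psep : forall x, (forall n, p n x = 0) -> x = 0)
    (pbnd : forall x, exists N, forall n : int, (N < `|n|)%N -> p n x = 0) x :
  exists2 s : seq int, uniq s & x = \sum_(n <- s) p n x.
Proof.
have [N hN] := pbnd x; exists (window N); first exact: window_uniq.
apply/eqP; rewrite -subr_eq0; apply/eqP/psep => n.
rewrite raddfB raddf_sum /=.
under eq_bigr do rewrite pp.
rewrite -big_mkcond big_mkcond /=.
case: (boolP (n \in window N)) => hn; last first.
  rewrite hN ?sub0r; last by rewrite mem_window -ltnNge in hn.
  rewrite big_seq big1 ?oppr0 // => m hm; case: eqP => // e.
  by rewrite e hm in hn.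
rewrite (bigD1_seq n) ?window_uniq //= eqxx big1 ?addr0 ?subrr // => m.
by rewrite eq_sym => /negPf ->.
Qed.

Section Grading.
Variable M : sqspace.
Implicit Types (x y : M) (n : int).

Lemma opp_id x : - x = x.
Proof. by apply/eqP; rewrite eq_sym -addr_eq0 addxx. Qed.

Lemma pr_sep x : (forall n, grpr n x = 0) -> x = 0.
Proof. by move=> h; have [s _ ->] := prsum x; rewrite big1. Qed.

Lemma pr_bnd x : exists N, forall n, (N < `|n|)%N -> grpr n x = 0.
Proof.
have [s us e] := prsum x.
exists (\sum_(m <- s) `|m|)%N => n hn.
rewrite e raddf_sum /= big_seq big1 // => m ms; rewrite prpr; case: eqP => // nm.
by move: hn; rewrite nm (big_rem m) //=; lia.
Qed.

Lemma pr_window x : exists N, x = \sum_(n <- window N) grpr n x.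
Proof.
have [N hN] := pr_bnd x; exists N.
apply/eqP; rewrite -subr_eq0; apply/eqP/pr_sep => n.
rewrite raddfB raddf_sum /=; under eq_bigr do rewrite prpr.
case: (boolP (n \in window N)) => hn; last first.
  rewrite hN ?sub0r; last by rewrite mem_window -ltnNge in hn.
  rewrite big_seq big1 ?oppr0 // => m hm; case: eqP => // e.
  by rewrite e hm in hn.
rewrite (bigD1_seq n) ?window_uniq //= eqxx big1 ?addr0 ?subrr // => m.
by rewrite eq_sym => /negPf ->.
Qed.

Lemma prSqE i n x : grpr n (Sq i x) = Sq i (grpr (n + i%:Z) x).
Proof. by rewrite -prSq addrK. Qed.

End Grading.

Definition homog (M : sqspace) (n : int) (x : M) := grpr n x = x.

(* The operations act on the right: [Sq i x] is x Sq^i, so x Sq^a Sq^b is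
   [Sq b (Sq a x)]. The mod 2 Steenrod algebra A is presented by the generators
   Sq^i, the Adem relations for a < 2b and Sq^0 = 1, so this says that the
   operations define a right A-module. *)
Definition steenrod_module (M : sqspace) :=
  (forall x : M, Sq 0 x = x) /\
  (forall (a b : nat) (x : M), (a < b.*2)%N ->
     Sq b (Sq a x) =
     \sum_(j < a./2.+1) Sq j (Sq (a + b - j) x) *+ 'C(b - 1 - j, a - j.*2)).

(* [cyclic x y] : y lies in x.A *)
Inductive cyclic (M : sqspace) (x : M) : M -> Prop :=
| orbit_gen : cyclic x x
| orbit_zero : cyclic x 0
| orbit_add y z : cyclic x y -> cyclic x z -> cyclic x (y + z)
| orbit_Sq i y : cyclic x y -> cyclic x (Sq i y).

Definition locally_finite (M : sqspace) :=
  forall x : M, finite_set [set y | cyclic x y].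

(* The category M of locally finite right A-modules, a full subcategory of
   [sqspace] (with the morphisms [sqhom]). *)
Record lfAmod := LfAmod {
  lfcar :> sqspace;
  lf_steenrod : steenrod_module lfcar;
  lf_fin : locally_finite lfcar }.

Definition unstable (M : sqspace) :=
  forall (n : int) (i : nat) (x : M), homog n x -> n < 2 * i%:Z -> Sq i x = 0.

(* [grhom]: degree-preserving linear maps; [sqhom]: those commuting with the Sq^i. *)
Record grhom (M N : sqspace) := GrHom {
  gfun :> {additive M -> N};
  ghom_pr : forall n x, gfun (grpr n x) = grpr n (gfun x) }.

Record sqhom (M N : sqspace) := SqHom {
  hfun :> grhom M N;
  hom_Sq : forall i x, hfun (Sq i x) = Sq i (hfun x) }.

Definition additive_of (V W : zmodType) (f : V -> W) (fB : zmod_morphism f) :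
  {additive V -> W} :=
  HB.pack f (GRing.isZmodMorphism.Build V W f fB).

Record submod (M : sqspace) := Submod {
  sub_in :> M -> Prop;
  sub_in0 : sub_in 0;
  sub_inD : forall x y, sub_in x -> sub_in y -> sub_in (x + y);
  sub_in_pr : forall n x, sub_in x -> sub_in (grpr n x);
  sub_in_Sq : forall i x, sub_in x -> sub_in (Sq i x) }.

Definition is_iso (M N : sqspace) (f : sqhom M N) := bijective (fun x : M => f x).

Section SubQuo.
Variables (M : sqspace) (P : submod M).

Definition smem : {pred M} := fun x => `[< P x >].

Lemma smemP x : reflect (P x) (x \in smem).
Proof. exact: asboolP. Qed.

Lemma smem_closed : zmod_closed smem.
Proof.
split=> [|x y /smemP Px /smemP Py]; apply/smemP; first exact: sub_in0.
by rewrite opp_id; apply: sub_inD.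
Qed.

HB.instance Definition _ := GRing.isZmodClosed.Build M smem smem_closed.

Record sub_car := SubCar { sub_val :> M; _ : sub_val \in smem }.

HB.instance Definition _ := [isSub for sub_val].
HB.instance Definition _ := [Choice of sub_car by <:].
HB.instance Definition _ := [SubChoice_isSubZmodule of sub_car by <:].

Lemma sub_carP (x : sub_car) : P (val x).
Proof. exact/smemP/(valP x). Qed.

Definition sub_mk x (Px : P x) : sub_car := SubCar (introT (smemP x) Px).

Definition sub_lift (f : {additive M -> M}) (h : forall x, P x -> P (f x))
  (x : sub_car) : sub_car := sub_mk (h _ (sub_carP x)).

Lemma sub_lift_add f h : zmod_morphism (@sub_lift f h).
Proof. by move=> x y; apply: val_inj; rewrite /= raddfB. Qed.

Definition sub_pr n := additive_of (sub_lift_add (@sub_in_pr M P n)).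
Definition sub_Sq i := additive_of (sub_lift_add (@sub_in_Sq M P i)).

Lemma sub_addxx (x : sub_car) : x + x = 0.
Proof. by apply: val_inj; rewrite /= addxx. Qed.

Lemma sub_prpr m n x : sub_pr m (sub_pr n x) = if m == n then sub_pr n x else 0.
Proof. by apply: val_inj; rewrite /= prpr; case: ifP. Qed.

Lemma sub_prsum x : exists2 s : seq int, uniq s & x = \sum_(n <- s) sub_pr n x.
Proof.
have [s us e] := prsum (val x); exists s => //.
by apply: val_inj; rewrite raddf_sum.
Qed.

Lemma sub_prSq i n x : sub_pr (n - i%:Z) (sub_Sq i x) = sub_Sq i (sub_pr n x).
Proof. by apply: val_inj; rewrite /= prSq. Qed.

Definition subobj : sqspace := SqSpace sub_addxx sub_prpr sub_prsum sub_prSq.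

Definition quo_car := Quotient.quot smem.

Definition qclass (x : M) : quo_car := (\pi_quo_car x)%qT.

Lemma cls_add : zmod_morphism qclass.
Proof. by move=> x y; rewrite /qclass !piE. Qed.

HB.instance Definition _ := GRing.isZmodMorphism.Build M quo_car qclass cls_add.

Lemma cls_eq0 x : qclass x = 0 <-> P x.
Proof.
have -> : (0 : quo_car) = qclass 0 by rewrite raddf0.
split=> [/eqP|h].
  by rewrite /qclass -Quotient.idealrBE subr0 => /smemP.
by apply/eqP; rewrite /qclass -Quotient.idealrBE subr0; apply/smemP.
Qed.

Lemma cls_repr (x : quo_car) : qclass (repr x) = x.
Proof. exact: reprK. Qed.

Lemma cls_surj (x : quo_car) : exists y, qclass y = x.
Proof. by exists (repr x); apply: cls_repr. Qed.

Lemma clsP x y : qclass x = qclass y <-> P (x - y).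
Proof.
by rewrite -cls_eq0 raddfB /=; split=> [->|/eqP]; [rewrite subrr|rewrite subr_eq0 => /eqP].
Qed.

Definition quo_lift (W : zmodType) (f : {additive M -> W}) (x : quo_car) : W :=
  f (repr x).

Lemma quo_liftE (W : zmodType) (f : {additive M -> W}) :
  (forall x, P x -> f x = 0) -> forall x, quo_lift f (qclass x) = f x.
Proof.
move=> h x; apply/eqP; rewrite -subr_eq0 -raddfB; apply/eqP/h/clsP.
exact: cls_repr.
Qed.

Lemma quo_lift_add (W : zmodType) (f : {additive M -> W}) :
  (forall x, P x -> f x = 0) -> zmod_morphism (quo_lift f).
Proof.
move=> h x y; have [a <-] := cls_surj x; have [b <-] := cls_surj y.
by rewrite -raddfB !quo_liftE // raddfB.
Qed.

Lemma quo_self (f : {additive M -> M}) : (forall x, P x -> P (f x)) ->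
  forall x, P x -> (qclass \o f) x = 0.
Proof. by move=> h x /h /cls_eq0. Qed.

Definition quo_pr n := additive_of (quo_lift_add (quo_self (@sub_in_pr M P n))).
Definition quo_Sq i := additive_of (quo_lift_add (quo_self (@sub_in_Sq M P i))).

Lemma quo_prE n x : quo_pr n (qclass x) = qclass (grpr n x).
Proof. exact: (quo_liftE (quo_self (@sub_in_pr M P n))). Qed.

Lemma quo_SqE i x : quo_Sq i (qclass x) = qclass (Sq i x).
Proof. exact: (quo_liftE (quo_self (@sub_in_Sq M P i))). Qed.

Lemma quo_addxx (x : quo_car) : x + x = 0.
Proof. by have [y <-] := cls_surj x; rewrite -raddfD addxx raddf0. Qed.

Lemma quo_prpr m n x : quo_pr m (quo_pr n x) = if m == n then quo_pr n x else 0.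
Proof.
have [y <-] := cls_surj x; rewrite !quo_prE prpr.
by case: ifP => //; rewrite raddf0.
Qed.

Lemma quo_prsum x : exists2 s : seq int, uniq s & x = \sum_(n <- s) quo_pr n x.
Proof.
have [y <-] := cls_surj x; have [s us e] := prsum y; exists s => //.
by rewrite {1}e raddf_sum; apply: eq_bigr => n _; rewrite quo_prE.
Qed.

Lemma quo_prSq i n x : quo_pr (n - i%:Z) (quo_Sq i x) = quo_Sq i (quo_pr n x).
Proof. by have [y <-] := cls_surj x; rewrite !(quo_prE, quo_SqE) prSq. Qed.

Definition quoobj : sqspace := SqSpace quo_addxx quo_prpr quo_prsum quo_prSq.

Definition quo_proj : sqhom M quoobj :=
  @SqHom M quoobj (@GrHom M quoobj qclass (fun n x => esym (quo_prE n x)))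
    (fun i x => esym (quo_SqE i x)).

End SubQuo.

Arguments qclass {M} P x.
Arguments sub_mk {M} P x Px.

Section Maps.

Definition gidh (M : sqspace) : grhom M M := @GrHom M M idfun (fun _ _ => erefl).

Section SubMap.
Variables (M N : sqspace) (P : submod M) (P' : submod N) (f : sqhom M N).
Hypothesis h : forall x, P x -> P' (f x).

Definition sub_fun (x : subobj P) : subobj P' := sub_mk P' (f (val x)) (h (sub_carP x)).

Lemma sub_fun_add : zmod_morphism sub_fun.
Proof. by move=> x y; apply: val_inj; rewrite /= raddfB. Qed.

Lemma sub_fun_pr n x : additive_of sub_fun_add (grpr n x) = grpr n (additive_of sub_fun_add x).
Proof. by apply: val_inj; rewrite /= ghom_pr. Qed.

Lemma sub_fun_Sq i x : additive_of sub_fun_add (Sq i x) = Sq i (additive_of sub_fun_add x).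
Proof. by apply: val_inj; rewrite /= hom_Sq. Qed.

Definition sub_hom : sqhom (subobj P) (subobj P') := @SqHom _ _ (GrHom sub_fun_pr) sub_fun_Sq.
End SubMap.

Section QuoMap.
Variables (M N : sqspace) (P : submod M) (P' : submod N) (f : grhom M N).
Hypothesis h : forall x, P x -> P' (f x).

Lemma quo_fun0 x : P x -> (qclass P' \o f) x = 0.
Proof. by move=> /h /cls_eq0. Qed.

Definition quo_fun : {additive quoobj P -> quoobj P'} := additive_of (quo_lift_add quo_fun0).

Lemma quo_funE x : quo_fun (qclass P x) = qclass P' (f x).
Proof. exact: (quo_liftE quo_fun0). Qed.

Lemma quo_fun_pr n x : quo_fun (grpr n x) = grpr n (quo_fun x).
Proof.
have [y <-] := cls_surj x.
have e (z : N) : grpr n (qclass P' z : quoobj P') = qclass P' (grpr n z) by exact: quo_prE.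
have -> : grpr n (qclass P y : quoobj P) = qclass P (grpr n y) by exact: quo_prE.
by rewrite quo_funE ghom_pr -e; congr (grpr n _); rewrite quo_funE.
Qed.

Definition quo_ghom : grhom (quoobj P) (quoobj P') := GrHom quo_fun_pr.
End QuoMap.

Section QuoHom.
Variables (M N : sqspace) (P : submod M) (P' : submod N) (f : sqhom M N).
Hypothesis h : forall x, P x -> P' (f x).

Lemma quo_hom_Sq i x : quo_ghom h (Sq i x) = Sq i (quo_ghom h x).
Proof.
have [y <-] := cls_surj x.
have e (z : N) : Sq i (qclass P' z : quoobj P') = qclass P' (Sq i z) by exact: quo_SqE.
have -> : Sq i (qclass P y : quoobj P) = qclass P (Sq i y) by exact: quo_SqE.
by rewrite [LHS]quo_funE hom_Sq -e; congr (Sq i _); rewrite [RHS]quo_funE.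
Qed.

Definition quo_hom : sqhom (quoobj P) (quoobj P') := SqHom quo_hom_Sq.
End QuoHom.
End Maps.

Record complex := Complex {
  cobj :> nat -> sqspace;
  cd : forall s, sqhom (cobj s) (cobj s.+1);
  cdd : forall s x, cd s.+1 (cd s x) = 0 }.

Record cmap (C D : complex) := Cmap {
  cfun :> forall s, sqhom (C s) (D s);
  cfunE : forall s x, cfun s.+1 (cd C s x) = cd D s (cfun s x) }.

Section Homology.
Variables (C : complex).

Definition cycles s : submod (C s).
Proof.
apply: (@Submod (C s) (fun x => cd C s x = 0)).
- by rewrite raddf0.
- by move=> x y hx hy; rewrite raddfD hx hy addr0.
- by move=> n x hx; rewrite ghom_pr hx raddf0.
- by move=> i x hx; rewrite hom_Sq hx raddf0.
Defined.

Definition is_boundary s : C s -> Prop :=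
  match s with
  | 0%N => fun x => x = 0
  | s'.+1 => fun x => exists y, x = cd C s' y
  end.

Definition boundaries s : submod (subobj (cycles s)).
Proof.
apply: (@Submod (subobj (cycles s)) (fun z => is_boundary (val z))).
- by case: s => [|s] //=; exists 0; rewrite raddf0.
- case: s => [|s] /= x y; first by move=> -> ->; rewrite addr0.
  by move=> [a ->] [b ->]; exists (a + b); rewrite raddfD.
- case: s => [|s] /= n x; first by move=> ->; rewrite raddf0.
  by move=> [a ->]; exists (grpr n a); rewrite ghom_pr.
- case: s => [|s] /= i x; first by move=> ->; rewrite raddf0.
  by move=> [a ->]; exists (Sq i a); rewrite hom_Sq.
Defined.

Definition homology s : sqspace := quoobj (boundaries s).
End Homology.

Section HomologyMap.
Variables (C D : complex) (f : cmap C D).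

Lemma cmap_cycles s x : cycles C s x -> cycles D s (f s x).
Proof. by rewrite /= -cfunE => ->; rewrite raddf0. Qed.

Lemma cmap_boundaries s (x : subobj (cycles C s)) :
  boundaries C s x -> boundaries D s (sub_hom (@cmap_cycles s) x).
Proof.
case: s x => [|s] x /=; first by move=> ->; rewrite raddf0.
by move=> [y ->]; exists (f s y); rewrite cfunE.
Qed.

Definition homology_map s : sqhom (homology C s) (homology D s) := quo_hom (@cmap_boundaries s).
End HomologyMap.

Section Omega.
Variable M : sqspace.

(* Omega^oo M is the largest unstable submodule of M, i.e. the union of all of
   them; see [Omega_unstable] and [Omega_largest]. *)
Definition in_Omega (x : M) := exists2 N : submod M, unstable (subobj N) & N x.

Lemma unstable_subP (N : submod M) : unstable (subobj N) <->
  forall (n : int) (i : nat) (x : M), N x -> homog n x -> n < 2 * i%:Z -> Sq i x = 0.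
Proof.
split=> h n i x.
  move=> Nx hx ni; have := h n i (sub_mk N x Nx) _ ni.
  by move=> /(_ _)/(congr1 val); apply; apply: val_inj.
move=> hx ni; apply: val_inj; apply: (h n i _ (sub_carP x) _ ni).
exact: (congr1 val hx).
Qed.

Definition zero_submod : submod M.
Proof.
apply: (@Submod M (fun x => x = 0)) => //.
- by move=> x y -> ->; rewrite addr0.
- by move=> n x ->; rewrite raddf0.
- by move=> n x ->; rewrite raddf0.
Defined.

Definition sum_submod (N1 N2 : submod M) : submod M.
Proof.
apply: (@Submod M (fun x => exists y z, [/\ N1 y, N2 z & x = y + z])).
- by exists 0, 0; split; rewrite ?addr0 //; apply: sub_in0.
- move=> x y [a [b [ha hb ->]]] [a' [b' [ha' hb' ->]]]; exists (a + a'), (b + b').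
  by split; [apply: sub_inD|apply: sub_inD|rewrite addrACA].
- move=> n x [a [b [ha hb ->]]]; exists (grpr n a), (grpr n b).
  by split; [apply: sub_in_pr|apply: sub_in_pr|rewrite raddfD].
- move=> n x [a [b [ha hb ->]]]; exists (Sq n a), (Sq n b).
  by split; [apply: sub_in_Sq|apply: sub_in_Sq|rewrite raddfD].
Defined.

Definition Omega_sub : submod M.
Proof.
apply: (@Submod M in_Omega).
- exists zero_submod => //; apply/unstable_subP => n i x /= -> _ _.
  by rewrite raddf0.
- move=> x y [N1 u1 h1] [N2 u2 h2]; exists (sum_submod N1 N2); last by exists x, y.
  move/unstable_subP in u1; move/unstable_subP in u2.
  apply/unstable_subP => n i z [a [b [ha hb ->]]] hz ni.
  rewrite -hz !raddfD /=.
  rewrite (u1 n i (grpr n a)) ?(u2 n i (grpr n b)) ?addr0 //;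
    by [apply: sub_in_pr | rewrite /homog prpr eqxx].
- by move=> n x [N u h]; exists N => //; apply: sub_in_pr.
- by move=> n x [N u h]; exists N => //; apply: sub_in_Sq.
Defined.

Definition Omega : sqspace := subobj Omega_sub.

Lemma Omega_unstable : unstable Omega.
Proof.
apply/unstable_subP => n i x [N uN Nx]; move/unstable_subP: uN; exact.
Qed.

Lemma Omega_largest (N : submod M) : unstable (subobj N) -> forall x, N x -> Omega_sub x.
Proof. by move=> u x h; exists N. Qed.
End Omega.

Section OmegaMap.
Variables (M N : sqspace) (f : sqhom M N).

Definition image_submod (P : submod M) : submod N.
Proof.
apply: (@Submod N (fun x => exists2 y, P y & x = f y)).
- by exists 0; [apply: sub_in0|rewrite raddf0].
- by move=> x y [a ha ->] [b hb ->]; exists (a + b); [apply: sub_inD|rewrite raddfD].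
- by move=> n x [a ha ->]; exists (grpr n a); [apply: sub_in_pr|rewrite ghom_pr].
- by move=> n x [a ha ->]; exists (Sq n a); [apply: sub_in_Sq|rewrite hom_Sq].
Defined.

Lemma Omega_sub_map x : Omega_sub M x -> Omega_sub N (f x).
Proof.
move=> [P /unstable_subP uP Px]; exists (image_submod P); last by exists x.
apply/unstable_subP => n i y [z Pz ->] hy ni.
rewrite -hy -ghom_pr -hom_Sq (uP n i) ?raddf0 //; first exact: sub_in_pr.
by rewrite /homog prpr eqxx.
Qed.

Definition Omega_map : sqhom (Omega M) (Omega N) := sub_hom Omega_sub_map.
End OmegaMap.

(* The binomial coefficient of an arbitrary integer n, the coefficient of t^k
   in (1 + t)^n, up to sign: the sign is irrelevant modulo 2. *)
Definition binz (n k : int) : nat :=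
  match k, n with
  | Negz _, _ => 0
  | Posz k, Posz n => 'C(n, k)
  | Posz k, Negz n => 'C(n + k, k)
  end.

Lemma binz_lt0 n k : k < 0 -> binz n k = 0%N.
Proof. by case: k. Qed.

(* [susp k] is the k-fold suspension (k in Z); sigma^k x is represented by x
   itself, only the grading is shifted. *)
Section Shift.
Variables (k : int) (M : sqspace).

Definition susp_pr (n : int) : {additive M -> M} := grpr (n - k).

Lemma susp_prpr m n x : susp_pr m (susp_pr n x) = if m == n then susp_pr n x else 0.
Proof. by rewrite /susp_pr prpr (inj_eq (addIr _)). Qed.

Lemma susp_prsum x : exists2 s : seq int, uniq s & x = \sum_(n <- s) susp_pr n x.
Proof.
apply: prsum_of => [|y hy|y]; first exact: susp_prpr.
  by apply: pr_sep => n; rewrite -(hy (n + k)) /susp_pr addrK.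
have [N hN] := pr_bnd y; exists (N + `|k|)%N => n hn; apply: hN; lia.
Qed.

Lemma susp_prSq i n x : susp_pr (n - i%:Z) (Sq i x) = Sq i (susp_pr n x).
Proof. by rewrite /susp_pr addrAC prSq. Qed.

Definition susp : sqspace := SqSpace (@addxx M) susp_prpr susp_prsum susp_prSq.
End Shift.

Lemma susp_steenrod k M : steenrod_module M -> steenrod_module (susp k M).
Proof. by []. Qed.

Lemma susp_orbit k (M : sqspace) (x y : M) :
  @cyclic (susp k M) x y -> cyclic x y.
Proof.
elim=> [||a b _ ha _ hb|i a _ ha]; first exact: orbit_gen.
- exact: orbit_zero.
- exact: orbit_add ha hb.
- exact: orbit_Sq ha.
Qed.

Lemma susp_lf k M : locally_finite M -> locally_finite (susp k M).
Proof.
by move=> h x; apply: sub_finite_set (h x) => y /=; apply: susp_orbit.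
Qed.

Definition lfsusp k (M : lfAmod) : lfAmod :=
  LfAmod (@susp_steenrod k M (lf_steenrod M)) (@susp_lf k M (@lf_fin M)).

Definition susp_ghom k (M N : sqspace) (f : grhom M N) : grhom (susp k M) (susp k N) :=
  @GrHom (susp k M) (susp k N) f (fun n x => ghom_pr f (n - k) x).

Definition susp_hom k (M N : sqspace) (f : sqhom M N) : sqhom (susp k M) (susp k N) :=
  @SqHom (susp k M) (susp k N) (susp_ghom k f) (hom_Sq f).

(* [FQ M] is spanned by the symbols Q^i x (i in Z, x in M, additive in x): a
   finitely supported f : int -> M stands for the sum of the Q^n (f n). The
   Steenrod operations on it are given by the Nishida relations, see [Sq_Qop],
   and the degree of Q^i x is i + |x|, see [grpr_Qop]. *)
Section FreeQ.
Variable M : sqspace.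

Definition finsupp (f : int -> M) : Prop :=
  exists N : nat, forall n : int, (N < `|n|)%N -> f n = 0.

Definition fsp : {pred int -> M} := fun f => `[< finsupp f >].

Lemma fspP f : reflect (finsupp f) (f \in fsp).
Proof. exact: asboolP. Qed.

Lemma fsp_closed : zmod_closed fsp.
Proof.
split=> [|f g /fspP[N hN] /fspP[N' hN']]; apply/fspP; first by exists 0%N.
exists (maxn N N') => n; rewrite gtn_max => /andP[h1 h2].
have -> : (f - g) n = f n - g n by [].
by rewrite hN // hN' // subrr.
Qed.

HB.instance Definition _ := GRing.isZmodClosed.Build (int -> M) fsp fsp_closed.

Record FQ_car := FQCar { coef :> int -> M; _ : coef \in fsp }.

HB.instance Definition _ := [isSub for coef].
HB.instance Definition _ := [Choice of FQ_car by <:].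
HB.instance Definition _ := [SubChoice_isSubZmodule of FQ_car by <:].

Lemma FQ_eq (f g : FQ_car) : (forall n, f n = g n) -> f = g.
Proof. by move=> h; apply: val_inj; apply/funext. Qed.

Lemma coef0 n : (0 : FQ_car) n = 0. Proof. by []. Qed.
Lemma coefB (f g : FQ_car) n : (f - g) n = f n - g n. Proof. by []. Qed.
Lemma coefD (f g : FQ_car) n : (f + g) n = f n + g n. Proof. by []. Qed.
Lemma coef_sum (I : Type) (r : seq I) (F : I -> FQ_car) n :
  (\sum_(i <- r) F i) n = \sum_(i <- r) F i n.
Proof. by elim/big_rec2: _ => // i y1 y2 _ <-; rewrite coefD. Qed.
Lemma coefMn (f : FQ_car) m n : (f *+ m) n = f n *+ m.
Proof. by elim: m => // m IH; rewrite !mulrS coefD IH. Qed.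

Lemma coef_supp (f : FQ_car) : finsupp f. Proof. exact/fspP/(valP f). Qed.

Definition FQ_mk f (h : finsupp f) : FQ_car := FQCar (introT (fspP f) h).

Lemma FQ_pr_supp (n : int) (f : FQ_car) : finsupp (fun m => grpr (n - m) (f m)).
Proof.
by have [N h] := coef_supp f; exists N => m hm; rewrite h // raddf0.
Qed.

Lemma FQ_pr_add n : zmod_morphism (fun f => FQ_mk (FQ_pr_supp n f)).
Proof. by move=> f g; apply: FQ_eq => m; rewrite /= raddfB. Qed.
Definition FQ_pr n := additive_of (FQ_pr_add n).

Lemma FQ_Sq_supp (r : nat) (f : FQ_car) : finsupp (fun n : int =>
  \sum_(j < r.+1) Sq j (f (n + r%:Z - j%:Z))
     *+ binz (n - j%:Z) (r%:Z - 2 * j%:Z)).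
Proof.
have [N h] := coef_supp f; exists (N + r)%N => n hn.
by apply: big1 => j _; rewrite h ?raddf0 ?mul0rn //; have := ltn_ord j; lia.
Qed.

Lemma FQ_Sq_add r : zmod_morphism (fun f => FQ_mk (FQ_Sq_supp r f)).
Proof.
move=> f g; apply: FQ_eq => m; rewrite coefB /= -sumrB.
by apply: eq_bigr => j _; rewrite raddfB mulrnBl.
Qed.
Definition FQ_Sq r := additive_of (FQ_Sq_add r).

Lemma FQ_addxx (f : FQ_car) : f + f = 0.
Proof. by apply: FQ_eq => n; rewrite coefD addxx. Qed.

Lemma FQ_prpr m n f : FQ_pr m (FQ_pr n f) = if m == n then FQ_pr n f else 0.
Proof.
by apply: FQ_eq => k; rewrite /= prpr (inj_eq (addIr _)); case: ifP.
Qed.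

Lemma FQ_prsum f : exists2 s : seq int, uniq s & f = \sum_(n <- s) FQ_pr n f.
Proof.
apply: prsum_of => [|g h|g]; first exact: FQ_prpr.
  apply: FQ_eq => m; apply: pr_sep => n.
  by have := congr1 (fun u : FQ_car => u m) (h (n + m)); rewrite /= addrK.
have [N hN] := coef_supp g.
have [B hB] : exists B : nat, forall m, m \in window N ->
    forall n : int, (B < `|n|)%N -> grpr n (g m) = 0.
  elim: (window N) => [|m w [B hB]]; first by exists 0%N.
  have [B' hB'] := pr_bnd (g m); exists (maxn B B') => k.
  rewrite in_cons => /orP[/eqP->|kw] n hn; first by apply: hB'; lia.
  by apply: hB => //; lia.
exists (B + N)%N => n hn; apply: FQ_eq => m; rewrite /=.
case: (leqP `|m| N) => hm; last by rewrite hN // raddf0.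
by rewrite (hB m) ?mem_window //; lia.
Qed.

Lemma FQ_prSq i n f : FQ_pr (n - i%:Z) (FQ_Sq i f) = FQ_Sq i (FQ_pr n f).
Proof.
apply: FQ_eq => m; rewrite /= raddf_sum /=; apply: eq_bigr => j _.
by rewrite raddfMn prSqE; congr (Sq _ (grpr _ _) *+ _); lia.
Qed.

Definition FQ : sqspace := SqSpace FQ_addxx FQ_prpr FQ_prsum FQ_prSq.

Lemma Q_supp (i : int) (x : M) : finsupp (fun n => if n == i then x else 0).
Proof. by exists `|i|%N => n hn; case: eqP hn => // ->; rewrite ltnn. Qed.

Lemma Q_add i : zmod_morphism (fun x => FQ_mk (Q_supp i x)).
Proof.
by move=> x y; apply: FQ_eq => n; rewrite coefB /=; case: ifP; rewrite ?subrr.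
Qed.

Definition Qop (i : int) : {additive M -> FQ} := additive_of (Q_add i).

Lemma coefQ i x n : (Qop i x : FQ_car) n = if n == i then x else 0.
Proof. by []. Qed.

Lemma grpr_Qop i n x : grpr n (Qop i x) = Qop i (grpr (n - i) x).
Proof.
apply: FQ_eq => m; rewrite /=.
by case: eqP => [->|] //; rewrite raddf0.
Qed.

Lemma Sq_Qop s r x : Sq r (Qop s x) =
  \sum_(i < r.+1) Qop (s - r%:Z + i%:Z) (Sq i x)
     *+ binz (s - r%:Z) (r%:Z - 2 * i%:Z).
Proof.
apply: FQ_eq => n; rewrite coef_sum /=; apply: eq_bigr => i _.
rewrite coefMn /=.
have -> : (n + r%:Z - i%:Z == s) = (n == s - r%:Z + i%:Z) by lia.
case: eqP => [->|_]; last by rewrite raddf0 !mul0rn.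
by rewrite addrK.
Qed.

Lemma FQ_gen (f : FQ) : exists N, f = \sum_(n <- window N) Qop n (coef f n).
Proof.
have [N h] := coef_supp f; exists N; apply: FQ_eq => m; rewrite coef_sum.
case: (boolP (m \in window N)) => hm; last first.
  rewrite h; last by rewrite mem_window -ltnNge in hm.
  rewrite big_seq big1 // => n hn /=; case: eqP => // e.
  by rewrite e hn in hm.
rewrite (bigD1_seq m) ?window_uniq //= eqxx big1 ?addr0 // => n.
by rewrite eq_sym => /negPf ->.
Qed.
End FreeQ.

Section FreeQMap.
Variables (M N : sqspace).

Section GMap.
Variable (f : grhom M N).
Lemma FQ_map_supp (u : FQ M) : finsupp (fun n => f (coef u n)).
Proof. by have [B h] := coef_supp u; exists B => n hn; rewrite h // raddf0. Qed.

Lemma FQ_map_add : zmod_morphism (fun u => FQ_mk (FQ_map_supp u) : FQ N).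
Proof. by move=> u v; apply: FQ_eq => n; rewrite /= raddfB. Qed.

Lemma FQ_map_pr n u : additive_of FQ_map_add (grpr n u) = grpr n (additive_of FQ_map_add u).
Proof. by apply: FQ_eq => m; rewrite /= ghom_pr. Qed.

Definition FQ_gmap : grhom (FQ M) (FQ N) := GrHom FQ_map_pr.

Lemma FQ_gmapQ i x : FQ_gmap (Qop M i x) = Qop N i (f x).
Proof. by apply: FQ_eq => n; rewrite /=; case: eqP; rewrite ?raddf0. Qed.
End GMap.

Variable f : sqhom M N.
Lemma FQ_map_Sq i u : FQ_gmap f (Sq i u) = Sq i (FQ_gmap f u).
Proof.
apply: FQ_eq => m; rewrite /= raddf_sum; apply: eq_bigr => j _.
by rewrite raddfMn hom_Sq.
Qed.
Definition FQ_hom : sqhom (FQ M) (FQ N) := SqHom FQ_map_Sq.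
End FreeQMap.

(* Spanned by the Q^I x with l(I) = s. *)
Fixpoint FQn (s : nat) (M : sqspace) : sqspace :=
  if s is s'.+1 then FQ (FQn s' M) else M.

Fixpoint FQn_hom s (M N : sqspace) (f : sqhom M N) : sqhom (FQn s M) (FQn s N) :=
  if s is s'.+1 then FQ_hom (FQn_hom s' f) else f.

(* The subspace of [FQn s M] spanned by the unstable and Adem relations, in any
   position of the word Q^I. In the Adem relation for Q^a Q^b the coefficient is
   zero when i is outside the window, see [Adem_window]. *)
Inductive Qrel (M : sqspace) : forall s, FQn s M -> Prop :=
| Qrel_zero s : Qrel (0 : FQn s M)
| Qrel_add s (u v : FQn s M) : Qrel u -> Qrel v -> Qrel (u + v)
| Qrel_unstable s (i n : int) (z : FQn s M) :
    homog n z -> i < n -> @Qrel M s.+1 (Qop _ i z)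
| Qrel_Adem s (a b : int) (z : FQn s M) :
    @Qrel M s.+2 (Qop _ a (Qop _ b z)
       - \sum_(i <- window (`|a| + `|b|).+1)
            Qop _ (a + b - i) (Qop _ i z) *+ binz (i - b - 1) (2 * i - a))
| Qrel_Q s (i : int) (u : FQn s M) : Qrel u -> @Qrel M s.+1 (Qop _ i u).

Lemma Adem_window (a b i : int) :
  i \notin window (`|a| + `|b|).+1 -> binz (i - b - 1) (2 * i - a) = 0%N.
Proof.
rewrite mem_window => h; rewrite /binz.
case ek: (2 * i - a) => [k|k] //; case em: (i - b - 1) => [m|m].
  by rewrite bin_small //; lia.
by exfalso; move: em; rewrite NegzE; lia.
Qed.

Section Rel.
Variable M : sqspace.

Lemma Qrel_pr s n (u : FQn s M) : Qrel u -> Qrel (grpr n u).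
Proof.
move=> h; elim: h n => {s u} [s n|s u v _ hu _ hv n|s i m z hz im n|s a b z n|s i u _ hu n].
- rewrite raddf0; exact: Qrel_zero.
- rewrite raddfD; exact: Qrel_add.
- rewrite grpr_Qop -hz prpr; case: eqP => [_|_].
    by rewrite hz; apply: Qrel_unstable hz im.
  rewrite raddf0; exact: Qrel_zero.
- set w := window _.
  suff -> : grpr n (Qop _ a (Qop _ b z) - \sum_(i <- w)
      Qop _ (a + b - i) (Qop _ i z) *+ binz (i - b - 1) (2 * i - a)) =
    Qop _ a (Qop _ b (grpr (n - a - b) z)) - \sum_(i <- w)
      Qop _ (a + b - i) (Qop _ i (grpr (n - a - b) z)) *+ binz (i - b - 1) (2 * i - a).
    exact: Qrel_Adem.
  rewrite raddfB !grpr_Qop raddf_sum; congr (_ - _); apply: eq_bigr => i _.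
  by rewrite raddfMn !grpr_Qop; congr (Qop _ _ (Qop _ _ (grpr _ _)) *+ _); lia.
- rewrite grpr_Qop; exact: Qrel_Q.
Qed.

End Rel.

(* The Nishida relations pass to the quotient by the unstable and Adem relations. *)
Definition Nishida_stable :=
  forall (M : lfAmod) s (r : nat) (u : FQn s M), Qrel u -> Qrel (Sq r u).

Lemma lf_Sq_eq0 (M : lfAmod) (x : M) :
  exists N, forall i, (N <= i)%N -> Sq i x = 0.
Proof.
have /finite_seqP [t et] := @lf_fin M x.
have [B hB] : exists B : nat, forall y, y \in t ->
    forall n : int, (B < `|n|)%N -> grpr n y = 0.
  elim: (t) => [|m w [B hB]]; first by exists 0%N.
  have [B' hB'] := pr_bnd m; exists (maxn B B') => k.
  rewrite in_cons => /orP[/eqP->|kw] n hn; first by apply: hB'; lia.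
  by apply: hB => //; lia.
have inT y : cyclic x y -> y \in t.
  by move=> h; have : [set z | cyclic x z]%classic y by []; rewrite et.
exists (B + B).+1 => i hi; apply: pr_sep => n.
case: (leqP `|n| B) => hn.
  rewrite prSqE (hB x) ?raddf0 //; first by apply/inT/orbit_gen.
  by lia.
by apply: hB hn; apply/inT/orbit_Sq/orbit_gen.
Qed.

(* [dFQ s] sends Q^I x to the sum over i >= 0 of Q^I Q^(i-1) (x Sq^i), for x in
   M placed in degree |x| + k on the left and |x| + k + 1 on the right; see
   [dR_Qword] for the resulting formula on R_s M. *)
Section Differential.
Variables (M : lfAmod) (k k' : int) (kk : k' = k + 1).

Definition dcoef (x : M) (n : int) : M := if n + 1 is Posz i then Sq i x else 0.

Lemma dcoef_supp x : finsupp (dcoef x : int -> susp k' M).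
Proof.
have [N h] := lf_Sq_eq0 x; exists N => n hn; rewrite /dcoef.
by case e: (n + 1) => [i|i] //; rewrite h //; lia.
Qed.

Lemma dFQ0_add : zmod_morphism (fun x : susp k M => FQ_mk (dcoef_supp x) : FQ (susp k' M)).
Proof.
move=> x y; apply: FQ_eq => n; rewrite coefB /= /dcoef.
by case: (n + 1) => [i|i]; rewrite ?raddfB ?subrr.
Qed.

Lemma dFQ0_pr n (x : susp k M) : additive_of dFQ0_add (grpr n x) = grpr n (additive_of dFQ0_add x).
Proof.
apply: FQ_eq => m; rewrite /= /dcoef /susp_pr.
case e: (m + 1) => [i|i]; last by rewrite raddf0.
rewrite prSqE; have -> : n - m - k' + i%:Z = n - k by lia.
by [].
Qed.

Definition dFQ0 : grhom (susp k M) (FQ (susp k' M)) := GrHom dFQ0_pr.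

Fixpoint dFQ s : grhom (FQn s (susp k M)) (FQn s.+1 (susp k' M)) :=
  if s is s'.+1 then FQ_gmap (dFQ s') else dFQ0.

Lemma dFQ0E (x : M) N : (forall i, (N <= i)%N -> Sq i x = 0) ->
  dFQ0 x = \sum_(i < N) Qop (susp k' M) (i%:Z - 1) (Sq i x).
Proof.
move=> h; apply: FQ_eq => n; rewrite coef_sum /= /dcoef.
case e: (n + 1) => [j|j]; last first.
  by rewrite big1 // => i _ /=; case: eqP => // en; lia.
case: (leqP N j) => hj.
  by rewrite h // big1 // => i _ /=; case: eqP => // en; have := ltn_ord i; lia.
rewrite (bigD1 (Ordinal hj)) //= big1 => [|i ij]; last first.
  case: eqP => // en; case/eqP: ij; apply: val_inj => /=; lia.
by case: eqP => [_|en]; [rewrite addr0|lia].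
Qed.

Lemma dFQ_Q s i (z : FQn s (susp k M)) : dFQ s.+1 (Qop _ i z) = Qop _ i (dFQ s z).
Proof. exact: FQ_gmapQ. Qed.

Lemma dFQ_rel s (u : FQn s (susp k M)) : Qrel u -> Qrel (dFQ s u).
Proof.
elim=> {s u} [s|s u v _ hu _ hv|s i m z hz im|s a b z|s i u _ hu].
- rewrite raddf0; exact: Qrel_zero.
- rewrite raddfD; exact: Qrel_add.
- rewrite dFQ_Q; apply: Qrel_unstable im.
  by rewrite /homog -ghom_pr hz.
- rewrite raddfB raddf_sum !dFQ_Q.
  under eq_bigr do rewrite raddfMn !dFQ_Q.
  exact: Qrel_Adem.
- rewrite dFQ_Q; exact: Qrel_Q.
Qed.
End Differential.

Lemma FQn_homQ (M N : sqspace) (f : sqhom M N) s i (z : FQn s M) :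
  FQn_hom s.+1 f (Qop _ i z) = Qop _ i (FQn_hom s f z).
Proof. exact: FQ_gmapQ. Qed.

Lemma FQn_hom_Qrel (M N : sqspace) (f : sqhom M N) s (u : FQn s M) :
  Qrel u -> Qrel (FQn_hom s f u).
Proof.
elim=> {s u} [s|s u v _ hu _ hv|s i m z hz im|s a b z|s i u _ hu].
- rewrite raddf0; exact: Qrel_zero.
- rewrite raddfD; exact: Qrel_add.
- rewrite FQn_homQ; apply: Qrel_unstable im.
  by rewrite /homog -ghom_pr hz.
- rewrite raddfB raddf_sum !FQn_homQ.
  under eq_bigr do rewrite raddfMn !FQn_homQ.
  exact: Qrel_Adem.
- rewrite FQn_homQ; exact: Qrel_Q.
Qed.

Section Rs.
Hypothesis st : Nishida_stable.

Definition Qrel_submod (s : nat) (M : lfAmod) : submod (FQn s M) :=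
  @Submod (FQn s M) (@Qrel M s) (@Qrel_zero M s) (@Qrel_add M s)
    (fun n u => @Qrel_pr M s n u) (fun r u => @st M s r u).

(* [calR s M] is the quotient <Q^I x | l(I) = s> / (unstable, Adem), with the
   Nishida action, and R_s = Sigma calR_s Sigma^(s-1). *)
Definition calR (s : nat) (M : lfAmod) : sqspace := quoobj (Qrel_submod s M).

Definition R_ (s : nat) (M : lfAmod) : sqspace := susp 1 (calR s (lfsusp (s%:Z - 1) M)).

Lemma deg_succ (s : nat) : s.+1%:Z - 1 = s%:Z - 1 + 1.
Proof. by lia. Qed.

Definition dR (s : nat) (M : lfAmod) : grhom (R_ s M) (R_ s.+1 M) :=
  susp_ghom 1 (@quo_ghom _ _ (Qrel_submod s (lfsusp (s%:Z - 1) M))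
    (Qrel_submod s.+1 (lfsusp (s.+1%:Z - 1) M)) (dFQ M (deg_succ s) s)
    (@dFQ_rel M _ _ (deg_succ s) s)).

Definition lfsusp_hom k (M N : lfAmod) (f : sqhom M N) :
  sqhom (lfsusp k M) (lfsusp k N) := susp_hom k f.

Definition Rmap (s : nat) (M N : lfAmod) (f : sqhom M N) : sqhom (R_ s M) (R_ s N) :=
  susp_hom 1 (@quo_hom _ _ (Qrel_submod s (lfsusp (s%:Z - 1) M))
    (Qrel_submod s (lfsusp (s%:Z - 1) N)) (FQn_hom s (lfsusp_hom _ f))
    (@FQn_hom_Qrel _ _ _ s)).

Lemma dR_cls s (M : lfAmod) (u : FQn s (lfsusp (s%:Z - 1) M)) :
  dR s M (qclass (Qrel_submod s (lfsusp (s%:Z - 1) M)) u) =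
  qclass (Qrel_submod s.+1 (lfsusp (s.+1%:Z - 1) M)) (dFQ M (deg_succ s) s u).
Proof.
exact: (@quo_funE _ _ (Qrel_submod s (lfsusp (s%:Z - 1) M))
  (Qrel_submod s.+1 (lfsusp (s.+1%:Z - 1) M)) (dFQ M (deg_succ s) s)
  (@dFQ_rel M _ _ (deg_succ s) s) u).
Qed.

Lemma Rmap_cls s (M N : lfAmod) (f : sqhom M N) (u : FQn s (lfsusp (s%:Z - 1) M)) :
  Rmap s f (qclass (Qrel_submod s (lfsusp (s%:Z - 1) M)) u) =
  qclass (Qrel_submod s (lfsusp (s%:Z - 1) N)) (FQn_hom s (lfsusp_hom _ f) u).
Proof.
exact: (@quo_funE _ _ (Qrel_submod s (lfsusp (s%:Z - 1) M))
  (Qrel_submod s (lfsusp (s%:Z - 1) N)) (FQn_hom s (lfsusp_hom _ f))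
  (@FQn_hom_Qrel _ _ _ s) u).
Qed.

End Rs.

(* (R_* M, d) is a chain complex in M for all M. The first three fields are the
   well-definedness of R_s : M -> M, i.e. the Nishida action descends to R_s M and
   makes it a locally finite A-module; the map d is linear and degree-preserving
   by construction. The formula for d determines it on the whole of R_s M. *)
Record R_is_complex : Prop := {
  Rstable : Nishida_stable;
  R_steenrod : forall s (M : lfAmod), steenrod_module (R_ Rstable s M);
  R_lf : forall s (M : lfAmod), locally_finite (R_ Rstable s M);
  dR_Sq : forall s (M : lfAmod) i x, dR Rstable s M (Sq i x) = Sq i (dR Rstable s M x);
  dR_dR : forall s (M : lfAmod) x, dR Rstable s.+1 M (dR Rstable s M x) = 0 }.

Definition Rcomplex (C : R_is_complex) (M : lfAmod) : complex :=
  @Complex (fun s => R_ (Rstable C) s M) (fun s => SqHom (@dR_Sq C s M))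
    (fun s => @dR_dR C s M).

Lemma dFQ_nat (M N : lfAmod) (f : sqhom M N) k k' (kk : k' = k + 1) s
    (u : FQn s (susp k M)) :
  FQn_hom s.+1 (lfsusp_hom k' f) (dFQ M kk s u) =
  dFQ N kk s (FQn_hom s (lfsusp_hom k f) u).
Proof.
elim: s u => [|s IH] u; last by apply: FQ_eq => n; apply: IH.
apply: FQ_eq => n; rewrite /= /dcoef.
by case: (n + 1) => [i|i]; [rewrite hom_Sq|rewrite raddf0].
Qed.

Lemma Rmap_d (C : R_is_complex) (M N : lfAmod) (f : sqhom M N) s (x : R_ (Rstable C) s M) :
  Rmap (Rstable C) s.+1 f (dR (Rstable C) s M x) =
  dR (Rstable C) s N (Rmap (Rstable C) s f x).
Proof.
have [u <-] := cls_surj x.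
rewrite !(dR_cls, Rmap_cls); congr (qclass _ _); exact: (dFQ_nat f (deg_succ s)).
Qed.

Definition Rcmap (C : R_is_complex) (M N : lfAmod) (f : sqhom M N) :
  cmap (Rcomplex C M) (Rcomplex C N) :=
  @Cmap (Rcomplex C M) (Rcomplex C N) (fun s => Rmap (Rstable C) s f)
    (@Rmap_d C M N f).

Section Qword.
Variable M : sqspace.
Fixpoint Qword (I : seq int) (x : M) : FQn (size I) M :=
  if I is i :: I' then Qop _ i (Qword I' x) else x.
Fixpoint Qword1 (I : seq int) (j : int) (x : M) : FQn (size I).+1 M :=
  if I is i :: I' then Qop _ i (Qword1 I' j x) else Qop _ j x.
End Qword.

Lemma dR_Qword (st : Nishida_stable) (M : lfAmod) (I : seq int) (x : M) (N : nat) :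
  (forall i, (N <= i)%N -> Sq i x = 0) ->
  let s := size I in
  dR st s M (qclass (Qrel_submod st s (lfsusp (s%:Z - 1) M))
              (@Qword (lfsusp (s%:Z - 1) M) I x)) =
  \sum_(i < N) qclass (Qrel_submod st s.+1 (lfsusp (s.+1%:Z - 1) M))
              (@Qword1 (lfsusp (s.+1%:Z - 1) M) I (i%:Z - 1) (Sq i x)).
Proof.
move=> h s; etransitivity; first exact: dR_cls.
rewrite -raddf_sum; congr (qclass _ _); rewrite {}/s.
move: (deg_succ (size I)); move: ((size I)%:Z - 1) ((size I).+1%:Z - 1) => k k' kk.
elim: I => [|i I IH] /=; first exact: dFQ0E.
etransitivity; first exact: dFQ_Q.
by rewrite IH raddf_sum.
Qed.

Definition injective_object (J : lfAmod) :=
  forall (A B : lfAmod) (i : sqhom A B) (f : sqhom A J), injective i ->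
    exists g : sqhom B J, forall a, g (i a) = f a.

(* Injective resolutions in M, and maps of resolutions over f. The derived functor
   Omega^oo_s M is the s-th cohomology of [Omega_complex I] for an injective
   resolution I of M, and Omega^oo_s f is induced by a map of resolutions over f.
   Every M has such a resolution: see [enough_injectives]. *)
Record inj_resolution (M : lfAmod) := InjResolution {
  ires :> nat -> lfAmod;
  ires_d : forall s, sqhom (ires s) (ires s.+1);
  ires_aug : sqhom M (ires 0);
  ires_aug_inj : injective ires_aug;
  ires_exact0 : forall x, ires_d 0 x = 0 <-> exists y, x = ires_aug y;
  ires_exact : forall s x, ires_d s.+1 x = 0 <-> exists y, x = ires_d s y;
  ires_inj : forall s, injective_object (ires s) }.

Record res_map (M N : lfAmod) (f : sqhom M N) (I : inj_resolution M)
    (J : inj_resolution N) := ResMap {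
  rmap :> forall s, sqhom (I s) (J s);
  rmap_aug : forall x, rmap 0 (ires_aug I x) = ires_aug J (f x);
  rmap_d : forall s x, rmap s.+1 (ires_d I s x) = ires_d J s (rmap s x) }.

Section OmegaComplex.

Lemma Omega_dd M (I : inj_resolution M) s (x : Omega (I s)) :
  Omega_map (ires_d I s.+1) (Omega_map (ires_d I s) x) = 0.
Proof. by apply: val_inj; apply/ires_exact; exists (val x). Qed.

Definition Omega_complex (M : lfAmod) (I : inj_resolution M) : complex :=
  @Complex (fun s => Omega (I s)) (fun s => Omega_map (ires_d I s))
    (@Omega_dd M I).

Variables (M N : lfAmod) (f : sqhom M N) (I : inj_resolution M) (J : inj_resolution N).
Variable F : res_map f I J.

Lemma Omega_rmap_d s (x : Omega_complex I s) :
  Omega_map (F s.+1) (cd (Omega_complex I) s x) =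
  cd (Omega_complex J) s (Omega_map (F s) x).
Proof. by apply: val_inj; rewrite /= rmap_d. Qed.

Definition Omega_cmap : cmap (Omega_complex I) (Omega_complex J) :=
  @Cmap (Omega_complex I) (Omega_complex J) (fun s => Omega_map (F s)) Omega_rmap_d.

End OmegaComplex.


Section Cofree.

Lemma orbit_hom (M N : sqspace) (f : sqhom M N) x y :
  cyclic (f x) y -> exists2 z, cyclic x z & y = f z.
Proof.
elim=> [||a b _ [a' ha ->] _ [b' hb ->]|i a _ [a' ha ->]].
- by exists x => //; apply: orbit_gen.
- by exists 0; [apply: orbit_zero|rewrite raddf0].
- by exists (a' + b'); [apply: orbit_add|rewrite raddfD].
- by exists (Sq i a'); [apply: orbit_Sq|rewrite hom_Sq].
Qed.

Lemma hom_orbit (M N : sqspace) (f : sqhom M N) x y :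
  cyclic x y -> cyclic (f x) (f y).
Proof.
elim=> [||a b _ ha _ hb|i a _ ha].
- exact: orbit_gen.
- rewrite raddf0; exact: orbit_zero.
- rewrite raddfD; exact: orbit_add.
- rewrite hom_Sq; exact: orbit_Sq.
Qed.

Lemma orbit_hom_finite (M N : sqspace) (f : sqhom M N) x :
  finite_set [set y | cyclic x y] -> finite_set [set y | cyclic (f x) y].
Proof.
move=> h; apply: sub_finite_set (finite_image f h) => y /= /orbit_hom [z hz ->].
by exists z.
Qed.

Section Comp.
Variables (L M N : sqspace) (g : sqhom M N) (f : sqhom L M).
Lemma comp_add : zmod_morphism (fun x => g (f x)).
Proof. by move=> x y; rewrite !raddfB. Qed.
Lemma comp_pr n x : additive_of comp_add (grpr n x) = grpr n (additive_of comp_add x).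
Proof. by rewrite /= !ghom_pr. Qed.
Lemma comp_Sq i x : additive_of comp_add (Sq i x) = Sq i (additive_of comp_add x).
Proof. by rewrite /= !hom_Sq. Qed.
Definition hom_comp : sqhom L N := @SqHom L N (GrHom comp_pr) comp_Sq.
End Comp.

Lemma quo_steenrod (M : sqspace) (P : submod M) : steenrod_module M -> steenrod_module (quoobj P).
Proof.
have e i (y : M) : Sq i (qclass P y : quoobj P) = qclass P (Sq i y) by exact: quo_SqE.
move=> [h0 h]; split=> [x|a b x ab]; have [y <-] := cls_surj x.
  by rewrite e h0.
rewrite !e h // raddf_sum; apply: eq_bigr => j _.
by rewrite !e raddfMn.
Qed.

Lemma quo_lf (M : sqspace) (P : submod M) : locally_finite M -> locally_finite (quoobj P).
Proof.
move=> h x; have [y <-] := cls_surj x.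
exact: (@orbit_hom_finite M (quoobj P) (quo_proj P)).
Qed.

Definition lfquo (M : lfAmod) (P : submod M) : lfAmod :=
  LfAmod (@quo_steenrod M P (lf_steenrod M)) (@quo_lf M P (@lf_fin M)).

(* The largest locally finite submodule. *)
Section LfPart.
Variable M : sqspace.

Definition lf_elt (x : M) := finite_set [set y | cyclic x y].

Lemma lf_elt0 : lf_elt 0.
Proof.
apply: (sub_finite_set _ (finite_set1 (0 : M))) => y /=.
by elim=> // [a b _ -> _ ->|i a _ ->]; rewrite ?addr0 ?raddf0.
Qed.

Lemma lf_eltD x y : lf_elt x -> lf_elt y -> lf_elt (x + y).
Proof.
move=> hx hy; apply: sub_finite_set (finite_image2 (fun a b => a + b) hx hy).
move=> z /=; elim=> [||a b _ [a1 h1 [a2 h2 <-]] _ [b1 h3 [b2 h4 <-]]|i a _ [a1 h1 [a2 h2 <-]]].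
- by exists x; [apply: orbit_gen|exists y; [apply: orbit_gen|]].
- by exists 0; [apply: orbit_zero|exists 0; [apply: orbit_zero|rewrite addr0]].
- by exists (a1 + b1); [apply: orbit_add|
    exists (a2 + b2); [apply: orbit_add|rewrite addrACA]].
- by exists (Sq i a1); [apply: orbit_Sq|
    exists (Sq i a2); [apply: orbit_Sq|rewrite raddfD]].
Qed.

Lemma lf_eltSq i x : lf_elt x -> lf_elt (Sq i x).
Proof.
move=> hx; apply: sub_finite_set hx => y /=.
elim=> [||a b _ ha _ hb|j a _ ha]; last exact: orbit_Sq.
- exact/orbit_Sq/orbit_gen.
- exact: orbit_zero.
- exact: orbit_add.
Qed.

Lemma lf_elt_pr n x : lf_elt x -> lf_elt (grpr n x).
Proof.
move=> hx; have hx' := hx.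
have /finite_seqP [t et] := hx'.
have inT y : cyclic x y -> y \in t.
  by move=> h; have : [set z | cyclic x z]%classic y by []; rewrite et.
have [B hB] : exists B : nat, forall y, y \in t ->
    forall n : int, (B < `|n|)%N -> grpr n y = 0.
  elim: (t) => [|m w [B hB]]; first by exists 0%N.
  have [B' hB'] := pr_bnd m; exists (maxn B B') => k.
  rewrite in_cons => /orP[/eqP->|kw] m' hn; first by apply: hB'; lia.
  by apply: hB => //; lia.
pose S (w : seq int) : set M := [set z | exists2 g : int -> M,
  (forall m, cyclic x (g m)) & z = \sum_(m <- w) grpr m (g m)]%classic.
have finS w : finite_set (S w).
  elim: w => [|m w IH].
    apply: (sub_finite_set _ (finite_set1 (0 : M))) => z /= [g _ ->].
    by rewrite big_nil.
  apply: sub_finite_set (finite_image2 (fun a b => grpr m a + b) hx IH).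
  move=> z /= [g hg ->]; rewrite big_cons; exists (g m) => //.
  by exists (\sum_(j <- w) grpr j (g j)) => //; exists g.
apply: sub_finite_set (finS (window B)) => z /=.
elim=> [||a b _ [g hg ->] _ [g' hg' ->]|i a _ [g hg ->]].
- exists (fun m => if m == n then x else 0).
    by move=> m; case: eqP => _; [apply: orbit_gen|apply: orbit_zero].
  case: (boolP (n \in window B)) => hn; last first.
    have hnB : (B < `|n|)%N by rewrite mem_window -ltnNge in hn.
    rewrite (hB x _ n hnB); last exact/inT/orbit_gen.
    rewrite big_seq big1 // => m hm; case: eqP => [e|_]; last exact: raddf0.
    by rewrite -e hm in hn.
  rewrite (bigD1_seq n) ?window_uniq //= eqxx big1 ?addr0 // => m.
  by move=> /negPf ->; rewrite raddf0.
- exists (fun _ => 0); first by move=> _; apply: orbit_zero.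
  by rewrite big1 // => m _; rewrite raddf0.
- exists (fun m => g m + g' m); first by move=> m; apply: orbit_add.
  by rewrite -big_split /=; apply: eq_bigr => m _; rewrite raddfD.
- exists (fun m => Sq i (g (m + i%:Z))); first by move=> m; apply: orbit_Sq.
  apply/eqP; rewrite -subr_eq0; apply/eqP/pr_sep => k.
  rewrite raddfB.
  have sel (h : int -> M) (c : int) : (forall m, cyclic x (h m)) ->
      grpr c (\sum_(m <- window B) grpr m (h m)) = grpr c (h c).
    move=> hh; rewrite raddf_sum; case: (boolP (c \in window B)) => hc; last first.
      have hcB : (B < `|c|)%N by rewrite mem_window -ltnNge in hc.
      rewrite (hB (h c)) ?inT // big_seq big1 // => m hm.
      by rewrite prpr; case: eqP => // e; rewrite e hm in hc.
    rewrite (bigD1_seq c) ?window_uniq //= prpr eqxx big1 ?addr0 // => m.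
    by rewrite prpr eq_sym => /negPf ->.
  rewrite /= prSqE sel // (sel (fun m => Sq i (g (m + i%:Z)))).
    by rewrite prSqE subrr.
  by move=> m; apply: orbit_Sq.
Qed.

Definition lf_sub : submod M :=
  @Submod M lf_elt lf_elt0 lf_eltD lf_elt_pr lf_eltSq.

Lemma lf_sub_lf : locally_finite (subobj lf_sub).
Proof.
move=> x; have [f hf] : exists f : sqhom (subobj lf_sub) M, forall y, f y = val y.
  have vB : zmod_morphism (fun y : subobj lf_sub => val y : M) by move=> ? ?.
  have vp n y : additive_of vB (grpr n y) = grpr n (additive_of vB y) by [].
  have vs i y : GrHom vp (Sq i y) = Sq i (GrHom vp y) by [].
  by exists (SqHom vs).
apply: (@sub_finite_set _ _ (f @^-1` [set y | cyclic (f x) y])%classic).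
  by move=> y /=; apply: hom_orbit.
apply: finite_preimage; last by rewrite hf; apply: (sub_carP x).
by move=> a b _ _; rewrite !hf => /val_inj.
Qed.

Lemma sub_steenrod (P : submod M) : steenrod_module M -> steenrod_module (subobj P).
Proof.
move=> [h0 h]; split=> [x|a b x ab]; apply: val_inj; first by rewrite /= h0.
rewrite raddf_sum [LHS]/= h //; apply: eq_bigr => j _.
by rewrite raddfMn.
Qed.

End LfPart.

(* Functions on words in the Sq^i that factor through A, i.e. the A-module of
   maps from A to M; its locally finite part is an injective object. *)
Section Coinduced.
Variable M : lfAmod.

Definition wdeg (w : seq nat) : int := (sumn w)%:Z.

Definition coind (g : seq nat -> M) : Prop :=
  [/\ forall u w, g (u ++ 0%N :: w) = g (u ++ w),
      forall u w a b, (a < b.*2)%N -> g (u ++ [:: a, b & w]) =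
        \sum_(j < a./2.+1) g (u ++ [:: (a + b - j)%N, j : nat & w])
           *+ 'C(b - 1 - j, a - j.*2) &
      exists B : nat, forall n : int, (B < `|n|)%N ->
        forall w, grpr (n - wdeg w) (g w) = 0].

Definition coindp : {pred seq nat -> M} := fun g => `[< coind g >].

Lemma coindP g : reflect (coind g) (g \in coindp).
Proof. exact: asboolP. Qed.

Lemma coind_closed : zmod_closed coindp.
Proof.
have fB (f g : seq nat -> M) w : (f - g) w = f w - g w by [].
split=> [|f g /coindP[f1 f2 [B fB3]] /coindP[g1 g2 [B' gB3]]]; apply/coindP.
  split=> //; last by exists 0%N => n _ w; rewrite raddf0.
  by move=> u w a b _; rewrite big1 // => j _; rewrite mul0rn.
split=> [u w|u w a b ab|]; first by rewrite !fB f1 g1.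
  rewrite !fB f2 // g2 // -sumrB; apply: eq_bigr => j _.
  by rewrite fB mulrnBl.
exists (maxn B B') => n; rewrite gtn_max => /andP[h1 h2] w.
by rewrite fB raddfB fB3 // gB3 // subrr.
Qed.

HB.instance Definition _ :=
  GRing.isZmodClosed.Build (seq nat -> M) coindp coind_closed.

Record coind_car := Coind { cofun :> seq nat -> M; _ : cofun \in coindp }.

HB.instance Definition _ := [isSub for cofun].
HB.instance Definition _ := [Choice of coind_car by <:].
HB.instance Definition _ := [SubChoice_isSubZmodule of coind_car by <:].

Lemma coind_eq (f g : coind_car) : (forall w, f w = g w) -> f = g.
Proof. by move=> h; apply: val_inj; apply/funext. Qed.

Lemma coind_car_P (f : coind_car) : coind f. Proof. exact/coindP/(valP f). Qed.

Definition coind_mk f (h : coind f) : coind_car := Coind (introT (coindP f) h).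

Lemma coind_pr_P n (f : coind_car) : coind (fun w => grpr (n - wdeg w) (f w)).
Proof.
have [f1 f2 [B f3]] := coind_car_P f; split=> [u w|u w a b ab|].
- by rewrite f1 /wdeg !sumn_cat.
- rewrite f2 // raddf_sum; apply: eq_bigr => j _.
  have hj := ltn_ord j; rewrite raddfMn; congr (grpr _ _ *+ _).
  by rewrite /wdeg !sumn_cat /=; lia.
exists B => m hm w; rewrite prpr; case: eqP => // e.
by rewrite f3 //; have -> : n = m by lia.
Qed.

Lemma coind_Sq_P i (f : coind_car) : coind (fun w => f (i :: w)).
Proof.
have [f1 f2 [B f3]] := coind_car_P f; split=> [u w|u w a b ab|].
- by rewrite -!cat_cons f1.
- by rewrite -!cat_cons f2.
exists (B + i)%N => m hm w.
have := f3 (m + i%:Z) _ (i :: w).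
have -> : m + i%:Z - wdeg (i :: w) = m - wdeg w by rewrite /wdeg /=; lia.
by apply; lia.
Qed.

Lemma coind_pr_add n : zmod_morphism (fun f => coind_mk (coind_pr_P n f)).
Proof. by move=> f g; apply: coind_eq => w; rewrite /= raddfB. Qed.
Definition coind_pr n := additive_of (coind_pr_add n).

Lemma coind_Sq_add i : zmod_morphism (fun f => coind_mk (coind_Sq_P i f)).
Proof. by move=> f g; apply: coind_eq. Qed.
Definition coind_Sq i := additive_of (coind_Sq_add i).

Lemma coind_addxx (f : coind_car) : f + f = 0.
Proof. by apply: coind_eq => w; have := addxx (f w). Qed.

Lemma coind_prpr m n f : coind_pr m (coind_pr n f) = if m == n then coind_pr n f else 0.
Proof.
by apply: coind_eq => w; rewrite /= prpr (inj_eq (addIr _)); case: ifP.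
Qed.

Lemma coind_prsum f : exists2 s : seq int, uniq s & f = \sum_(n <- s) coind_pr n f.
Proof.
apply: prsum_of => [|g h|g]; first exact: coind_prpr.
  apply: coind_eq => w; apply: pr_sep => n.
  have := congr1 (fun u : coind_car => u w) (h (n + wdeg w)).
  by rewrite /= addrK.
have [_ _ [B g3]] := coind_car_P g; exists B => n hn.
by apply: coind_eq => w; apply: g3.
Qed.

Lemma coind_prSq i n f :
  coind_pr (n - i%:Z) (coind_Sq i f) = coind_Sq i (coind_pr n f).
Proof.
apply: coind_eq => w /=; congr (grpr _ _); rewrite /wdeg /=; lia.
Qed.

Definition coinduced : sqspace :=
  SqSpace coind_addxx coind_prpr coind_prsum coind_prSq.

Lemma coind_sum (I : Type) (r : seq I) (F : I -> coind_car) n :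
  (\sum_(i <- r) F i) n = \sum_(i <- r) F i n.
Proof. by elim/big_rec2: _ => // i y1 y2 _ <-. Qed.

Lemma coindMn (f : coind_car) m w : (f *+ m) w = f w *+ m.
Proof. by elim: m => // m IH; rewrite !mulrS -IH. Qed.

Lemma coinduced_steenrod : steenrod_module coinduced.
Proof.
split=> [f|a b f ab]; have [f1 f2 _] := coind_car_P f; apply: coind_eq => w /=.
  exact: (f1 [::] w).
rewrite (f2 [::] w a b ab) coind_sum; apply: eq_bigr => j _.
by rewrite coindMn.
Qed.

Definition cofree : lfAmod :=
  LfAmod (@sub_steenrod _ (lf_sub coinduced) coinduced_steenrod) (@lf_sub_lf coinduced).

Definition word_act (L : sqspace) (w : seq nat) (x : L) : L := foldl (fun y i => Sq i y) x w.

Lemma act_cat (L : sqspace) (u w : seq nat) (x : L) : word_act (u ++ w) x = word_act w (word_act u x).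
Proof. exact: foldl_cat. Qed.

Lemma act0 (L : sqspace) (w : seq nat) : word_act w (0 : L) = 0.
Proof. by elim: w => //= i w IH; rewrite raddf0. Qed.

Lemma actB (L : sqspace) (w : seq nat) (x y : L) : word_act w (x - y) = word_act w x - word_act w y.
Proof. by elim: w x y => //= i w IH x y; rewrite raddfB IH. Qed.

Lemma actMn (L : sqspace) (w : seq nat) (x : L) n : word_act w (x *+ n) = word_act w x *+ n.
Proof. by elim: w x => //= i w IH x; rewrite raddfMn IH. Qed.

Lemma act_sum (L : sqspace) (w : seq nat) (I : Type) (r : seq I) (F : I -> L) :
  word_act w (\sum_(i <- r) F i) = \sum_(i <- r) word_act w (F i).
Proof. by elim: w F => //= i w IH F; rewrite raddf_sum IH. Qed.

Lemma act_pr (L : sqspace) (w : seq nat) n (x : L) :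
  grpr (n - wdeg w) (word_act w x) = word_act w (grpr n x).
Proof.
elim: w n x => [|i w IH] n x /=; first by rewrite /wdeg subr0.
rewrite -prSq -IH; congr (grpr _ _); rewrite /wdeg /=; lia.
Qed.

Lemma act_hom (L L' : sqspace) (f : sqhom L L') w x : f (word_act w x) = word_act w (f x).
Proof. by elim: w x => //= i w IH x; rewrite IH hom_Sq. Qed.

Section CofreeMap.
Variables (B : lfAmod) (psi : grhom B M).

Lemma cofree_map_P (b : B) : coind (fun w => psi (word_act w b)).
Proof.
have [s0 s1] := lf_steenrod B; split=> [u w|u w a c ac|].
- by rewrite !act_cat /= s0.
- rewrite act_cat /= s1 // act_sum raddf_sum; apply: eq_bigr => j _.
  by rewrite actMn raddfMn act_cat.
have [N hN] := pr_bnd b; exists N => n hn w.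
by rewrite -ghom_pr act_pr hN // act0 raddf0.
Qed.

Lemma cofree_map_add :
  zmod_morphism (fun b => coind_mk (cofree_map_P b) : coinduced).
Proof. by move=> x y; apply: coind_eq => w; rewrite /= actB raddfB. Qed.

Lemma cofree_map_pr n b :
  additive_of cofree_map_add (grpr n b) = grpr n (additive_of cofree_map_add b).
Proof. by apply: coind_eq => w; rewrite /= -ghom_pr act_pr. Qed.

Lemma cofree_map_Sq i b :
  GrHom cofree_map_pr (Sq i b) = Sq i (GrHom cofree_map_pr b).
Proof. by apply: coind_eq. Qed.

Definition coind_map : sqhom B coinduced := SqHom cofree_map_Sq.

Lemma coind_map_lf b : lf_sub coinduced (coind_map b).
Proof. exact: orbit_hom_finite (@lf_fin B b). Qed.

Definition cofree_fun (b : B) : cofree := sub_mk (lf_sub coinduced) _ (coind_map_lf b).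

Lemma cofree_fun_add : zmod_morphism cofree_fun.
Proof. by move=> x y; apply: val_inj; apply: (raddfB coind_map). Qed.

Lemma cofree_fun_pr n b : additive_of cofree_fun_add (grpr n b) = grpr n (additive_of cofree_fun_add b).
Proof. by apply: val_inj; apply: (ghom_pr coind_map). Qed.

Lemma cofree_fun_Sq i b : GrHom cofree_fun_pr (Sq i b) = Sq i (GrHom cofree_fun_pr b).
Proof. by apply: val_inj; apply: (hom_Sq coind_map). Qed.

Definition cofree_map : sqhom B cofree := SqHom cofree_fun_Sq.

Lemma cofree_mapE b w : (val (cofree_map b) : coind_car) w = psi (word_act w b).
Proof. by []. Qed.
End CofreeMap.

Definition cofree_ev_fun (g : cofree) : M := (val g : coind_car) [::].

Lemma cofree_ev_add : zmod_morphism cofree_ev_fun.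
Proof. by []. Qed.

Lemma cofree_ev_pr n g : additive_of cofree_ev_add (grpr n g) = grpr n (additive_of cofree_ev_add g).
Proof. by rewrite /= /cofree_ev_fun /= /wdeg /= subr0. Qed.

Definition cofree_ev : grhom cofree M := GrHom cofree_ev_pr.

Lemma cofree_ev_act (g : cofree) w : cofree_ev (word_act w g) = (val g : coind_car) w.
Proof. by elim: w g => [|i w IH] g //=; rewrite IH. Qed.

End Coinduced.

(* Extension of graded linear maps along injections. *)
Section Extend.
Variables (A B M : sqspace) (i : grhom A B) (phi : grhom A M) (inji : injective i).

Record ext_graph (G : set (B * M)) : Prop := ExtGraph {
  good_base : forall a, G (i a, phi a);
  good_add : forall x y x' y', G (x, y) -> G (x', y') -> G (x + x', y + y');
  good_pr : forall n x y, G (x, y) -> G (grpr n x, grpr n y);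
  good_fun : forall y, G (0, y) -> y = 0 }.

Lemma good_maximal : exists2 G, ext_graph G & forall G', (G `<=` G')%classic -> ext_graph G' -> (G' `<=` G)%classic.
Proof.
pose base : set (B * M) := [set p | exists a, p = (i a, phi a)]%classic.
have gbase : ext_graph base.
  split=> [a|x y x' y' [a [-> ->]] [b [-> ->]]|n x y [a [-> ->]]|y [a [e ->]]].
  - by exists a.
  - by exists (a + b); rewrite !raddfD.
  - by exists (grpr n a); rewrite !ghom_pr.
  - have -> : a = 0 by apply: inji; rewrite -e raddf0.
    by rewrite raddf0.
pose P (G : set (B * M)) := G = set0 \/ ext_graph G.
have [|G [PG Gmax]] := @Zorn_bigcup _ P.
  move=> F FP tot.
  case: (pselect (exists2 G, F G & ext_graph G)) => [[G0 FG0 gG0]|no]; last first.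
    left; rewrite predeqE => p; split=> // -[G FG Gp].
    by case: (FP G FG) => [e|g]; [rewrite e in Gp|case: no; exists G].
  have pick G p : F G -> G p -> ext_graph G.
    by move=> FG Gp; case: (FP G FG) => // e; rewrite e in Gp.
  right; split=> [a|x y x' y' [G FG Gp] [G' FG' Gp']|n x y [G FG Gp]|y [G FG Gp]].
  - by exists G0 => //; apply: (good_base gG0).
  - case: (tot G G' FG FG') => s.
      by exists G' => //; apply: (good_add (pick _ _ FG' Gp') (s _ Gp) Gp').
    by exists G => //; apply: (good_add (pick _ _ FG Gp) Gp (s _ Gp')).
  - by exists G => //; apply: (good_pr (pick _ _ FG Gp) n Gp).
  - exact: (good_fun (pick _ _ FG Gp) Gp).
have gG : ext_graph G.
  case: PG => // e; case: (Gmax base _ (or_intror gbase)); rewrite e; split=> //.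
  by move=> /(_ (i 0, phi 0)); apply; exists 0.
exists G => // G' GG' gG'; apply: contrapT => n; apply: (Gmax G' _ (or_intror gG')).
by split.
Qed.

Lemma extend : exists psi : grhom B M, forall a, psi (i a) = phi a.
Proof.
have [G gG Gmax] := good_maximal.
have G0 : G (0, 0) by have := good_base gG 0; rewrite !raddf0.
have Gsub x y x' y' : G (x, y) -> G (x', y') -> G (x - x', y - y').
  by move=> h h'; rewrite !(opp_id x') !(opp_id y'); apply: good_add.
have uni x y y' : G (x, y) -> G (x, y') -> y = y'.
  move=> h h'; apply/eqP; rewrite -subr_eq0; apply/eqP/(good_fun gG).
  by rewrite -(subrr x); apply: Gsub.
have toth n b : homog n b -> exists y, G (b, y).
  move=> hb; apply: contrapT => nex.
  pose G' : set (B * M) := [set p | G p \/ G (p.1 - b, p.2)]%classic.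
  have gG' : ext_graph G'.
    split=> [a|x y x' y' [h|h] [h'|h']|m x y [h|h]|y [h|h]].
    - by left; apply: (good_base gG).
    - by left; apply: (good_add gG).
    - right; rewrite /= -addrA; exact: (good_add gG h h').
    - right; rewrite /= addrAC; exact: (good_add gG h h').
    - left; have := good_add gG h h'; rewrite /= addrACA.
      by rewrite -opprD addxx oppr0 addr0.
    - by left; apply: (good_pr gG m).
    - have := good_pr gG m h; rewrite /= raddfB -hb prpr.
      case: eqP => [_|_]; first by rewrite hb; right.
      by rewrite subr0; left.
    - exact: (good_fun gG h).
    - case: nex; exists y; move: h; rewrite /= sub0r opp_id.
      by [].
  have GG' : (G `<=` G')%classic by move=> p; left.
  case: nex; exists 0; apply: (Gmax G' GG' gG').
  by right; rewrite /= subrr.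
have tot b : exists y, G (b, y).
  have [N eb] := pr_window b; rewrite eb.
  elim: (window N) => [|n w [y hy]]; first by exists 0; rewrite big_nil.
  have [|z hz] := @toth n (grpr n b); first by rewrite /homog prpr eqxx.
  by exists (z + y); rewrite big_cons; apply: (good_add gG).
have [psi hpsi] := choice tot.
have pB : zmod_morphism psi.
  by move=> x y; apply: (uni (x - y)) => //; apply: Gsub.
have pp n x : additive_of pB (grpr n x) = grpr n (additive_of pB x).
  by apply: (uni (grpr n x)) => //=; apply: (good_pr gG n).
exists (GrHom pp) => a; apply: (uni (i a)) => //; exact: (good_base gG).
Qed.
End Extend.

Lemma cofree_injective (M : lfAmod) : injective_object (cofree M).
Proof.
move=> A B i f inji.
have phiB : zmod_morphism (fun a => cofree_ev M (f a)) by move=> x y; rewrite !raddfB.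
have phip n a : additive_of phiB (grpr n a) = grpr n (additive_of phiB a).
  etransitivity; first exact: (congr1 (cofree_ev M) (ghom_pr f n a)).
  exact: (ghom_pr (cofree_ev M)).
have [psi hpsi] := @extend A B M i (GrHom phip) inji.
exists (cofree_map psi) => a; apply: val_inj; apply: coind_eq => w.
by rewrite cofree_mapE -cofree_ev_act -!act_hom hpsi.
Qed.

Definition cofree_emb (M : lfAmod) : sqhom M (cofree M) := cofree_map (gidh M).

Lemma cofree_emb_inj (M : lfAmod) : injective (cofree_emb M).
Proof.
move=> x y e; exact: (congr1 (fun g : cofree M => cofree_ev M g) e).
Qed.

Definition emb_image (M : lfAmod) : submod (cofree M) :=
  image_submod (cofree_emb M) (@Submod M (fun _ => True) I
    (fun _ _ _ _ => I) (fun _ _ _ => I) (fun _ _ _ => I)).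

Fixpoint syzygy (M : lfAmod) (s : nat) : lfAmod :=
  if s is s'.+1 then lfquo (emb_image (syzygy M s')) else M.

Definition cofree_res_d (M : lfAmod) s :
  sqhom (cofree (syzygy M s)) (cofree (syzygy M s.+1)) :=
  hom_comp (cofree_emb (syzygy M s.+1)) (quo_proj (emb_image (syzygy M s))).

Lemma emb_d0 (M : lfAmod) s (x : cofree (syzygy M s)) :
  cofree_res_d M s x = 0 <-> exists y, x = cofree_emb (syzygy M s) y.
Proof.
split=> [h|[y ->]].
  have : qclass (emb_image (syzygy M s)) x = 0.
    apply: (@cofree_emb_inj (syzygy M s.+1)).
    by rewrite (raddf0 (cofree_emb (syzygy M s.+1))); exact: h.
  by move/cls_eq0 => [y _ ->]; exists y.
have /cls_eq0 e : emb_image (syzygy M s) (cofree_emb (syzygy M s) y) by exists y.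
rewrite /cofree_res_d /= e; exact: (raddf0 (cofree_emb (syzygy M s.+1))).
Qed.

Lemma enough_injectives (M : lfAmod) : inhabited (inj_resolution M).
Proof.
constructor; apply: (@InjResolution M (fun s => cofree (syzygy M s))
  (cofree_res_d M) (cofree_emb M)).
- exact: cofree_emb_inj.
- exact: (@emb_d0 M 0).
- move=> s x; rewrite emb_d0; split=> -[y ->]; last by eexists.
  have [z <-] := cls_surj y; by exists z.
- by move=> s; apply: cofree_injective.
Qed.

End Cofree.

(* Main.v *)
Require Import Defs.
From mathcomp Require Import all_boot all_order all_algebra.
From mathcomp Require Import boolp classical_sets cardinality.
From mathcomp Require Import zify ring.

(* Filter the relations on words Q^I x by strengthening the unstable relation to Q^i z =
   0 for i < |z| + k. Passing from k + 1 to k adds exactly the image of the bottom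
   operation Q_0 : z |-> Q^(|z|+k) z, and Q_0 is injective modulo the relations; this is
   seen by pairing words with the dual of the Steenrod algebra, where Q_0 corresponds to
   shifting the indices of Milnor monomials in the xi_i. Descending along k, exactness
   of R_*J in positive degrees reduces to the surjectivity of the bottom Steenrod
   operation on unstable elements of J, which holds for cofree J, hence for every
   injective J as a retract of a cofree module. The kernel of d_0 on R_0 J consists of
   the unstable elements, i.e. it is Omega^oo J. Since R_s is exact (short exact
   sequences of modules split as graded vector spaces), the double complex R_s(I_t) of
   an injective resolution I of M has exact rows and columns, and a zigzag compares
   H_s(R_*M) with H_s(Omega^oo I). *)

Set Implicit Arguments.
Unset Strict Implicit.
Unset Printing Implicit Defensive.

Import Order.TTheory GRing.Theory Num.Theory.

Local Open Scope ring_scope.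

(** * Binomial coefficients modulo 2 *)

(** Most identities between products of two operations are tested on functionals: the Milnor
    monomials in xi_1 and xi_2 for the Sq^i, the monomials in two Dickson invariants for the Q^i. A
    combination of products lies in the span of the Adem relations as soon as all these functionals
    vanish on it. Each test is a sum of products of binomial coefficients, recognized as a
    coefficient of an explicit polynomial in x + y and x^2 y, or in x^2 + y and x y. The indices of
    the Q^i range over all integers, where exponents may be negative. Since (1 + t)^(2^K) = 1 +
    t^(2^K) modulo 2, coefficients of bounded order do not change when the exponent is raised by a
    large power of 2, and this reduces everything to natural exponents. For longer words one
    statement about the dual Steenrod algebra serves both halves of the argument: an unstable
    functional on words lifts along the bottom operation. Paired with words in the Q^i, it makes Q_0
    injective; since the elements of a cofree module are functions on words, it also makes the
    bottom Steenrod operation surjective there. *)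

Definition binF (n k : int) : 'F_2 := (binz n k)%:R.

Lemma addFF (x : 'F_2) : x + x = 0.
Proof. by rewrite -mulr2n -mulr_natr pchar_Zp ?mulr0. Qed.

Lemma binF_neg n k : k < 0 -> binF n k = 0.
Proof. by move=> h; rewrite /binF binz_lt0. Qed.

Lemma binF_nat (n k : nat) : binF n k = 'C(n, k)%:R.
Proof. by []. Qed.

Lemma binF0 n : binF n 0 = 1.
Proof. by case: n => n; rewrite /binF /= ?bin0. Qed.

Lemma binF_pascal (n k : int) : binF (n + 1) k = binF n k + binF n (k - 1).
Proof.
case: k => [[|k]|k].
- by rewrite !binF0 binF_neg ?addr0.
- have -> : k.+1%:Z - 1 = k by lia.
  case: n => [n|[|n]].
  + have -> : Posz n + 1 = n.+1 by lia.
    by rewrite !binF_nat binS natrD.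
  + have -> : Negz 0 + 1 = 0 by [].
    by rewrite /binF /= !add0n !binn bin0n addFF.
  + have -> : Negz n.+1 + 1 = Negz n by lia.
    rewrite /binF /= [(n.+1 + k.+1)%N]addnS binS natrD addSn addnS.
    by rewrite -addrA addFF addr0.
- by rewrite !binF_neg ?addr0 // NegzE; lia.
Qed.

Lemma binF_small (n k : nat) : (n < k)%N -> binF n k = 0.
Proof. by move=> h; rewrite binF_nat bin_small. Qed.

(** Up to sign this is the middle binomial coefficient C(2n + 2, n + 1), which is even. *)
Lemma binF_even_mid n : binF (- n.+1%:Z - 1) n.+1 = 0.
Proof.
have -> : - n.+1%:Z - 1 = Negz n.+1 by lia.
rewrite /binF /= addSn binS natrD.
have -> : 'C(n + n.+1, n.+1) = 'C(n + n.+1, n).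
  by rewrite -(@bin_sub (n + n.+1) n) ?leq_addr // addKn.
by rewrite addFF.
Qed.

(** In characteristic 2, (1 + t)^(2^K) = 1 + t^(2^K). *)
Lemma binF_period K n k :
  binF (n + (2 ^ K)%:Z) k = binF n k + binF n (k - (2 ^ K)%:Z).
Proof.
elim: K n k => [|K IH] n k; first by rewrite expn0 binF_pascal.
have -> : (2 ^ K.+1)%:Z = (2 ^ K)%:Z + (2 ^ K)%:Z by rewrite expnS mul2n -addnn.
rewrite addrA !IH opprD addrA addrA -[X in X + _ = _]addrA addFF addr0.
by [].
Qed.

Lemma binF_shift K n k : k < (2 ^ K)%:Z -> binF (n + (2 ^ K)%:Z) k = binF n k.
Proof. by move=> h; rewrite binF_period (@binF_neg n (k - _)) ?addr0 //; lia. Qed.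

(* The coefficient of t^a in (1 + t)^z (1 + t + t^2)^m modulo 2. For z = -a-1 it is
   also that of t^a in (1 + t)^m, see [trinom_diag]. *)
Definition trinom (m : nat) (z a : int) : 'F_2 :=
  \sum_(j < m.+1) binF m j * binF (z + m%:Z - j%:Z) (a - 2 * j%:Z).

(** This is 1 + t + t^2 = 1 + t (1 + t). *)
Lemma trinomS m z a : trinom m.+1 z a = trinom m z a + trinom m (z + 1) (a - 1).
Proof.
pose F (n : nat) (j : nat) : 'F_2 := binF (z + n%:Z - j%:Z) (a - 2 * j%:Z).
have -> : trinom m.+1 z a = \sum_(j < m.+1) binF m j * F m.+1 j +
    \sum_(j < m.+1) binF m j * F m.+1 j.+1.
  rewrite /trinom big_ord_recl /=.
  under eq_bigr => j _.
    rewrite /bump /= add1n.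
    have -> : binF m.+1 j.+1 = binF m j.+1 + binF m j.
      by rewrite !binF_nat binS natrD.
    rewrite mulrDl; over.
  rewrite big_split /= addrA; congr (_ + _).
  rewrite big_ord_recr /= (@binF_small m m.+1) // mul0r.
  by rewrite (addr0 (\sum_(i < m) _)) [in RHS]big_ord_recl /= !binF0 /F subr0.
rewrite -!big_split /=; apply: eq_bigr => j _.
rewrite -!mulrDr; congr (_ * _); rewrite /F.
set n := z + m%:Z - j%:Z; set k := a - 2 * j%:Z.
have -> : z + m.+1%:Z - j%:Z = n + 1 by rewrite /n; lia.
have -> : z + m.+1%:Z - j.+1%:Z = n by rewrite /n; lia.
have -> : a - 2 * j.+1%:Z = k - 1 - 1 by rewrite /k; lia.
have -> : z + 1 + m%:Z - j%:Z = n + 1 by rewrite /n; lia.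
have -> : a - 1 - 2 * j%:Z = k - 1 by rewrite /k; lia.
by rewrite !binF_pascal addrA.
Qed.

Lemma trinom_diag m a : trinom m (- a - 1) a = binF m a.
Proof.
elim: m a => [|m IH] a.
  rewrite /trinom big_ord1 binF0 mul1r mulr0 !subr0.
  case: a => [[|a]|a]; first by rewrite !binF0.
    by rewrite binF_even_mid binF_small.
  by rewrite !binF_neg // NegzE; lia.
rewrite trinomS IH.
have -> : - a - 1 + 1 = - (a - 1) - 1 by lia.
rewrite IH -binF_pascal; congr binF; lia.
Qed.

Lemma binF_sym (m : nat) (k : int) : binF m (m%:Z - k) = binF m k.
Proof.
case: k => [k|k]; last first.
  rewrite (binF_neg _ (_ : Negz k < 0)) //.
  have -> : m%:Z - Negz k = (m + k.+1)%N by lia.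
  by rewrite binF_small //; lia.
case: (leqP k m) => h; last by rewrite binF_small // binF_neg //; lia.
have -> : m%:Z - k%:Z = (m - k)%N by lia.
by rewrite !binF_nat bin_sub.
Qed.

(** The weight C(m, b) of Sq^(m - b) Sq^b is invariant under Adem rewriting: the second factor is
    the Adem coefficient of Sq^(m - k) Sq^k, here without the restriction m - k < 2 k. *)
Lemma binF_star (m : nat) (k : int) :
  binF m k = \sum_(j < m.+1) binF m j * binF (k - 1 - j%:Z) (m%:Z - k - 2 * j%:Z).
Proof.
rewrite -binF_sym -trinom_diag; apply: eq_bigr => j _; congr (_ * binF _ _); lia.
Qed.

Lemma big_uniq_supp (W : nmodType) (I : eqType) (s t : seq I) (F : I -> W) :
  uniq s -> uniq t -> (forall i, F i != 0 -> (i \in s) && (i \in t)) ->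
  \sum_(i <- s) F i = \sum_(i <- t) F i.
Proof.
move=> us ut h.
rewrite (bigID (fun i => F i == 0)) [RHS](bigID (fun i => F i == 0)) /=.
rewrite [X in X + _ = _]big1 => [|i /eqP //].
rewrite [X in _ = X + _]big1 => [|i /eqP //].
rewrite !add0r -big_filter -[RHS]big_filter; apply: perm_big.
apply: uniq_perm; rewrite ?filter_uniq // => i; rewrite !mem_filter.
by case: eqP => //= /eqP /h /andP[-> ->].
Qed.

Lemma binF_star_seq (m : nat) (k l : int) (s : seq int) : uniq s ->
  (forall j, binF m (j - l) != 0 ->
     binF (k - 1 - j) (m%:Z + 2 * l - (k - l) - 2 * j) != 0 -> j \in s) ->
  binF m (k - l) = \sum_(j <- s)
    binF m (j - l) * binF (k - 1 - j) (m%:Z + 2 * l - (k - l) - 2 * j).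
Proof.
move=> us h; rewrite binF_star.
pose F j := binF m (j - l) * binF (k - 1 - j) (m%:Z + 2 * l - (k - l) - 2 * j).
transitivity (\sum_(j <- [seq j%:Z + l | j <- iota 0 m.+1]) F j).
  rewrite big_map -[iota 0 m.+1]/(index_iota 0 m.+1) big_mkord; apply: eq_bigr => j _.
  by rewrite /F; congr (binF _ _ * binF _ _); lia.
apply: big_uniq_supp => //; first by rewrite map_inj_uniq ?iota_uniq // => i j; lia.
move=> j; rewrite mulf_eq0 negb_or => /andP[h1 h2]; rewrite h // andbT.
have [p ep] : exists p : nat, j - l = p.
  by case e: (j - l) h1 => [p|p]; [exists p|rewrite binF_neg ?eqxx].
apply/mapP; exists p; last by lia.
rewrite mem_iota /= add0n ltnS; apply: contraR h1; rewrite -ltnNge => hp.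
by rewrite ep binF_small.
Qed.

(** * Adem relations in all degrees *)

Lemma F2P (c : 'F_2) : c = 0 \/ c = 1.
Proof. by case: c => [[|[|c]] hc]; [left|right|]; try exact: val_inj. Qed.

(** Scalar multiplication by F_2 on groups that are declared only as abelian groups; additivity in
    the scalar requires x + x = 0. *)
Definition sc (W : zmodType) (c : 'F_2) (x : W) : W := if c == 0 then 0 else x.

Section Scale.
Variable W : zmodType.
Implicit Types (x y : W) (c d : 'F_2).

Lemma sc0 x : sc 0 x = 0. Proof. by rewrite /sc eqxx. Qed.
Lemma sc1 x : sc 1 x = x. Proof. by []. Qed.
Lemma scr0 c : sc c (0 : W) = 0. Proof. by rewrite /sc; case: ifP. Qed.
Lemma scrD c x y : sc c (x + y) = sc c x + sc c y.
Proof. by rewrite /sc; case: ifP; rewrite ?addr0. Qed.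
Lemma scM c d x : sc (c * d) x = sc c (sc d x).
Proof. by case: (F2P c) => ->; rewrite ?mul0r ?sc0 ?mul1r ?sc1. Qed.
Lemma sc_sumr c (I : Type) (r : seq I) (P : pred I) (F : I -> W) :
  sc c (\sum_(i <- r | P i) F i) = \sum_(i <- r | P i) sc c (F i).
Proof. by elim/big_rec2: _ => [|i y1 y2 _ <-]; rewrite ?scr0 ?scrD. Qed.

Hypothesis W2 : forall x, x + x = 0.

Lemma scD c d x : sc (c + d) x = sc c x + sc d x.
Proof.
case: (F2P c) => ->; case: (F2P d) => ->; rewrite ?add0r ?addr0 ?sc0 ?sc1 ?add0r ?addr0 //.
Qed.
Lemma sc_suml (I : Type) (r : seq I) (P : pred I) (F : I -> 'F_2) x :
  sc (\sum_(i <- r | P i) F i) x = \sum_(i <- r | P i) sc (F i) x.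
Proof. by elim/big_rec2: _ => [|i y1 y2 _ <-]; rewrite ?sc0 ?scD. Qed.
Lemma sc_nat (n : nat) x : sc n%:R x = x *+ n.
Proof. by elim: n => [|n IH]; rewrite ?mulr0n ?sc0 // mulrSr mulrS scD IH sc1 addrC. Qed.
Lemma sc_bin (n k : int) x : x *+ binz n k = sc (binF n k) x.
Proof. by rewrite sc_nat. Qed.
Lemma opp2 x : - x = x.
Proof. by apply/eqP; rewrite eq_sym -addr_eq0 W2. Qed.
End Scale.

Lemma sc_raddf (V W : zmodType) (f : {additive V -> W}) c x : f (sc c x) = sc c (f x).
Proof. by rewrite /sc; case: ifP => _; rewrite ?raddf0. Qed.

Lemma sc_F2 c (d : 'F_2) : sc c d = c * d.
Proof. by case: (F2P c) => ->; rewrite ?sc0 ?mul0r ?sc1 ?mul1r. Qed.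

(* [e b] stands for a product whose degrees are D - b and b, S for the span of
   relations. The functionals [phi l] annihilate the Adem relations and are
   unitriangular on the admissible [e b] (3 b <= D), hence detect membership in S. *)
Section AdemSpan.
Variables (W : zmodType) (W2 : forall x : W, x + x = 0).
Variables (S : W -> Prop) (S0 : S 0) (SD : forall x y, S x -> S y -> S (x + y)).
Variables (D : int) (e : int -> W) (L : pred int).
Hypothesis Lup : forall i j, L i -> i <= j -> L j.
Hypothesis eL : forall b, ~~ L b -> S (e b).
Hypothesis red : forall b, D < 3 * b -> exists s : seq int,
  [/\ uniq s, (forall j, binF (b - 1 - j) (D - b - 2 * j) != 0 -> j \in s) &
   S (e b - \sum_(j <- s) sc (binF (b - 1 - j) (D - b - 2 * j)) (e j))].

(** The value of the Milnor monomial xi_1^(D - 3 l) xi_2^l on Sq^(D - b) Sq^b. *)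
Let phi (l b : int) := binF (D - 3 * l) (b - l).
Let adm b := L b && (3 * b <= D).

Let S_sum (t : seq int) : (forall b, b \in t -> S (e b)) -> S (\sum_(b <- t) e b).
Proof.
elim: t => [|b t IH] h; first by rewrite big_nil.
rewrite big_cons; apply: SD; first by apply: h; rewrite mem_head.
by apply: IH => c hc; apply: h; rewrite inE hc orbT.
Qed.

Lemma seq_max (t : seq int) : t != [::] -> exists2 m, m \in t & forall b, b \in t -> b <= m.
Proof.
elim: t => [//|a [|b t] IH] _; first by exists a; rewrite ?mem_head // => b; rewrite inE => /eqP->.
have [//|m hm h] := IH; case: (leP a m) => am.
  by exists m => [|c]; rewrite inE ?hm ?orbT // => /orP[/eqP->|/h].
exists a => [|c]; rewrite inE ?eqxx // => /orP[/eqP->//|/h hc]; exact: le_trans hc (ltW am).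
Qed.

(** At the largest letter m of t, [phi m] is 1, and it vanishes at all smaller letters. Hence m
    occurs an even number of times, and two copies of it can be cancelled. *)
Lemma adem_admissible (t : seq int) : all adm t ->
  (forall l, adm l -> \sum_(b <- t) phi l b = 0) -> \sum_(b <- t) e b = 0.
Proof.
elim: {t}_.+1 {-2}t (ltnSn (size t)) => // n IH t ht at_ h.
case: (eqVneq t [::]) => [->|tn]; first by rewrite big_nil.
have [m mt hm] := seq_max tn.
have am := allP at_ m mt.
have Dm : exists p : nat, D - 3 * m = p.
  by case/andP: am => _; exists (absz (D - 3 * m)%R); lia.
have cnt : (count_mem m t)%:R = 0 :> 'F_2.
  rewrite -(h m am) -sum1_count natr_sum big_mkcond /= big_seq [RHS]big_seq.
  apply: eq_bigr => b /hm bm; rewrite /phi; case: eqP => [->|bm'].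
    by rewrite subrr binF0.
  by rewrite binF_neg // subr_lt0 lt_neqAle bm andbT; apply/eqP.
have c0 : (0 < count_mem m t)%N by rewrite -has_count has_pred1.
have c2 : (1 < count_mem m t)%N.
  by move: cnt c0; case: (count_mem m t) => [|[|c]] //= /eqP; rewrite oner_eq0.
have [t1 p1] : exists t1, perm_eq t (m :: t1) by exists (rem m t); apply: perm_to_rem.
have mt1 : m \in t1.
  have /permP/(_ (pred1 m)) := p1; rewrite /= eqxx add1n => ec.
  by rewrite -has_pred1 has_count -ltnS -ec.
have [t2 p2] : exists t2, perm_eq t1 (m :: t2) by exists (rem m t1); apply: perm_to_rem.
have p : perm_eq t [:: m, m & t2].
  by apply: (perm_trans p1); rewrite perm_cons.
rewrite (perm_big _ p) !big_cons /= addrA W2 add0r; apply: IH.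
- by move: ht; rewrite (perm_size p) /=; lia.
- by move: at_; rewrite (perm_all _ p) /= => /and3P[].
- by move=> l /h; rewrite (perm_big _ p) !big_cons /= addrA addFF add0r.
Qed.

(** A single use of [red] gives admissible letters: a nonzero coefficient forces 2 j <= D - b, and
    with D < 3 b this yields 3 j <= D. The functionals agree by [binF_star_seq]. *)
Lemma adem_reduce_letter b : exists t : seq int,
  [/\ all adm t, S (e b - \sum_(j <- t) e j) &
      forall l, adm l -> phi l b = \sum_(j <- t) phi l j].
Proof.
have drop l c : L l -> ~~ L c -> phi l c = 0.
  move=> Ll Lc; rewrite /phi binF_neg // subr_lt0 ltNge; apply: contra Lc; exact: Lup.
case: (boolP (L b)) => Lb; last first.
  exists [::]; split; rewrite ?big_nil ?subr0 //; first exact: eL.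
  by move=> l /andP[Ll _]; rewrite big_nil drop.
case: (leP (3 * b) D) => hb.
  exists [:: b]; rewrite /= /adm Lb hb; split=> // [|l _]; last by rewrite big_seq1.
  by rewrite big_seq1 subrr.
have [s [us hs Ss]] := red hb.
pose c j := binF (b - 1 - j) (D - b - 2 * j).
exists [seq j <- s | (c j != 0) && L j]; split.
- apply/allP => j; rewrite mem_filter /adm => /andP[/andP[cj ->] _] /=.
  move: cj; rewrite leNgt; apply: contraNN => hj.
  by rewrite /c binF_neg //; lia.
- rewrite big_filter.
  have -> : \sum_(j <- s | (c j != 0) && L j) e j =
      \sum_(j <- s) sc (c j) (e j) - \sum_(j <- s | (c j != 0) && ~~ L j) e j.
    rewrite (opp2 W2) big_mkcond /= [X in _ = _ + X]big_mkcond /= -big_split /=.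
    apply: eq_bigr => j _; rewrite /sc.
    by case: eqP => _ /=; case: (L j); rewrite ?addr0 ?add0r ?W2.
  rewrite opprB addrCA addrC; apply: SD => //.
  by rewrite -big_filter; apply: S_sum => j; rewrite mem_filter => /andP[/andP[_ /eL]].
- move=> l /andP[Ll hl].
  have [p ep] : exists p : nat, D - 3 * l = p by exists (absz (D - 3 * l)%R); lia.
  rewrite /phi ep (@binF_star_seq p b l s us) => [|j _ hj]; last first.
    by apply: hs; move: hj; congr (binF _ _ != 0); lia.
  rewrite big_filter [RHS]big_mkcond /=; apply: eq_bigr => j _.
  have -> : p%:Z + 2 * l - (b - l) - 2 * j = D - b - 2 * j by lia.
  rewrite -/(c j); case: eqP => [->|cj] /=; first by rewrite mulr0.
  case: ifP => Lj; last by rewrite -ep -/(phi l j) drop ?Lj ?mul0r.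
  by case: (F2P (c j)) => [/cj|->]; rewrite ?mulr1.
Qed.

Lemma adem_reduce (t : seq int) : exists t' : seq int,
  [/\ all adm t', S (\sum_(b <- t) e b - \sum_(b <- t') e b) &
      forall l, adm l -> \sum_(b <- t) phi l b = \sum_(b <- t') phi l b].
Proof.
elim: t => [|b t [t' [a1 s1 f1]]].
  by exists [::]; split=> [//||l _]; rewrite !big_nil // subrr.
have [tb [a2 s2 f2]] := adem_reduce_letter b.
exists (tb ++ t'); split; first by rewrite all_cat a2.
  rewrite big_cons big_cat /= opprD addrACA; exact: SD.
by move=> l al; rewrite big_cons big_cat /= f1 // f2.
Qed.

Lemma adem_span_seq (t : seq int) :
  (forall l, L l -> 3 * l <= D -> \sum_(b <- t) phi l b = 0) -> S (\sum_(b <- t) e b).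
Proof.
move=> h; have [t' [a1 s1 f1]] := adem_reduce t.
have e0 : \sum_(b <- t') e b = 0.
  by apply: adem_admissible => // l al; rewrite -f1 //; case/andP: al => *; apply: h.
by move: s1; rewrite e0 subr0.
Qed.

Lemma adem_span (I : Type) (r : seq I) (B : I -> int) (c : I -> 'F_2) :
  (forall l, L l -> 3 * l <= D -> \sum_(i <- r) c i * binF (D - 3 * l) (B i - l) = 0) ->
  S (\sum_(i <- r) sc (c i) (e (B i))).
Proof.
move=> h.
have -> : \sum_(i <- r) sc (c i) (e (B i)) = \sum_(b <- [seq B i | i <- r & c i != 0]) e b.
  rewrite big_map big_filter [RHS]big_mkcond; apply: eq_bigr => i _.
  by rewrite /sc; case: eqP.
apply: adem_span_seq => l Ll hl; rewrite -[RHS](h l Ll hl) big_map big_filter big_mkcond.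
apply: eq_bigr => i _; case: (F2P (c i)) => ->; rewrite ?eqxx ?mul0r //.
by rewrite oner_eq0 mul1r.
Qed.

(** The Adem formula also holds for admissible b: every [phi l] annihilates the difference of its
    two sides. *)
Lemma adem_ext (b : int) (s : seq int) : uniq s ->
  (forall j, L j -> binF (b - 1 - j) (D - b - 2 * j) != 0 -> j \in s) ->
  S (e b - \sum_(j <- s) sc (binF (b - 1 - j) (D - b - 2 * j)) (e j)).
Proof.
move=> us hs.
have := @adem_span _ (None :: map Some s) (fun i => if i is Some j then j else b)
  (fun i => if i is Some j then binF (b - 1 - j) (D - b - 2 * j) else 1).
rewrite big_cons sc1 big_map (opp2 W2); apply=> l Ll hl; rewrite big_cons big_map mul1r.
have [p ep] : exists p : nat, D - 3 * l = p by exists (absz (D - 3 * l)%R); lia.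
rewrite ep (@binF_star_seq p b l s us) => [|j hl1 hj]; last first.
  apply: hs; last by move: hj; congr (binF _ _ != 0); lia.
  apply: (Lup Ll); rewrite leNgt; apply: contraNN hl1 => hl1.
  by rewrite binF_neg //; lia.
rewrite -big_split big1 // => j _ /=.
have -> : p%:Z + 2 * l - (b - l) - 2 * j = D - b - 2 * j by lia.
by rewrite mulrC addFF.
Qed.

End AdemSpan.

Section NatAdem.
Variables (W : zmodType) (g : nat -> nat -> W).
Hypothesis W2 : forall x : W, x + x = 0.
Hypothesis ad : forall a b : nat, (a < b.*2)%N ->
  g a b = \sum_(j < a./2.+1) g (a + b - j)%N j *+ 'C(b - 1 - j, a - j.*2).

Definition extz (a b : int) : W :=
  if a is Posz a then if b is Posz b then g a b else 0 else 0.

Lemma extz_negr a b : b < 0 -> extz a b = 0.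
Proof. by case: a => a; case: b. Qed.

Lemma extz_reduced (D b : int) : D < 3 * b -> exists s : seq int,
  [/\ uniq s, (forall j, binF (b - 1 - j) (D - b - 2 * j) != 0 -> j \in s) &
   extz (D - b) b - \sum_(j <- s) sc (binF (b - 1 - j) (D - b - 2 * j)) (extz (D - j) j) = 0].
Proof.
(* Beyond this window the coefficient is zero: for large j the lower index is negative, and for very
   negative j it exceeds the upper index, which is nonnegative there. *)
move=> hb; exists (window (`|b| + `|D| + `|b|)); split; first exact: window_uniq.
  move=> j; apply: contraR; rewrite mem_window -ltnNge => hj.
  rewrite /binF; case ek: (D - b - 2 * j) => [k|k] //; case em: (b - 1 - j) => [m|m].
    by rewrite /= bin_small //; lia.
  by exfalso; move: em; rewrite NegzE; lia.
case ea: (D - b) => [a|a]; last first.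
  rewrite big1 ?subrr // => j _; case: (ltP j 0) => j0.
    by rewrite extz_negr ?scr0.
  by rewrite binF_neg ?sc0 // NegzE; lia.
case: b hb ea => [b|b] hb ea; last first.
  by exfalso; move: ea; lia.
rewrite /= ad; last by lia.
apply/eqP; rewrite subr_eq0; apply/eqP.
pose F (j : int) := sc (binF (b%:Z - 1 - j) (a%:Z - 2 * j)) (extz (D - j) j).
transitivity (\sum_(j <- [seq j%:Z | j <- iota 0 a./2.+1]) F j).
  rewrite big_map -[iota 0 _]/(index_iota 0 a./2.+1) big_mkord; apply: eq_bigr => j _.
  have hj := ltn_ord j; rewrite /F /=.
  have -> : D - j%:Z = (a + b - j)%N by lia.
  have -> : b%:Z - 1 - j%:Z = (b - 1 - j)%N by lia.
  have -> : a%:Z - 2 * j%:Z = (a - j.*2)%N by lia.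
  by rewrite /= binF_nat sc_nat.
apply: big_uniq_supp; rewrite ?window_uniq ?map_inj_uniq ?iota_uniq //.
  by move=> i j; lia.
move=> j; case: (ltP j 0) => j0; first by rewrite /F extz_negr ?scr0 ?eqxx.
have {j0} [k ->] : exists k : nat, j = k by exists (absz j); lia.
case: (leqP k a./2) => hk; last by rewrite /F binF_neg ?sc0 ?eqxx //; lia.
move=> _; rewrite mem_map ?mem_iota ?mem_window; last by move=> u v; lia.
lia.
Qed.

Lemma extz_ext (a b : int) (s : seq int) : uniq s ->
  (forall j, 0 <= j -> binF (b - 1 - j) (a - 2 * j) != 0 -> j \in s) ->
  extz a b = \sum_(j <- s) sc (binF (b - 1 - j) (a - 2 * j)) (extz (a + b - j) j).
Proof.
move=> us hs.
have := @adem_ext W W2 (fun y => y = 0) (erefl 0) _ (a + b)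
  (fun j => extz (a + b - j) j) (fun j => 0 <= j) _ _ _ b s us.
rewrite addrK => /(_ _ _ _ _ _)/eqP; rewrite subr_eq0 => h; apply/eqP/h => //.
- by move=> u v -> ->; rewrite addr0.
- by move=> i j hi; apply: le_trans.
- by move=> j; rewrite -ltNge => hj; apply: extz_negr.
- move=> c hc; exact: extz_reduced.
Qed.

End NatAdem.

Section SteenrodZ.
Variable M : sqspace.

Definition SqZ (i : int) (x : M) : M := if i is Posz n then Sq n x else 0.

Lemma SqZ_neg i x : i < 0 -> SqZ i x = 0. Proof. by case: i. Qed.
Lemma SqZ0 i : SqZ i 0 = 0. Proof. by case: i => n //=; rewrite raddf0. Qed.

Lemma SqZ_extz (x : M) a b : SqZ b (SqZ a x) = extz (fun a b => Sq b (Sq a x)) a b.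
Proof. by case: a => a; case: b => b //=; rewrite raddf0. Qed.

Hypothesis st : steenrod_module M.

Lemma steenrod_reduced (x : M) (D b : int) : D < 3 * b ->
  exists s : seq int,
  [/\ uniq s, (forall j, binF (b - 1 - j) (D - b - 2 * j) != 0 -> j \in s) &
   SqZ b (SqZ (D - b) x) - \sum_(j <- s) sc (binF (b - 1 - j) (D - b - 2 * j))
     (SqZ j (SqZ (D - j) x)) = 0].
Proof.
move=> hb; have [_ ad] := st.
have [s [h1 h2 h3]] := extz_reduced (@addxx M) (fun a b => ad a b x) hb.
exists s; split=> //; rewrite SqZ_extz -[RHS]h3; congr (_ - _).
by apply: eq_bigr => j _; rewrite SqZ_extz.
Qed.

Lemma steenrod_ext (x : M) (a b : int) (s : seq int) : uniq s ->
  (forall j, 0 <= j -> binF (b - 1 - j) (a - 2 * j) != 0 -> j \in s) ->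
  SqZ b (SqZ a x) = \sum_(j <- s) sc (binF (b - 1 - j) (a - 2 * j)) (SqZ j (SqZ (a + b - j) x)).
Proof.
move=> us hs; have [_ ad] := st.
rewrite SqZ_extz (extz_ext (@addxx M) (fun a b => ad a b x) us hs).
by apply: eq_bigr => j _; rewrite SqZ_extz.
Qed.

End SteenrodZ.

(** * The Nishida action satisfies the Adem relations *)

Section MonomialSpan.
Variables (K A : comNzRingType) (emb : {rmorphism K -> A}) (x y : A).

Inductive monspan : A -> Prop :=
| monspan0 : monspan 0
| monspanD f g : monspan f -> monspan g -> monspan (f + g)
| monspan_mon c m l : monspan (emb c * x ^+ m * y ^+ l).

Lemma monspanC c : monspan (emb c).
Proof. by have := monspan_mon c 0 0; rewrite !expr0 !mulr1. Qed.

Lemma monspan1 : monspan 1.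
Proof. by rewrite -(rmorph1 emb); apply: monspanC. Qed.

Lemma monspanX : monspan x.
Proof. by have := monspan_mon 1 1 0; rewrite rmorph1 expr1 expr0 mulr1 mul1r. Qed.

Lemma monspanY : monspan y.
Proof. by have := monspan_mon 1 0 1; rewrite rmorph1 expr1 expr0 mulr1 mul1r. Qed.

Lemma monspanM f g : monspan f -> monspan g -> monspan (f * g).
Proof.
move=> hf; elim: hf g => {f} [g _|f f' _ IH _ IH' g hg|c m l g].
- rewrite mul0r; exact: monspan0.
- rewrite mulrDl; apply: monspanD; [exact: IH|exact: IH'].
elim=> {g} [|g g' _ IH _ IH'|c' m' l'].
- rewrite mulr0; exact: monspan0.
- rewrite mulrDr; exact: monspanD.
have -> : emb c * x ^+ m * y ^+ l * (emb c' * x ^+ m' * y ^+ l') =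
    emb (c * c') * x ^+ (m + m') * y ^+ (l + l').
  by rewrite rmorphM !exprD; ring.
exact: monspan_mon.
Qed.

Lemma monspan_exp f n : monspan f -> monspan (f ^+ n).
Proof.
by move=> h; elim: n => [|n IH]; [exact: monspan1|rewrite exprS; apply: monspanM].
Qed.

End MonomialSpan.

(** * Polynomials in x + y and x^2 y *)

Section XY.
Variable K : comNzRingType.
Hypothesis K2 : forall x : K, x + x = 0.

(* With x and y the outer and inner variable, the coefficients of x^a y^b in a polynomial
   in x + y and x^2 y satisfy the Adem relations: see [XYspan_adem]. *)
Definition XX : {poly {poly K}} := 'X + 'X%:P.
Definition YY : {poly {poly K}} := 'X^2 * 'X%:P.

Definition embC : {rmorphism K -> {poly {poly K}}} := polyC \o polyC.

Definition XYspan := monspan embC XX YY.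

Definition cz (f : {poly {poly K}}) (a b : int) : K :=
  if a is Posz a then if b is Posz b then f`_a`_b else 0 else 0.

Lemma czD f g a b : cz (f + g) a b = cz f a b + cz g a b.
Proof. by case: a => a; case: b => b; rewrite /= ?addr0 // !coefD. Qed.

Lemma cz0 a b : cz 0 a b = 0.
Proof. by case: a => a; case: b => b; rewrite /= ?coef0. Qed.

Lemma cz_sum (I : Type) (r : seq I) (P : pred I) (F : I -> {poly {poly K}}) a b :
  cz (\sum_(i <- r | P i) F i) a b = \sum_(i <- r | P i) cz (F i) a b.
Proof. by elim/big_rec2: _ => [|i y1 y2 _ <-]; rewrite ?cz0 ?czD. Qed.

Lemma czMn f n a b : cz (f *+ n) a b = cz f a b *+ n.
Proof. by elim: n => [|n IH]; rewrite ?mulr0n ?cz0 // !mulrS czD IH. Qed.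

Lemma coef_XD1 (R : nzRingType) (e k : nat) : ((1 + 'X) ^+ e : {poly R})`_k = 'C(e, k)%:R.
Proof.
elim: e k => [|e IH] k; first by rewrite expr0 coef1 bin0n.
rewrite exprS mulrDl mul1r coefD coefXM IH.
by case: k => [|k]; rewrite /= ?bin0 ?addr0 // IH binS natrD.
Qed.

Lemma cz_mono c (u e v : nat) (a b : int) :
  cz (c%:P%:P * ('X^u * (1 + 'X) ^+ e) * ('X^v)%:P) a b =
  sc (if b == v then binF e (a - u%:Z) else 0) c.
Proof.
case: a => a; last first.
  by rewrite /= binF_neg ?if_same ?sc0 //; lia.
case: b => b; last by rewrite /= sc0.
rewrite [LHS]/= coefMC coefCM coefXnM -mulrA coefCM.
case: ltnP => hu.
  by rewrite mul0r coef0 mulr0 binF_neg ?if_same ?sc0 //; lia.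
rewrite coef_XD1 -polyC_natr coefCM coefXn eqz_nat.
case: eqP => _; last by rewrite !mulr0 sc0.
have -> : Posz a - u%:Z = (a - u)%N by lia.
by rewrite binF_nat sc_nat // mulr1 mulr_natr.
Qed.

Lemma cz_mon c m l a b : cz (c%:P%:P * XX ^+ m * YY ^+ l) a b =
  sc (if a + b == (m + 3 * l)%:Z then binF m (b - l%:Z) else 0) c.
Proof.
rewrite /XX /YY exprDn mulr_sumr mulr_suml cz_sum.
have F (i : 'I_m.+1) : cz (c%:P%:P * ('X^(m - i) * 'X%:P ^+ i *+ 'C(m, i)) * ('X^2 * 'X%:P) ^+ l) a b
   = sc (if (b == (i + l)%N) && (a + b == (m + 3 * l)%N) then binF m i else 0) c.
  have -> : c%:P%:P * ('X^(m - i) * 'X%:P ^+ i *+ 'C(m, i)) * ('X^2 * 'X%:P) ^+ l =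
     (c%:P%:P * ('X^(m - i + 2 * l) * (1 + 'X) ^+ 0) * ('X^(i + l))%:P) *+ 'C(m, i).
    rewrite mulrnAr mulrnAl; congr (_ *+ _).
    by rewrite expr0 mulr1 exprMn polyC_exp -exprM !exprD; ring.
  rewrite czMn cz_mono -(sc_nat K2) -scM -binF_nat; congr sc.
  case: eqP => [->|_] /=; last by rewrite mulr0.
  have hi := ltn_ord i.
  case: eqP => ha.
    have -> : a - (m - i + 2 * l)%N%:Z = 0 by lia.
    by rewrite binF0 mulr1.
  case e: (a - (m - i + 2 * l)%N%:Z) => [k|k]; last by rewrite (@binF_neg 0) ?mulr0 //.
  by case: k e => [|k] e; [lia|rewrite (@binF_small 0) ?mulr0].
under eq_bigr => i _ do rewrite F.
rewrite -(sc_suml K2); congr sc.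
case: eqP => ab; last by rewrite big1 // => i _; rewrite andbF.
case: (boolP ((0 <= b - l%:Z) && (b - l%:Z <= m%:Z))) => h.
  have [k ek] : exists k : nat, b - l%:Z = k by exists (absz (b - l%:Z)%R); lia.
  have hk : (k < m.+1)%N by lia.
  rewrite (bigD1 (Ordinal hk)) //= big1 ?addr0.
    by rewrite ek; case: eqP => //; lia.
  by move=> i /eqP ik; case: eqP => //= e; case: ik; apply: val_inj => /=; lia.
rewrite big1 => [|i _]; last first.
  by have hi := ltn_ord i; case: eqP => //= e; move: h; rewrite e; lia.
case e: (b - l%:Z) => [k|k]; last by rewrite binF_neg.
by rewrite binF_small //; lia.
Qed.

(** On (x + y)^m (x^2 y)^l the coefficient of x^a y^b is C(m, b - l) in the right total degree, so
    this reduces to [binF_star_seq]. *)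
Lemma XYspan_adem f : XYspan f -> forall (a b : int) (s : seq int), uniq s ->
  (forall j, 0 <= j -> 2 * j <= a -> j \in s) ->
  cz f a b = \sum_(j <- s) sc (binF (b - 1 - j) (a - 2 * j)) (cz f (a + b - j) j).
Proof.
move=> hf a b s us hs; elim: hf => {f} [|f g _ IH _ IH'|c m l].
- by rewrite cz0 big1 // => j _; rewrite cz0 scr0.
- rewrite czD IH IH' -big_split; apply: eq_bigr => j _.
  by rewrite czD scrD.
rewrite cz_mon; under eq_bigr => j _ do rewrite cz_mon -scM subrK.
case: eqP => ab; last by rewrite sc0 big1 // => j _; rewrite mulr0 sc0.
rewrite -(sc_suml K2); congr sc.
rewrite (@binF_star_seq m b l s us) => [|j h1 h2].
  by apply: eq_bigr => j _; rewrite mulrC; congr (binF _ _ * _); lia.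
have j0 : 0 <= j - l%:Z by rewrite leNgt; apply: contraNN h1 => h; rewrite binF_neg.
have ja : 0 <= m%:Z + 2 * l%:Z - (b - l%:Z) - 2 * j.
  by rewrite leNgt; apply: contraNN h2 => h; rewrite binF_neg.
by apply: hs; lia.
Qed.

End XY.

Lemma cz_mono1 (u e v : nat) (a b : int) :
  cz (('X^u * (1 + 'X) ^+ e) * ('X^v)%:P : {poly {poly 'F_2}}) a b =
  if b == v then binF e (a - u%:Z) else 0.
Proof.
have := @cz_mono 'F_2 addFF 1 u e v a b; rewrite mul1r => ->.
by rewrite sc_F2 mulr1.
Qed.

Lemma addpp (R : nzRingType) : (forall x : R, x + x = 0) -> forall x : {poly R}, x + x = 0.
Proof. by move=> h x; apply/polyP => i; rewrite coefD coef0 h. Qed.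

(* The Q^n-component of u Sq^a Sq^b is a combination of terms x Sq^(D-j) Sq^j; this is
   its value under the weight functional of [adem_span] indexed by l. It is also the
   coefficient of x^a y^b in [nishP], which lies in the span of the X^i Y^j. *)
Definition nishW (n : int) (D m l : nat) (a b : int) : 'F_2 :=
  \sum_(j < D.+1) binF (n - j%:Z) (b - 2 * j%:Z) *
    binF (n + b - D%:Z) (a - 2 * (D%:Z - j%:Z)) * binF m (j%:Z - l%:Z).

Definition nishP (E m l : nat) : {poly {poly 'F_2}} :=
  (1 + XX _ + YY _) ^+ E * (XX _ ^+ 2 + YY _ + XX _ * YY _) ^+ m *
  (YY _ * (1 + XX _ + YY _)) ^+ (2 * l).

Lemma nishP_span E m l : XYspan (nishP E m l).
Proof.
have h1 : XYspan (1 + XX 'F_2 + YY 'F_2).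
  by apply: monspanD (monspanY _ _ _); apply: monspanD (monspanX _ _ _); apply: monspan1.
apply: monspanM; [apply: monspanM|]; apply: monspan_exp => //.
  apply: monspanD; last by apply: monspanM (monspanX _ _ _) (monspanY _ _ _).
  by apply: monspanD (monspanY _ _ _); apply: monspan_exp (monspanX _ _ _).
exact: monspanM (monspanY _ _ _) h1.
Qed.

(** The origin of [nishP]: multiplying the terms of [nishW] by x^a y^b and summing over a and b
    gives, with T = 1 + y (1 + x), powers of (1 + x) T = 1 + X + Y, of x^2 T + y^2 (1 + x)^2 = X^2 +
    Y + X Y, and of x^2 y (1 + x) T = Y (1 + X + Y). *)
Lemma nishPE E m l : nishP E m l = \sum_(i < m.+1) \sum_(h < (m - i + 2 * l + E).+1)
   ('X^(2 * (m - i + 2 * l)) * (1 + 'X) ^+ (2 * (i + l) + E + h) *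
     ('X^(2 * (i + l) + h))%:P) *+ ('C(m, i) * 'C(m - i + 2 * l + E, h)).
Proof.
pose p : {poly {poly 'F_2}} := 'X; pose q : {poly {poly 'F_2}} := 'X%:P.
pose T := 1 + q * (1 + p).
have P2 (x : {poly {poly 'F_2}}) : x + x = 0.
  by apply: addpp => y; apply: addpp => z; apply: addFF.
have e1 : 1 + XX _ + YY _ = (1 + p) * T.
  (* [ring] does not know that 2 = 0, so the term that occurs twice on the right is added on the
     left. *)
  rewrite -[LHS]addr0 -(P2 (p * q)) /XX /YY /T -/p -/q; ring.
have e2 : XX _ ^+ 2 + YY _ + XX _ * YY _ = p ^+ 2 * T + q ^+ 2 * (1 + p) ^+ 2.
  rewrite -[LHS]addr0 -[RHS]addr0 -[in LHS](P2 (p * q ^+ 2)) -[in RHS](P2 (p * q)).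
  rewrite /XX /YY /T -/p -/q; ring.
rewrite /nishP e2 e1 [in LHS]exprDn mulr_sumr mulr_suml; apply: eq_bigr => i _.
have e3 : ((1 + p) * T) ^+ E * ((p ^+ 2 * T) ^+ (m - i) * (q ^+ 2 * (1 + p) ^+ 2) ^+ i) *
    (YY 'F_2 * ((1 + p) * T)) ^+ (2 * l) =
    p ^+ (2 * (m - i + 2 * l)) * (1 + p) ^+ (2 * (i + l) + E) * q ^+ (2 * (i + l)) *
    T ^+ (m - i + 2 * l + E).
  rewrite /YY -/p -/q !mul2n -!addnn !exprD !exprMn ?expr2; ring.
rewrite mulrnAr mulrnAl e3 /T [X in _ * X](exprDn 1 (q * (1 + p))) mulr_sumr -sumrMnl; apply: eq_bigr => h _.
rewrite mulrnAr -mulrnA; congr (_ *+ _); last exact: mulnC.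
by rewrite expr1n mul1r exprMn polyC_exp -/p -/q !exprD; ring.
Qed.

Lemma nishW_cz (E m l : nat) (n : int) (a b : int) : n = E%:Z + (m + 3 * l)%:Z ->
  nishW n (m + 3 * l) m l a b = cz (nishP E m l) a b.
Proof.
move=> en; rewrite nishPE cz_sum.
pose F (j : int) := binF (n - j) (b - 2 * j) *
    binF (n + b - (m + 3 * l)%:Z) (a - 2 * ((m + 3 * l)%:Z - j)) * binF m (j - l%:Z).
transitivity (\sum_(j <- [seq j%:Z | j <- iota 0 (m + 3 * l).+1]) F j).
  by rewrite big_map -[iota _ _]/(index_iota 0 (m + 3 * l).+1) big_mkord.
transitivity (\sum_(j <- [seq (i + l)%:Z | i <- iota 0 m.+1]) F j).
  apply: big_uniq_supp; rewrite ?map_inj_uniq ?iota_uniq //.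
  - by move=> i j; lia.
  - by move=> i j; lia.
  move=> j; rewrite /F mulf_eq0 negb_or => /andP[_ h].
  have [k ek] : exists k : nat, j - l%:Z = k.
    by case e: (j - l%:Z) h => [k|k]; [exists k|rewrite binF_neg ?eqxx].
  have hk : (k <= m)%N.
    by rewrite leqNgt; apply: contraNN h => h; rewrite ek binF_small.
  apply/andP; split; apply/mapP; [exists (k + l)%N|exists k]; rewrite ?mem_iota; lia.
rewrite big_map -[iota _ _]/(index_iota 0 m.+1) big_mkord; apply: eq_bigr => i _.
have hi := ltn_ord i.
rewrite cz_sum /F; set N := (m - i + 2 * l + E)%N.
have -> : n - (i + l)%N%:Z = N by rewrite /N; lia.
have -> : (i + l)%N%:Z - l%:Z = i by lia.
under eq_bigr => h _ do rewrite czMn cz_mono1.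
have -> : a - 2 * ((m + 3 * l)%N%:Z - (i + l)%N%:Z) = a - (2 * (m - i + 2 * l))%N%:Z by lia.
set A := a - _.
case: (boolP (0 <= b - 2 * (i + l)%N%:Z <= N%:Z)) => hb.
  have [h eh] : exists h : nat, b - 2 * (i + l)%N%:Z = h by exists (absz (b - 2 * (i + l)%N%:Z)%R); lia.
  have hh : (h < N.+1)%N by lia.
  rewrite (bigD1 (Ordinal hh)) //= big1 ?addr0 => [|k /eqP hk]; last first.
    by case: eqP => [e|_]; [case: hk; apply: val_inj => /=; lia|rewrite mul0rn].
  case: eqP => [_|]; last by lia.
  rewrite eh !binF_nat -[RHS]mulr_natr natrM.
  have -> : n + b - (m + 3 * l)%N%:Z = (2 * (i + l) + E + h)%N by lia.
  ring.
rewrite [RHS]big1 => [|k _]; last first.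
  by have hk := ltn_ord k; case: eqP => [e|_]; [move: hb; rewrite e; lia|rewrite mul0rn].
suff -> : binF N (b - 2 * (i + l)%N%:Z) = 0 by rewrite !mul0r.
case e: (b - 2 * (i + l)%N%:Z) => [k|k]; last by rewrite binF_neg.
by rewrite binF_small //; lia.
Qed.

Lemma nishW_shift K n D m l a b : a < (2 ^ K)%:Z -> b < (2 ^ K)%:Z ->
  nishW (n + (2 ^ K)%:Z) D m l a b = nishW n D m l a b.
Proof.
move=> ha hb; apply: eq_bigr => j _; have hj := ltn_ord j; congr (_ * _ * _).
  by rewrite addrAC binF_shift //; lia.
have -> : n + (2 ^ K)%:Z + b - D%:Z = n + b - D%:Z + (2 ^ K)%:Z by lia.
by rewrite binF_shift //; lia.
Qed.

(** Raising n by a power of 2 larger than a + b changes none of the terms and makes n - D a natural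
    exponent E; then [XYspan_adem] applies to [nishP]. *)
Lemma nishW_adem n D m l a b (s : seq int) : D = (m + 3 * l)%N -> 0 <= a -> 0 <= b -> uniq s ->
  (forall j, 0 <= j -> 2 * j <= a -> j \in s) -> (forall j, j \in s -> 0 <= j <= a + b) ->
  nishW n D m l a b =
  \sum_(j <- s) binF (b - 1 - j) (a - 2 * j) * nishW n D m l (a + b - j) j.
Proof.
move=> eD a0 b0 us hs sb.
pose K := (absz (a + b) + absz n + D).+1.
have hK := @ltn_expl 2 K isT.
have [E eE] : exists E : nat, n + (2 ^ K)%:Z = E%:Z + D%:Z by exists (absz (n + (2 ^ K)%:Z - D%:Z)%R); lia.
rewrite -(@nishW_shift K) ?eE ?eD; [|lia|lia].
rewrite (@nishW_cz E) // (@XYspan_adem 'F_2 addFF _ (nishP_span E m l) a b s us hs).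
rewrite big_seq [RHS]big_seq; apply: eq_bigr => j /sb hj.
rewrite sc_F2 -(@nishW_shift K n); [|lia|lia].
by rewrite eE eD (@nishW_cz E).
Qed.

Section Sums.
Variable W : nmodType.

Lemma big_ord_bound (m n : nat) (F : nat -> W) :
  (forall i, (m <= i)%N || (n <= i)%N -> F i = 0) ->
  \sum_(i < m) F i = \sum_(i < n) F i.
Proof.
have aux (p q : nat) : (p <= q)%N -> (forall i, (p <= i)%N -> F i = 0) ->
    \sum_(i < p) F i = \sum_(i < q) F i.
  move=> pq h; rewrite (big_ord_widen _ _ pq) big_mkcond; apply: eq_bigr => i _.
  by case: ltnP => // /h.
move=> h; case: (leqP m n) => mn; first by apply: aux => // i hi; apply: h; rewrite hi.
by symmetry; apply: aux => [|i hi]; [exact: ltnW|apply: h; rewrite hi orbT].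
Qed.

Lemma big_diag (N : nat) (F : nat -> nat -> W) :
  \sum_(D < N) \sum_(j < D.+1) F (D - j)%N j = \sum_(j < N) \sum_(i < N - j) F i j.
Proof.
elim: N => [|N IH]; first by rewrite !big_ord0.
rewrite big_ord_recr IH /= [RHS]big_ord_recr [X in _ = _ + X]/= subSnn big_ord1.
rewrite [X in _ + X = _]big_ord_recr /= subnn addrA; congr (_ + _).
rewrite -big_split /=; apply: eq_bigr => j _.
by rewrite subSn 1?ltnW // big_ord_recr.
Qed.

End Sums.

Section FQsteenrod.
Variable M : sqspace.
Hypothesis st : steenrod_module M.

Lemma FQ_SqE r (f : FQ M) (n : int) : coef (Sq r f) n =
  \sum_(j < r.+1) sc (binF (n - j%:Z) (r%:Z - 2 * j%:Z)) (Sq j (coef f (n + r%:Z - j%:Z))).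
Proof. by apply: eq_bigr => j _; rewrite sc_bin //; apply: addxx. Qed.

Lemma FQ_Sq2 (a b : nat) (f : FQ M) (n : int) : coef (Sq b (Sq a f)) n =
  \sum_(D < (a + b).+1) \sum_(j < D.+1)
     sc (binF (n - j%:Z) (b%:Z - 2 * j%:Z) * binF (n + b%:Z - D%:Z) (a%:Z - 2 * (D%:Z - j%:Z)))
     (SqZ j (SqZ (D%:Z - j%:Z) (coef f (n + (a + b)%:Z - D%:Z)))).
Proof.
pose F (i j : nat) := sc (binF (n - j%:Z) (b%:Z - 2 * j%:Z) *
   binF (n + b%:Z - (i + j)%:Z) (a%:Z - 2 * i%:Z)) (Sq j (Sq i (coef f (n + (a + b)%:Z - (i + j)%:Z)))).
have F0 i j : (a < 2 * i)%N || (b < 2 * j)%N -> F i j = 0.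
  rewrite /F => /orP[h|h].
    by rewrite (binF_neg (n + b%:Z - _)) ?mulr0 ?sc0 //; lia.
  by rewrite (binF_neg (n - j%:Z)) ?mul0r ?sc0 //; lia.
transitivity (\sum_(D < (a + b).+1) \sum_(j < D.+1) F (D - j)%N j); last first.
  apply: eq_bigr => D _; apply: eq_bigr => j _; have hj := ltn_ord j.
  have -> : D%:Z - j%:Z = (D - j)%N by lia.
  by rewrite /F subnK.
rewrite big_diag FQ_SqE (@big_ord_bound _ b.+1 (a + b).+1 (fun j => sc (binF (n - j%:Z) (b%:Z - 2 * j%:Z))
   (Sq j (coef (Sq a f) (n + b%:Z - j%:Z))))); last first.
  by move=> j hj; rewrite binF_neg ?sc0 //; lia.
apply: eq_bigr => j _; have hj := ltn_ord j; rewrite FQ_SqE.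
case: (leqP (2 * j) b) => hb; last first.
  rewrite binF_neg ?sc0; last by lia.
  by rewrite big1 // => i _; rewrite F0 // hb orbT.
rewrite raddf_sum sc_sumr.
transitivity (\sum_(i < a.+1) F i j).
  apply: eq_bigr => i _; rewrite sc_raddf -scM /F; congr (sc (_ * binF _ _) (Sq _ (Sq _ (coef _ _)))); lia.
by apply: (@big_ord_bound M _ _ (fun i => F i j)) => i hi; apply: F0; lia.
Qed.

(** The coefficient at Q^n of each side is grouped by the total degree D of the operations that act
    on a coefficient of f. For each D, [adem_span] with S reduced to 0 leaves the numerical identity
    [nishW_adem]. *)
Lemma FQ_steenrod : steenrod_module (FQ M).
Proof.
split=> [f|a b f ab].
  apply: FQ_eq => n; rewrite FQ_SqE big_ord1 subrr binF0 sc1 subr0 addr0.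
  by case: st => ->.
pose s : seq int := [seq j%:Z | j <- iota 0 a./2.+1].
have us : uniq s by rewrite map_inj_uniq ?iota_uniq // => i j; lia.
have E : Sq b (Sq a f) - \sum_(j <- s) sc (binF (b%:Z - 1 - j) (a%:Z - 2 * j))
    (SqZ j (SqZ (a%:Z + b%:Z - j) f)) = 0; last first.
  move/eqP: E; rewrite subr_eq0 => /eqP ->.
  rewrite /s big_map -[iota _ _]/(index_iota 0 a./2.+1) big_mkord; apply: eq_bigr => j _.
  have hj := ltn_ord j.
  have -> : a%:Z + b%:Z - j%:Z = (a + b - j)%N by lia.
  have -> : b%:Z - 1 - j%:Z = (b - 1 - j)%N by lia.
  have -> : a%:Z - 2 * j%:Z = (a - j.*2)%N by lia.
  by rewrite /= binF_nat sc_nat //; exact: (@addxx (FQ M)).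
apply: FQ_eq => n; rewrite Defs.coefB Defs.coef0 Defs.coef_sum.
pose X (D : nat) := coef f (n + (a + b)%:Z - D%:Z).
pose c (a' b' : int) (D j : nat) :=
  binF (n - j%:Z) (b' - 2 * j%:Z) * binF (n + b' - D%:Z) (a' - 2 * (D%:Z - j%:Z)).
have T (a' b' : int) : 0 <= a' -> 0 <= b' -> a' + b' = a%:Z + b%:Z ->
    coef (SqZ b' (SqZ a' f)) n = \sum_(D < (a + b).+1) \sum_(j < D.+1)
      sc (c a' b' D j) (SqZ j (SqZ (D%:Z - j%:Z) (X D))).
  case: a' => // a'; case: b' => // b' _ _ e; rewrite FQ_Sq2.
  by have -> : (a' + b' = a + b)%N by lia.
rewrite (T a b) //.
have -> : \sum_(j <- s) coef (sc (binF (b%:Z - 1 - j) (a%:Z - 2 * j))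
    (SqZ j (SqZ (a%:Z + b%:Z - j) f))) n = \sum_(D < (a + b).+1) \sum_(j < D.+1)
      sc (\sum_(i <- s) binF (b%:Z - 1 - i) (a%:Z - 2 * i) * c (a%:Z + b%:Z - i) i D j)
        (SqZ j (SqZ (D%:Z - j%:Z) (X D))).
  under [RHS]eq_bigr => D _ do under eq_bigr => j _ do rewrite (sc_suml (@addxx M)).
  under [RHS]eq_bigr => D _ do rewrite exchange_big /=.
  rewrite [RHS]exchange_big /= big_seq [RHS]big_seq; apply: eq_bigr => i hi.
  have [k ek hk] : exists2 k : nat, i = k & (k <= a./2)%N.
    by case/mapP: hi => k; rewrite mem_iota => hk ->; exists k => //; lia.
  have -> : coef (sc (binF (b%:Z - 1 - i) (a%:Z - 2 * i)) (SqZ i (SqZ (a%:Z + b%:Z - i) f))) n =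
      sc (binF (b%:Z - 1 - i) (a%:Z - 2 * i)) (coef (SqZ i (SqZ (a%:Z + b%:Z - i) f)) n).
    by rewrite /sc; case: ifP.
  rewrite T; [|lia|lia|lia]; rewrite sc_sumr; apply: eq_bigr => D _.
  by rewrite sc_sumr; apply: eq_bigr => j _; rewrite scM.
apply/eqP; rewrite subr_eq0; apply/eqP; apply: eq_bigr => D _.
apply/eqP; rewrite -subr_eq0; apply/eqP.
rewrite (opp2 (@addxx M)) -big_split /=.
under eq_bigr => j _ do rewrite -(scD (@addxx M)).
pose e (j : int) : M := SqZ j (SqZ (D%:Z - j) (X D)).
apply: (@adem_span M (@addxx M) (fun x => x = 0) (erefl 0) _ D e (fun j => 0 <= j) _ _ _ _
   _ (fun j : 'I_D.+1 => j%:Z)).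
- by move=> x y -> ->; rewrite addr0.
- by move=> i j hi; apply: le_trans.
- by move=> j; rewrite -ltNge => hj; apply: SqZ_neg.
- by move=> j; apply: steenrod_reduced.
move=> [] // l _ hl.
have [m em] : exists m : nat, D%:Z - 3 * l%:Z = m by exists (absz (D%:Z - 3 * l%:Z)%R); lia.
rewrite em.
have H := @nishW_adem n D m l a b s.
transitivity (nishW n D m l a b + \sum_(i <- s) binF (b%:Z - 1 - i) (a%:Z - 2 * i) *
    nishW n D m l (a%:Z + b%:Z - i) i); last first.
  rewrite -H ?addFF //; [lia| |].
    move=> j j0 ja; apply/mapP; exists (absz j); last by lia.
    by rewrite mem_iota; lia.
  by move=> j /mapP[k]; rewrite mem_iota => hk ->; lia.
under eq_bigr => j _ do rewrite mulrDl.
rewrite big_split /=; congr (_ + _).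
rewrite /nishW; under [RHS]eq_bigr => i _ do rewrite mulr_sumr.
rewrite exchange_big /=; apply: eq_bigr => j _.
by rewrite mulr_suml; apply: eq_bigr => i _; rewrite /c -mulrA.
Qed.

End FQsteenrod.

Lemma FQn_steenrod (M : sqspace) s : steenrod_module M -> steenrod_module (FQn s M).
Proof. by move=> h; elim: s => //= s IH; apply: FQ_steenrod. Qed.

(** * The Nishida action preserves the relations among the Q^i *)

(* The analogue of [nishW] for the Adem relations among the Q^i, with q1 = x^2 + y and
   q0 = x y in place of X and Y. *)
Definition nishQ (r m : nat) (t a b : int) : 'F_2 :=
  \sum_(k < r.+1) binF (a - r%:Z) (r%:Z - 2 * k%:Z) * binF (b - k%:Z) k *
    binF m (b - k%:Z - t).

(** With x = u and y = v (u + v), [q1] and [q0] are the Dickson invariants u^2 + u v + v^2 and u v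
    (u + v). *)
Definition q1 : {poly {poly 'F_2}} := 'X^2 + 'X%:P.
Definition q0 : {poly {poly 'F_2}} := 'X * 'X%:P.

Definition Qspan := monspan (embC 'F_2) q1 q0.

Definition cq (f : {poly {poly 'F_2}}) (a b : int) : 'F_2 := cz f (a - b) b.

Lemma cq_mon c m t a b : cq (embC _ c * q1 ^+ m * q0 ^+ t) a b =
  c * (if a + b == (2 * m + 3 * t)%:Z then binF m (b - t%:Z) else 0).
Proof.
have -> : embC _ c * q1 ^+ m * q0 ^+ t = \sum_(i < m.+1)
   ((c%:P)%:P * ('X^(2 * (m - i) + t) * (1 + 'X) ^+ 0) * ('X^(i + t))%:P) *+ 'C(m, i).
  rewrite /q1 /q0 exprDn mulr_sumr mulr_suml; apply: eq_bigr => i _.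
  rewrite mulrnAr mulrnAl; congr (_ *+ _).
  by rewrite -exprM expr0 mulr1 [(_ * _) ^+ t]exprMn polyC_exp !exprD /=; ring.
rewrite /cq cz_sum.
under eq_bigr => i _ do rewrite czMn (cz_mono addFF) sc_F2.
case: (eqVneq (a + b) (2 * m + 3 * t)%:Z) => e; last first.
  rewrite mulr0 big1 // => i _; have hi := ltn_ord i.
  case: eqP => [eb|_]; last by rewrite mul0r mul0rn.
  case e1: (a - b - (2 * (m - i) + t)%N%:Z) => [[|k]|k]; last by rewrite binF_neg ?mul0r ?mul0rn.
    by exfalso; move/eqP: e; apply; lia.
  by rewrite binF_small ?mul0r ?mul0rn.
case: (boolP (0 <= b - t%:Z <= m%:Z)) => hb; last first.
  rewrite big1 => [|i _]; last first.
    by have hi := ltn_ord i; case: eqP => [eb|_]; [lia|rewrite mul0r mul0rn].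
  case e1: (b - t%:Z) => [k|k]; last by rewrite binF_neg ?mulr0.
  by rewrite binF_small ?mulr0 //; lia.
have [k ek] : exists k : nat, b - t%:Z = k by exists (absz (b - t%:Z)%R); lia.
have hk : (k < m.+1)%N by lia.
rewrite (bigD1 (Ordinal hk)) //= big1 ?addr0 => [|i /eqP ik]; last first.
  by case: eqP => [eb|_]; [case: ik; apply: val_inj => /=; lia|rewrite mul0r mul0rn].
case: eqP => [_|]; last by lia.
have -> : a - b - (2 * (m - k) + t)%N%:Z = 0 by lia.
by rewrite binF0 mul1r ek binF_nat mulr_natr.
Qed.

(** Negating all indices turns the Adem relation among the Q^i into the one among the Sq^i, so
    [binF_star_seq] applies again. *)
Lemma Qspan_adem f : Qspan f -> forall (a b : int) (s : seq int), uniq s ->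
  (forall j, binF (j - b - 1) (2 * j - a) != 0 -> j \in s) ->
  cq f a b = \sum_(j <- s) binF (j - b - 1) (2 * j - a) * cq f (a + b - j) j.
Proof.
move=> hf a b s us hs; elim: hf => {f} [|f g _ IH _ IH'|c m t].
- by rewrite /cq cz0 big1 // => j _; rewrite cz0 mulr0.
- rewrite /cq czD -/(cq f a b) -/(cq g a b) IH IH' -big_split; apply: eq_bigr => j _.
  by rewrite /cq czD mulrDr.
rewrite cq_mon; under eq_bigr => j _ do rewrite cq_mon subrK.
case: eqP => ab; last by rewrite mulr0 big1 // => j _; rewrite !mulr0.
pose s' := [seq - j | j <- s].
have us' : uniq s' by rewrite map_inj_uniq // => i j; lia.
have st := @binF_star_seq m (- b) (- (m + t)%:Z) s' us'.
have <- : binF m (- b - (- (m + t)%:Z)) = binF m (b - t%:Z).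
  by rewrite -(binF_sym m (b - t%:Z)); congr binF; lia.
rewrite st => [|j _ hj]; last first.
  apply/mapP; exists (- j); last by lia.
  by apply: hs; move: hj; congr (binF _ _ != 0); lia.
rewrite big_map mulr_sumr; apply: eq_bigr => j _.
transitivity (c * (binF m (j - t%:Z) * binF (j - b - 1) (2 * j - a))); last by ring.
congr (_ * (_ * _)); last by congr binF; lia.
by rewrite -(binF_sym m (j - t%:Z)); congr binF; lia.
Qed.

(** The total Steenrod square of q1^m q0^t: Sq(q1) = q1 + q0 + q1^2 and Sq(q0) = q0 (1 + q1 +
    q0). *)
Definition nishR (m t : nat) : {poly {poly 'F_2}} :=
  (q1 + q0 + q1 ^+ 2) ^+ m * (q0 * (1 + q1 + q0)) ^+ t.

Lemma nishR_span m t : Qspan (nishR m t).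
Proof.
apply: monspanM; apply: monspan_exp.
  by apply: monspanD (monspan_exp _ (monspanX _ _ _));
     apply: monspanD (monspanX _ _ _) (monspanY _ _ _).
apply: monspanM (monspanY _ _ _) _; apply: monspanD (monspanY _ _ _).
by apply: monspanD (monspan1 _ _ _) (monspanX _ _ _).
Qed.

Lemma nishRE m t : nishR m t = \sum_(i < m.+1) \sum_(k < (i + t).+1)
   ('X^(2 * (m - i) + t) * (1 + 'X) ^+ (2 * (m - i) + t + (i + t - k)) *
     ('X^(i + t + k))%:P) *+ ('C(m, i) * 'C(i + t, k)).
Proof.
pose y : {poly {poly 'F_2}} := 'X; pose w : {poly {poly 'F_2}} := 'X%:P.
(* The total squares of u and of v (u + v). *)
pose Y := y * (1 + y); pose V := w * ((1 + y) + w).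
have P2 (x : {poly {poly 'F_2}}) : x + x = 0.
  by apply: addpp => z; apply: addpp => z'; apply: addFF.
have e1 : q1 + q0 + q1 ^+ 2 = Y ^+ 2 + V.
  rewrite -[LHS]addr0 -[RHS]addr0 -[in LHS](P2 (y ^+ 3)) -[in RHS](P2 (y ^+ 2 * w)).
  rewrite /q1 /q0 /Y /V -/y -/w; ring.
have e2 : q0 * (1 + q1 + q0) = Y * V.
  rewrite -[LHS]addr0 -(P2 (y ^+ 2 * w)) /q1 /q0 /Y /V -/y -/w; ring.
rewrite /nishR e2 e1 [in LHS]exprDn mulr_suml; apply: eq_bigr => i _.
have e3 : (Y ^+ 2) ^+ (m - i) * V ^+ i * (Y * V) ^+ t =
   y ^+ (2 * (m - i) + t) * (1 + y) ^+ (2 * (m - i) + t) * w ^+ (i + t) * ((1 + y) + w) ^+ (i + t).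
  by rewrite -exprM /Y /V !exprMn !exprD; ring.
rewrite mulrnAl e3 [X in _ * X *+ _](exprDn (1 + y) w) mulr_sumr -sumrMnl; apply: eq_bigr => k _.
rewrite mulrnAr -mulrnA; congr (_ *+ _); last exact: mulnC.
by rewrite polyC_exp -/y -/w !exprD; ring.
Qed.

Lemma nishQ_cq (m t r : nat) (a b : int) : a + b = (2 * m + 3 * t + r)%:Z ->
  nishQ r m t a b = cq (nishR m t) a b.
Proof.
move=> eab; rewrite nishRE /cq cz_sum.
pose F (j : int) := binF (a - r%:Z) (r%:Z - 2 * j) * binF (b - j) j * binF m (b - j - t%:Z).
transitivity (\sum_(j <- [seq k%:Z | k <- iota 0 r.+1]) F j).
  by rewrite big_map -[iota _ _]/(index_iota 0 r.+1) big_mkord.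
transitivity (\sum_(j <- [seq b - t%:Z - i%:Z | i <- iota 0 m.+1]) F j).
  apply: big_uniq_supp; rewrite ?map_inj_uniq ?iota_uniq //.
  - by move=> i j; lia.
  - by move=> i j; lia.
  move=> j; rewrite /F !mulf_eq0 !negb_or => /andP[/andP[h1 h2] h3].
  have h1' : 0 <= r%:Z - 2 * j by rewrite leNgt; apply: contraNN h1 => h; rewrite binF_neg.
  have h2' : 0 <= j by rewrite leNgt; apply: contraNN h2 => h; rewrite binF_neg.
  have [k ek] : exists k : nat, b - j - t%:Z = k.
    by case e: (b - j - t%:Z) h3 => [k|k]; [exists k|rewrite binF_neg ?eqxx].
  have hk : (k <= m)%N.
    by rewrite leqNgt; apply: contraNN h3 => h; rewrite ek binF_small.
  apply/andP; split; apply/mapP; [exists (absz j)|exists k]; rewrite ?mem_iota; lia.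
rewrite big_map -[iota _ _]/(index_iota 0 m.+1) big_mkord; apply: eq_bigr => i _.
have hi := ltn_ord i.
rewrite cz_sum /F.
have -> : b - (b - t%:Z - i%:Z) = (i + t)%N by lia.
have -> : (i + t)%N%:Z - t%:Z = i by lia.
under eq_bigr => h _ do rewrite czMn cz_mono1.
set J := b - t%:Z - i%:Z.
case: (boolP (0 <= J <= (i + t)%N%:Z)) => hJ.
  have [k ek] : exists k : nat, J = k by exists (absz J); lia.
  have hk : (k < (i + t).+1)%N by lia.
  rewrite (bigD1 (Ordinal hk)) //= big1 ?addr0 => [|h /eqP kh]; last first.
    by case: eqP => [e|_]; [case: kh; apply: val_inj => /=; lia|rewrite mul0rn].
  case: eqP => [_|]; last by lia.
  rewrite ek -[RHS]mulr_natr natrM !binF_nat.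
  have -> : a - r%:Z = (2 * (m - i) + t + (i + t - k))%N by lia.
  have -> : a - b - (2 * (m - i) + t)%N%:Z = r%:Z - 2 * k%:Z by lia.
  ring.
rewrite [RHS]big1 => [|k _]; last first.
  by have hk := ltn_ord k; case: eqP => [e|_]; [lia|rewrite mul0rn].
suff -> : binF (i + t)%N J = 0 by rewrite mulr0 mul0r.
case e: J => [k|k]; last by rewrite binF_neg.
by rewrite binF_small //; lia.
Qed.

(** Corresponds to multiplication by q0^(2^K), which makes a negative exponent t nonnegative. *)
Lemma nishQ_shift K r m t a b : r%:Z < (2 ^ K)%:Z ->
  nishQ r m (t + (2 ^ K)%:Z) (a + 2 * (2 ^ K)%:Z) (b + (2 ^ K)%:Z) = nishQ r m t a b.
Proof.
move=> hr; apply: eq_bigr => k _; have hk := ltn_ord k; congr (_ * _ * binF _ _); last by lia.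
  have -> : a + 2 * (2 ^ K)%:Z - r%:Z = a - r%:Z + (2 ^ K)%:Z + (2 ^ K)%:Z by lia.
  by rewrite !binF_shift //; lia.
by rewrite addrAC binF_shift //; lia.
Qed.

Lemma nishQ_adem r m t a b (s : seq int) : a + b = (2 * m + r)%:Z + 3 * t -> uniq s ->
  (forall j, binF (j - b - 1) (2 * j - a) != 0 -> j \in s) ->
  nishQ r m t a b = \sum_(j <- s) binF (j - b - 1) (2 * j - a) * nishQ r m t (a + b - j) j.
Proof.
move=> e us hs; pose K := (absz t + r).+1.
have hK := @ltn_expl 2 K isT.
have [t' et] : exists t' : nat, t + (2 ^ K)%:Z = t' by exists (absz (t + (2 ^ K)%:Z)%R); lia.
rewrite -(@nishQ_shift K); last by lia.
rewrite et nishQ_cq; last by lia.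
pose s' := [seq j + (2 ^ K)%:Z | j <- s].
rewrite (@Qspan_adem _ (nishR_span m t') _ _ s') => [||j hj]; first last.
- apply/mapP; exists (j - (2 ^ K)%:Z); last by lia.
  by apply: hs; move: hj; congr (binF _ _ != 0); lia.
- by rewrite map_inj_uniq // => i j; lia.
rewrite big_map; apply: eq_bigr => j _; congr (_ * _); first by congr binF; lia.
rewrite -(@nishQ_shift K); last by lia.
rewrite et (@nishQ_cq m t' r); last by lia.
by congr (cq _ _ _); lia.
Qed.

(** The substitution i = k + 2 l brings the terms of (Q^a Q^b z) Sq^r that end in z Sq^l to the form
    of [nishQ]. *)
Lemma nishQ_twist (r l m : nat) (t a b : int) :
  \sum_(i < r.+1) binF (a - r%:Z) (r%:Z - 2 * i%:Z) * binF (b - i%:Z) (i%:Z - 2 * l%:Z) *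
    binF m (b - i%:Z + l%:Z - t) =
  if (4 * l <= r)%N then
    nishQ (r - 4 * l) m (t - l%:Z) (a - 4 * l%:Z) (b - 2 * l%:Z) else 0.
Proof.
case: leqP => h; last first.
  apply: big1 => i _; case: (leqP (2 * l) i) => hi.
    by rewrite binF_neg ?mul0r //; lia.
  by rewrite (binF_neg (b - i%:Z)) ?mulr0 ?mul0r //; lia.
pose F (i : nat) := binF (a - r%:Z) (r%:Z - 2 * i%:Z) * binF (b - i%:Z) (i%:Z - 2 * l%:Z) *
    binF m (b - i%:Z + l%:Z - t).
transitivity (\sum_(i <- iota 0 r.+1) F i).
  by rewrite -[iota _ _]/(index_iota 0 r.+1) big_mkord.
transitivity (\sum_(i <- [seq (k + 2 * l)%N | k <- iota 0 (r - 4 * l).+1]) F i).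
  apply: big_uniq_supp; rewrite ?map_inj_uniq ?iota_uniq //.
    by move=> i j; lia.
  move=> i; rewrite /F !mulf_eq0 !negb_or => /andP[/andP[h1 h2] _].
  have h1' : 0 <= r%:Z - 2 * i%:Z by rewrite leNgt; apply: contraNN h1 => ?; rewrite binF_neg.
  have h2' : 0 <= i%:Z - 2 * l%:Z by rewrite leNgt; apply: contraNN h2 => ?; rewrite binF_neg.
  rewrite mem_iota; apply/andP; split; first by lia.
  by apply/mapP; exists (i - 2 * l)%N; rewrite ?mem_iota; lia.
rewrite big_map -[iota _ _]/(index_iota 0 (r - 4 * l).+1) big_mkord; apply: eq_bigr => k _.
by rewrite /F; congr (binF _ _ * binF _ _ * binF _ _); lia.
Qed.

Section Nishida.
Variable M : sqspace.

Lemma Qrel_span s (z : FQn s M) (D : int) (I : Type) (r : seq I) (B : I -> int) (c : I -> 'F_2) :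
  (forall (m : nat) (t : int), D = (2 * m)%:Z + 3 * t ->
     \sum_(i <- r) c i * binF m (B i - t) = 0) ->
  Qrel (\sum_(i <- r) sc (c i) (Qop _ (D - B i) (Qop _ (B i) z)) : FQn s.+2 M).
Proof.
move=> h.
(* After this change of sign the relations among the Q^i have the shape required by [adem_span]. *)
pose e (b : int) : FQn s.+2 M := Qop _ (D + b) (Qop _ (- b) z).
have -> : \sum_(i <- r) sc (c i) (Qop _ (D - B i) (Qop _ (B i) z)) =
   \sum_(i <- r) sc (c i) (e (- B i)).
  by apply: eq_bigr => i _; rewrite /e opprK.
apply: (@adem_span _ (@addxx (FQn s.+2 M)) (@Qrel M s.+2) (@Qrel_zero M s.+2)
   (@Qrel_add M s.+2) (- D) e predT) => //.
- move=> b _; exists [seq - i | i <- window (`|D + b| + `|b|).+1]; split.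
  + by rewrite map_inj_uniq ?window_uniq // => i j; lia.
  + move=> j; apply: contraR => hj; rewrite /binF (_ : binz _ _ = 0%N) //.
    have := @Adem_window (D + b) (- b) (- j).
    have -> : (`|D + b| + `|- b|).+1 = (`|D + b| + `|b|).+1 by lia.
    have -> : - j - - b - 1 = b - 1 - j by lia.
    have -> : 2 * - j - (D + b) = - D - b - 2 * j by lia.
    by apply; apply: contraNN hj => hj; apply/mapP; exists (- j); rewrite ?opprK.
  + have := @Qrel_Adem M s (D + b) (- b) z.
    have -> : (`|D + b| + `|- b|).+1 = (`|D + b| + `|b|).+1 by lia.
    congr Qrel; congr (_ - _); rewrite [RHS]big_map; apply: eq_bigr => i _.
    have -> : b - 1 - - i = i - - b - 1 by lia.
    have -> : - D - b - 2 * - i = 2 * i - (D + b) by lia.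
    rewrite sc_bin; last exact: (@addxx (FQn s.+2 M)).
    by rewrite /e; congr (sc _ (Qop _ _ (Qop _ _ _))); lia.
- move=> l _ hl; have [m em] : exists m : nat, - D - 3 * l = m.
    by exists (absz (- D - 3 * l)%R); lia.
  rewrite em -[RHS](h m (- m%:Z - l)); last by lia.
  apply: eq_bigr => i _; congr (_ * _); rewrite -(binF_sym m (B i - _)); congr binF; lia.
Qed.

Lemma Sq_QopF s r (x : FQn s M) (n : int) : (Sq r (Qop _ n x) : FQn s.+1 M) =
  \sum_(i < r.+1) sc (binF (n - r%:Z) (r%:Z - 2 * i%:Z)) (Qop _ (n - r%:Z + i%:Z) (Sq i x)).
Proof.
apply: etrans (Sq_Qop _ _ _) _; apply: eq_bigr => i _.
by apply: sc_bin; exact: (@addxx (FQn s.+1 M)).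
Qed.

Definition nishT s (r l : nat) (z : FQn s M) (a b : int) : FQn s.+2 M :=
  \sum_(i < r.+1) sc (binF (a - r%:Z) (r%:Z - 2 * i%:Z) * binF (b - i%:Z) (i%:Z - 2 * l%:Z))
    (Qop _ (a - r%:Z + i%:Z) (Qop _ (b - i%:Z + l%:Z) (Sq l z))).

Lemma Sq_QQ s r (z : FQn s M) (a b : int) :
  (Sq r (Qop _ a (Qop _ b z)) : FQn s.+2 M) = \sum_(l < r.+1) nishT r l z a b.
Proof.
rewrite (@Sq_QopF s.+1) [RHS]exchange_big; apply: eq_bigr => i _; have hi := ltn_ord i.
rewrite (@Sq_QopF s) raddf_sum sc_sumr.
pose F (l : nat) : FQn s.+2 M := sc (binF (a - r%:Z) (r%:Z - 2 * i%:Z) * binF (b - i%:Z) (i%:Z - 2 * l%:Z))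
    (Qop _ (a - r%:Z + i%:Z) (Qop _ (b - i%:Z + l%:Z) (Sq l z))).
transitivity (\sum_(l < i.+1) F l).
  by apply: eq_bigr => l _; rewrite sc_raddf -scM.
apply: big_ord_bound => l hl.
by rewrite /F (binF_neg (b - i%:Z)) ?mulr0 ?sc0 //; lia.
Qed.

Lemma Qrel_sum s (I : Type) (r : seq I) (P : pred I) (F : I -> FQn s M) :
  (forall i, P i -> Qrel (F i)) -> Qrel (\sum_(i <- r | P i) F i).
Proof. by move=> h; apply: big_ind => //; [exact: Qrel_zero|exact: Qrel_add]. Qed.

Lemma Qrel_sc s c (u : FQn s M) : Qrel u -> Qrel (sc c u).
Proof. by rewrite /sc; case: ifP => // _ _; apply: Qrel_zero. Qed.

Lemma nishT_adem s r l (z : FQn s M) (a b : int) :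
  Qrel (nishT r l z a b - \sum_(j <- window (`|a| + `|b|).+1)
    sc (binF (j - b - 1) (2 * j - a)) (nishT r l z (a + b - j) j)).
Proof.
set w := window _.
pose c (a b : int) (i : nat) := binF (a - r%:Z) (r%:Z - 2 * i%:Z) * binF (b - i%:Z) (i%:Z - 2 * l%:Z).
pose L := [seq (c a b i, b - i%:Z + l%:Z) | i <- iota 0 r.+1] ++
  [seq (binF (j - b - 1) (2 * j - a) * c (a + b - j) j i, j - i%:Z + l%:Z) | j <- w, i <- iota 0 r.+1].
pose D := a + b - r%:Z + l%:Z.
have T (a' b' : int) : a' + b' = a + b -> nishT r l z a' b' = \sum_(i <- iota 0 r.+1)
    sc (c a' b' i) (Qop _ (D - (b' - i%:Z + l%:Z)) (Qop _ (b' - i%:Z + l%:Z) (Sq l z))).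
  move=> e; rewrite -[iota _ _]/(index_iota 0 r.+1) big_mkord; apply: eq_bigr => i _.
  by congr (sc _ (Qop _ _ _)); rewrite /D; lia.
have := @Qrel_span s (Sq l z) D _ L snd fst.
rewrite big_cat big_map big_allpairs_dep /= (T a b) //.
rewrite (opp2 (@addxx (FQn s.+2 M))).
have <- : \sum_(j <- w) \sum_(i <- iota 0 r.+1) sc (binF (j - b - 1) (2 * j - a) * c (a + b - j) j i)
     (Qop _ (D - (j - i%:Z + l%:Z)) (Qop _ (j - i%:Z + l%:Z) (Sq l z))) =
   \sum_(j <- w) sc (binF (j - b - 1) (2 * j - a)) (nishT r l z (a + b - j) j) :> FQn s.+2 M.
  apply: eq_bigr => j _; rewrite (T (a + b - j) j) ?subrK // sc_sumr.
  by apply: eq_bigr => i _; rewrite scM.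
apply=> m t eD; rewrite big_cat big_map big_allpairs_dep /=.
have H (a' b' : int) : \sum_(i <- iota 0 r.+1) c a' b' i * binF m (b' - i%:Z + l%:Z - t) =
  if (4 * l <= r)%N then
    nishQ (r - 4 * l) m (t - l%:Z) (a' - 4 * l%:Z) (b' - 2 * l%:Z) else 0.
  by rewrite -nishQ_twist -[iota _ _]/(index_iota 0 r.+1) big_mkord.
rewrite H.
have -> : \sum_(j <- w) \sum_(i <- iota 0 r.+1) binF (j - b - 1) (2 * j - a) *
    c (a + b - j) j i * binF m (j - i%:Z + l%:Z - t) =
  \sum_(j <- w) binF (j - b - 1) (2 * j - a) * (if (4 * l <= r)%N then
    nishQ (r - 4 * l) m (t - l%:Z) (a + b - j - 4 * l%:Z) (j - 2 * l%:Z) else 0).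
  apply: eq_bigr => j _; rewrite -H mulr_sumr; apply: eq_bigr => i _; by rewrite mulrA.
case: leqP => hl; last by rewrite big1 ?addr0 // => j _; rewrite mulr0.
rewrite (@nishQ_adem _ _ _ _ _ [seq j - 2 * l%:Z | j <- w]); last first.
- move=> j hj; apply/mapP; exists (j + 2 * l%:Z); last by lia.
  apply: contraR hj => /Adem_window; rewrite /binF.
  have -> : j - (b - 2 * l%:Z) - 1 = j + 2 * l%:Z - b - 1 by lia.
  have -> : 2 * j - (a - 4 * l%:Z) = 2 * (j + 2 * l%:Z) - a by lia.
  by move=> ->.
- by rewrite map_inj_uniq ?window_uniq // => i j; lia.
- by move: eD; rewrite /D; lia.
rewrite big_map -big_split big1 // => j _ /=.
have -> : j - 2 * l%:Z - (b - 2 * l%:Z) - 1 = j - b - 1 by lia.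
have -> : 2 * (j - 2 * l%:Z) - (a - 4 * l%:Z) = 2 * j - a by lia.
have -> : a - 4 * l%:Z + (b - 2 * l%:Z) - (j - 2 * l%:Z) = a + b - j - 4 * l%:Z by lia.
exact: addFF.
Qed.

Lemma Qrel_Sq s r (u : FQn s M) : Qrel u -> Qrel (Sq r u).
Proof.
move=> h; elim: h r => {s u} [s r|s u v _ hu _ hv r|s i n z hz ni r|s a b z r|s i u _ hu r].
- rewrite raddf0; exact: Qrel_zero.
- rewrite raddfD; exact: Qrel_add.
- rewrite Sq_QopF; apply: Qrel_sum => j _.
  (* For 2 j <= r, i < n implies i - r + j < n - j, so the term is again unstable. *)
  case: (leqP (2 * j) r) => hj; last by rewrite binF_neg ?sc0; [exact: Qrel_zero|lia].
  apply: Qrel_sc; apply: (@Qrel_unstable M s _ (n - j%:Z)); last by lia.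
  by rewrite /homog prSq hz.
- rewrite raddfB raddf_sum.
  have E (j : int) : Sq r (Qop _ (a + b - j) (Qop _ j z) *+ binz (j - b - 1) (2 * j - a)) =
      \sum_(l < r.+1) sc (binF (j - b - 1) (2 * j - a)) (nishT r l z (a + b - j) j).
    rewrite sc_bin; last exact: (@addxx (FQn s.+2 M)).
    by rewrite sc_raddf Sq_QQ sc_sumr.
  under [X in _ - X]eq_bigr => j _ do rewrite E.
  rewrite Sq_QQ.
  rewrite [X in _ - X]exchange_big -sumrB; apply: Qrel_sum => l _; exact: nishT_adem.
- rewrite Sq_QopF; apply: Qrel_sum => j _; exact/Qrel_sc/Qrel_Q/hu.
Qed.

End Nishida.

Lemma Nishida_stable_holds : Nishida_stable.
Proof. by move=> M s r u; apply: Qrel_Sq. Qed.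

(** * Milnor monomials and functionals on words *)

(* One variable for each letter of a word: the coefficient of [mil t] at the word w is the
   value of the Milnor monomial prod_(i in t) xi_i on Sq^w. *)
Fixpoint ipoly (l : nat) : comNzRingType := if l is l'.+1 then {poly (ipoly l')} else 'F_2.

Lemma ipoly2 l (x : ipoly l) : x + x = 0.
Proof.
elim: l x => [|l IH] x; first exact: addFF.
by apply/(@polyP (ipoly l)) => i; rewrite (@coefD (ipoly l)) coef0.
Qed.

(** The iterated coproduct of the dual Steenrod algebra. The total square in the first variable X
    sends xi_1 to X and xi_i to 0 for i > 1, so two terms of the coproduct of xi_(i+1) survive. *)
Fixpoint xi (l i : nat) : ipoly l :=
  match l return ipoly l with
  | 0%N => (i == 0%N)%:R
  | l'.+1 => if i is i'.+1 then (xi l' i'.+1)%:P + (xi l' i')%:P * 'X^(2 ^ i')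
             else 1
  end.

Definition mil (t : seq nat) (l : nat) : ipoly l := \prod_(i <- t) xi l i.

Fixpoint coefw (w : seq nat) : ipoly (size w) -> 'F_2 :=
  match w return ipoly (size w) -> 'F_2 with
  | [::] => id
  | i :: w' => fun f => coefw (f : {poly ipoly (size w')})`_i
  end.

Definition psi (t w : seq nat) : 'F_2 := coefw (mil t (size w)).

Lemma coefw0 w : coefw (0 : ipoly (size w)) = 0.
Proof. by elim: w => //= i w IH; rewrite coef0. Qed.

Lemma coefwD w (f g : ipoly (size w)) : coefw (f + g) = coefw f + coefw g.
Proof. by elim: w f g => //= i w IH f g; rewrite (@coefD (ipoly (size w))) IH. Qed.

Lemma coefw_sc w c (f : ipoly (size w)) : coefw (sc c f) = sc c (coefw f).
Proof. by rewrite /sc; case: ifP => //; rewrite coefw0. Qed.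

Lemma coefw_sum w (I : Type) (r : seq I) (F : I -> ipoly (size w)) :
  coefw (\sum_(i <- r) F i) = \sum_(i <- r) coefw (F i).
Proof. by elim/big_rec2: _ => [|i y1 y2 _ <-]; rewrite ?coefw0 ?coefwD. Qed.

Lemma xi0 l : xi l 0 = 1. Proof. by case: l. Qed.

Lemma coef_xi l i j : (xi l.+1 i.+1 : {poly ipoly l})`_j =
  (if j == 0%N then xi l i.+1 else 0) + (if j == (2 ^ i)%N then xi l i else 0).
Proof.
rewrite /= coefD coefC coefCM coefXn; case: (j == 2 ^ i)%N; case: (j == 0)%N => /=; by rewrite ?mulr1 ?mulr0.
Qed.

(* The analogue of [wordfun] for the coefficients of a polynomial. *)
Fixpoint unst_poly (l : nat) (e d : int) : ipoly l -> Prop :=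
  match l return ipoly l -> Prop with
  | 0%N => fun f => d != 0 -> f = 0
  | l'.+1 => fun f : {poly ipoly l'} =>
      forall j : nat, (d + e < 2 * j%:Z -> f`_j = 0) /\ unst_poly e (d - j%:Z) f`_j
  end.

Lemma unst_poly0 l e d : @unst_poly l e d 0.
Proof. by elim: l d => //= l IH d j; rewrite coef0. Qed.

Lemma unst_polyD l e d (f g : ipoly l) : unst_poly e d f -> unst_poly e d g -> unst_poly e d (f + g).
Proof.
elim: l d f g => [|l IH] d f g /=; first by move=> hf hg h; rewrite hf // hg // addr0.
move=> hf hg j; have [f1 f2] := hf j; have [g1 g2] := hg j.
rewrite (@coefD (ipoly l)); split; last exact: IH.
by move=> h; rewrite f1 // g1 // addr0.
Qed.

Lemma unst_poly_sum l e d (I : Type) (r : seq I) (P : pred I) (F : I -> ipoly l) :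
  (forall i, P i -> unst_poly e d (F i)) -> unst_poly e d (\sum_(i <- r | P i) F i).
Proof. by move=> h; apply: big_ind => //; [exact: unst_poly0|exact: unst_polyD]. Qed.

(** The bounds add up: when j exceeds the bound of the product, in every splitting j = i + (j - i)
    one of the parts exceeds its own bound. *)
Lemma unst_polyM l e d e' d' (f g : ipoly l) :
  unst_poly e d f -> unst_poly e' d' g -> unst_poly (e + e') (d + d') (f * g).
Proof.
elim: l d d' f g => [|l IH] d d' f g /=.
  move=> hf hg h; case: (eqVneq d 0) => [d0|d0]; last by rewrite hf ?mul0r.
  by rewrite hg ?mulr0 //; apply: contraNN h => /eqP ->; rewrite d0.
move=> hf hg j; rewrite (@coefM (ipoly l)); split.
  move=> h; apply: big1 => i _; have hi := ltn_ord i.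
  case: (leP (2 * i%:Z) (d + e)) => hi2; last by have [-> //] := hf i; rewrite mul0r.
  by have [-> ] := hg (j - i)%N; rewrite ?mulr0 //; lia.
apply: unst_poly_sum => i _; have hi := ltn_ord i.
have -> : d + d' - j%:Z = (d - i%:Z) + (d' - (j - i)%N%:Z) by lia.
by apply: IH; [case: (hf i)|case: (hg (j - i)%N)].
Qed.

Lemma unst_poly_xi l i : unst_poly 1 ((2 ^ i)%N%:Z - 1) (xi l i).
Proof.
elim: l i => [|l IH] i; first by case: i => //= i h; rewrite eqn0Ngt.
case: i => [|i].
  have -> : (2 ^ 0)%N%:Z - 1 = 0 by [].
  move=> j; rewrite [xi _ _]/= coef1; split; first by case: j => //; lia.
  case: j => [|j] /=; last by exact: unst_poly0.
  by rewrite subr0 -(xi0 l); have := IH 0%N.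
move=> j; have hp : (0 < 2 ^ i)%N by rewrite expn_gt0.
have e2 : (2 ^ i.+1 = 2 ^ i + 2 ^ i)%N by rewrite expnS mul2n addnn.
rewrite coef_xi; split.
  by move=> h; do 2![case: eqP => [?|_]; first by lia]; rewrite addr0.
case: eqP => [->|_]; case: eqP => [e|_]; rewrite ?addr0 ?add0r; try exact: unst_poly0.
- by lia.
- exact: IH.
- by have -> : (2 ^ i.+1)%N%:Z - 1 - j%:Z = (2 ^ i)%N%:Z - 1 by lia.
Qed.

Definition mdeg (t : seq nat) : nat := sumn [seq (2 ^ i - 1)%N | i <- t].

Lemma unst_poly_mil t l : unst_poly (size t)%:Z (mdeg t)%:Z (mil t l).
Proof.
rewrite /mil; elim: t => [|i t IH].
  rewrite big_nil /= /mdeg /=; elim: l => //= l IH j; rewrite coef1.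
  case: j => [|j]; first by rewrite subr0.
  by split=> [_ |]; [|exact: unst_poly0].
rewrite big_cons /mdeg /= -/(mdeg t).
have -> : (size t).+1%:Z = 1 + (size t)%:Z by lia.
have hp : (0 < 2 ^ i)%N by rewrite expn_gt0.
have -> : (2 ^ i - 1 + mdeg t)%N%:Z = ((2 ^ i)%N%:Z - 1) + (mdeg t)%:Z by lia.
by apply: unst_polyM => //; apply: unst_poly_xi.
Qed.

Definition span2 (l : nat) : {poly ipoly l} -> Prop :=
  match l return {poly ipoly l} -> Prop with
  | 0%N => fun _ => True
  | l'.+1 => fun f => monspan (embC (ipoly l')) (XX _) (YY _) f
  end.

(** Encodes the Adem relations at all pairs of consecutive letters: [span2] handles the first pair,
    the coefficients handle the later ones. *)
Fixpoint adem_poly (l : nat) : ipoly l -> Prop :=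
  match l return ipoly l -> Prop with
  | 0%N => fun _ => True
  | l'.+1 => fun f : {poly ipoly l'} => span2 f /\ forall j, adem_poly f`_j
  end.

Lemma adem_poly0 l : @adem_poly l 0.
Proof.
elim: l => //= l IH; split=> [|j]; last by rewrite coef0.
case: l {IH} => //= l; exact: monspan0.
Qed.

Lemma adem_polyD l (f g : ipoly l) : adem_poly f -> adem_poly g -> adem_poly (f + g).
Proof.
elim: l f g => //= l IH f g [f1 f2] [g1 g2]; split=> [|j]; last first.
  by rewrite (@coefD (ipoly l)); apply: IH.
by case: l f g f1 g1 {IH f2 g2} => //= l f g; apply: monspanD.
Qed.

Lemma adem_polyM l (f g : ipoly l) : adem_poly f -> adem_poly g -> adem_poly (f * g).
Proof.
elim: l f g => //= l IH f g [f1 f2] [g1 g2]; split=> [|j]; last first.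
  rewrite (@coefM (ipoly l)); apply: big_ind => [||i _]; [exact: adem_poly0|exact: adem_polyD|].
  exact: IH.
by case: l f g f1 g1 {IH f2 g2} => //= l f g; apply: monspanM.
Qed.

Lemma adem_poly1 l : @adem_poly l 1.
Proof.
elim: l => //= l IH; split=> [|j]; last by rewrite coef1; case: eqP => _ //; apply: adem_poly0.
case: l {IH} => //= l; exact: monspan1.
Qed.

Lemma exprD_pow2 (R : comNzRingType) (R2 : forall x : R, x + x = 0) (x y : R) n :
  (x + y) ^+ (2 ^ n) = x ^+ (2 ^ n) + y ^+ (2 ^ n).
Proof.
elim: n => [|n IH]; first by rewrite !expr1.
rewrite expnS mulnC !exprM IH.
by rewrite sqrrD mulr2n R2 addr0.
Qed.

Lemma adem_poly_xi l i : adem_poly (xi l i).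
Proof.
elim: l i => // l IH [|i]; first exact: adem_poly1.
split=> [|j]; last first.
  rewrite coef_xi; apply: adem_polyD; case: ifP => _ //; exact: adem_poly0.
case: l {IH} => // l.
have P2 (x : {poly {poly ipoly l}}) : x + x = 0 by exact: (@ipoly2 l.+2).
rewrite [span2]/=; case: i => [|i].
  rewrite /= !xi0 expn0 !mul1r expr1 polyCD -addrA [_ + 'X]addrC.
  exact: monspanD (monspanC _ _ _ _) (monspanX _ _ _).
(* In the recursion expanded twice, the powers x^(2^(i+1)) and y^(2^(i+1)) add up to a power of x +
   y by Frobenius, and the mixed term is a power of x^2 y. *)
have -> : xi l.+2 i.+2 = embC _ (xi l i.+2) + embC _ (xi l i.+1) * XX _ ^+ (2 ^ i.+1) +
   embC _ (xi l i) * YY _ ^+ (2 ^ i).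
  rewrite /XX (exprD_pow2 P2) /YY [xi _ _]/=.
  rewrite [in X in _ = _ + X]exprMn -exprM -expnS !polyCD !polyCM !polyC_exp. ring.
apply: monspanD; [apply: monspanD|]; try apply: monspanM; try exact: monspanC.
  exact: monspan_exp (monspanX _ _ _).
exact: monspan_exp (monspanY _ _ _).
Qed.

Lemma adem_poly_mil t l : adem_poly (mil t l).
Proof.
rewrite /mil; elim: t => [|i t IH]; rewrite ?big_nil ?big_cons; first exact: adem_poly1.
by apply: adem_polyM => //; apply: adem_poly_xi.
Qed.

Lemma coefw_adem (F : forall l, ipoly l) (hF : forall l, adem_poly (F l)) (u w : seq nat) (a b : nat) :
  (a < b.*2)%N -> coefw (F (size (u ++ [:: a, b & w]))) =
   \sum_(j < a./2.+1) coefw (F (size (u ++ [:: (a + b - j)%N, j : nat & w]))) *+ 'C(b - 1 - j, a - j.*2).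
Proof.
move=> ab; elim: u F hF => [|i u IH] F hF; last first.
  by have := IH (fun l => (F l.+1 : {poly ipoly l})`_i) (fun l => (hF l.+1).2 i).
pose s : seq int := [seq j%:Z | j <- iota 0 a./2.+1].
have us : uniq s by rewrite map_inj_uniq ?iota_uniq // => i j; lia.
have hs j : 0 <= j -> 2 * j <= a%:Z -> j \in s.
  by move=> j0 ja; apply/mapP; exists (absz j); rewrite ?mem_iota; lia.
have := @XYspan_adem (ipoly (size w)) (@ipoly2 _) _ (hF (size w).+2).1 a b s us hs.
move/(congr1 (@coefw w)); rewrite coefw_sum big_map.
rewrite -[iota _ _]/(index_iota 0 a./2.+1) big_mkord => E; apply: etrans E _.
apply: eq_bigr => j _; have hj := ltn_ord j.
have -> : a%:Z + b%:Z - j%:Z = (a + b - j)%N by lia.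
have -> : b%:Z - 1 - j%:Z = (b - 1 - j)%N by lia.
have -> : a%:Z - 2 * j%:Z = (a - j.*2)%N by lia.
rewrite coefw_sc binF_nat sc_nat //; exact: addFF.
Qed.

Lemma mil_coef0 t l : (mil t l.+1 : {poly ipoly l})`_0 = mil t l.
Proof.
rewrite /mil; elim: t => [|i t IH]; first by rewrite !big_nil coef1.
rewrite !big_cons (@coef0M (ipoly l)) IH; congr (_ * _).
case: i => [|i]; first by rewrite [xi _ _]/= coef1 xi0.
rewrite coef_xi /=; case: eqP => [e|_]; last by rewrite addr0.
by have := expn_gt0 2 i; rewrite -e.
Qed.

(** In the first variable X the leading term of xi_(i+1) is xi_i X^(2^i); leading terms multiply. *)
Lemma mil_top t l : (forall j, (sumn [seq (2 ^ i)%N | i <- t] < j)%N ->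
    (mil (map S t) l.+1 : {poly ipoly l})`_j = 0) /\
  (mil (map S t) l.+1 : {poly ipoly l})`_(sumn [seq (2 ^ i)%N | i <- t]) = mil t l.
Proof.
rewrite /mil; elim: t => [|i t [IH1 IH2]].
  by rewrite !big_nil; split=> [j|]; rewrite coef1 //; case: j.
rewrite !big_cons /=; set J := sumn _ in IH1 IH2 *; have hp : (0 < 2 ^ i)%N by rewrite expn_gt0.
have X j : (2 ^ i < j)%N -> (xi l.+1 i.+1 : {poly ipoly l})`_j = 0.
  by move=> h; rewrite coef_xi; do 2![case: eqP => [?|_]; first by lia]; rewrite addr0.
split.
  move=> j hj; rewrite (@coefM (ipoly l)) big1 // => k _; have hk := ltn_ord k.
  case: (ltnP (2 ^ i) k) => h; first by rewrite X // mul0r.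
  by rewrite [X in _ * X]IH1 ?mulr0 //; lia.
have hi : (2 ^ i < (2 ^ i + J).+1)%N by lia.
rewrite (@coefM (ipoly l)) (bigD1 (Ordinal hi)) //= addKn [X in _ + X]big1 ?addr0 ?[X in _ * X]IH2.
  congr (_ * _); rewrite [LHS]coef_xi eqxx; case: eqP => [e|_]; [lia|by rewrite add0r].
move=> k /eqP ki; have hk := ltn_ord k.
case: (ltnP (2 ^ i) k) => h; first by rewrite [X in X * _]X // mul0r.
rewrite [X in _ * X]IH1 ?mulr0 //.
have : (k : nat) <> (2 ^ i)%N by move=> e; apply: ki; apply: val_inj.
by lia.
Qed.

(** * Unstable functionals on words in the Sq^i *)

Section WordFun.
Variable V : zmodType.
Implicit Types (e d : int) (G : seq nat -> V) (u w : seq nat).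

(* The properties of w |-> f (x Sq^w), for x of degree d + e in an unstable module and f
   a linear functional on its part of degree e. *)
Record wordfun e d G : Prop := WordFun {
  wf_zero : forall u w, G (u ++ 0%N :: w) = G (u ++ w);
  wf_adem : forall u w a b, (a < b.*2)%N -> G (u ++ [:: a, b & w]) =
    \sum_(j < a./2.+1) G (u ++ [:: (a + b - j)%N, j : nat & w]) *+ 'C(b - 1 - j, a - j.*2);
  wf_deg : forall w, (sumn w)%:Z != d -> G w = 0;
  wf_inst : forall u j w, d - (sumn u)%:Z + e < 2 * j%:Z -> G (u ++ j :: w) = 0 }.

Lemma wordfun_cons e d G j : wordfun e d G -> wordfun e (d - j%:Z) (fun w => G (j :: w)).
Proof.
move=> [h1 h2 h3 h4]; split=> [u w|u w a b ab|w hw|u i w h].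
- by rewrite -!cat_cons h1.
- by rewrite -!cat_cons h2.
- by apply: h3; move: hw => /=; apply: contraNN => /eqP <-; apply/eqP; lia.
- by rewrite -cat_cons; apply: h4; move: h => /=; lia.
Qed.

Lemma wordfun0 e d : wordfun e d (fun _ => 0).
Proof. by split=> // u w a b _; rewrite big1 // => j _; rewrite mul0rn. Qed.

Lemma wordfunD e d G G' : wordfun e d G -> wordfun e d G' ->
  wordfun e d (fun w => G w + G' w).
Proof.
move=> [h1 h2 h3 h4] [k1 k2 k3 k4]; split=> [u w|u w a b ab|w hw|u i w h].
- by rewrite h1 k1.
- by rewrite h2 // k2 // -big_split; apply: eq_bigr => j _; rewrite mulrnDl.
- by rewrite h3 // k3 // addr0.
- by rewrite h4 // k4 // addr0.
Qed.

Lemma wordfun_sum e d (I : Type) (r : seq I) (F : I -> seq nat -> V) :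
  (forall i, wordfun e d (F i)) -> wordfun e d (fun w => \sum_(i <- r) F i w).
Proof.
move=> h; elim: r => [|i r IH].
  rewrite (_ : (fun w => _) = (fun _ => 0)); first exact: wordfun0.
  by apply/funext => w; rewrite big_nil.
rewrite (_ : (fun w => _) = (fun w => F i w + \sum_(j <- r) F j w)); first exact: wordfunD.
by apply/funext => w; rewrite big_cons.
Qed.

Lemma wordfun_inst0 e d G w : wordfun e d G -> d + e < 0 -> G w = 0.
Proof.
move=> h de; rewrite -(wf_zero h [::] w).
by apply: (wf_inst h (u := [::])); rewrite /=; lia.
Qed.

(** A top letter in second position can be moved to the front. Let 2 i = d - c + e: if c >= 2 i,
    then 2 c >= d + e already; if c < 2 i, every term Sq^(c + i - k) Sq^k of the Adem relation has 2
    (c + i - k) >= c + 2 i = d + e. *)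
Lemma wordfun_drop e d G : wordfun e d G ->
  (forall (j : nat) w, 2 * j%:Z = d + e -> G (j :: w) = 0) -> wordfun (e - 1) d G.
Proof.
move=> hG top; case: (hG) => h1 h2 h3 _; split=> // u.
elim: u d G hG top {h1 h2 h3} => [|c u IH] d G hG top i w hi.
  case: (ltP (d + e) (2 * i%:Z)) => h; first by apply: (wf_inst hG (u := [::])) => /=; lia.
  by apply: top; move: hi => /=; lia.
apply: (IH (d - c%:Z) (fun w => G (c :: w))); first exact: wordfun_cons; last first.
  by move: hi => /=; lia.
move=> {i u w IH hi} i w hi.
case: (ltnP c i.*2) => ci; last first.
  case: (ltP (d + e) (2 * c%:Z)) => h; first by apply: (wf_inst hG (u := [::])) => /=; lia.
  by apply: top; lia.
rewrite (wf_adem hG [::]) // big1 // => k _; have hk := ltn_ord k.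
case: (ltP (d + e) (2 * (c + i - k)%N%:Z)) => h.
  by rewrite (wf_inst hG (u := [::])) ?mul0rn //=; lia.
by rewrite /= top ?mul0rn //; lia.
Qed.

End WordFun.

(** The Adem relation Sq^0 Sq^b = Sq^b Sq^0, b > 0, moves a letter 0 to the front. *)
Lemma zero_of_front (V : zmodType) (G : seq nat -> V) :
  (forall u w a b, (a < b.*2)%N -> G (u ++ [:: a, b & w]) =
    \sum_(j < a./2.+1) G (u ++ [:: (a + b - j)%N, j : nat & w]) *+ 'C(b - 1 - j, a - j.*2)) ->
  (forall w, G (0%N :: w) = G w) -> forall u w, G (u ++ 0%N :: w) = G (u ++ w).
Proof.
move=> ad fr; elim/last_ind => [|u b IH] w //=.
rewrite !cat_rcons; case: b => [|b]; first by rewrite IH.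
rewrite -[RHS]IH [RHS]ad // big_ord1 /= subn0 add0n bin0 mulr1n.
by [].
Qed.

Lemma psi_wordfun t : wordfun (size t)%:Z (mdeg t)%:Z (psi t).
Proof.
have ad u w a b : (a < b.*2)%N -> psi t (u ++ [:: a, b & w]) =
    \sum_(j < a./2.+1) psi t (u ++ [:: (a + b - j)%N, j : nat & w]) *+ 'C(b - 1 - j, a - j.*2).
  move=> ab; exact: (coefw_adem (adem_poly_mil t)).
split=> //.
- by apply: zero_of_front => // w; rewrite /psi /= mil_coef0.
- move=> w; rewrite /psi; move: (unst_poly_mil t (size w)); move: (mil t _) => f.
  elim: w (mdeg t)%:Z f => [|i w IH] d f /=; first by move=> h; rewrite eq_sym => /h.
  by move=> h hd; apply: IH (proj2 (h i)) _; apply: contraNN hd => /eqP ?; apply/eqP; lia.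
- move=> u j w; rewrite /psi; move: (unst_poly_mil t (size (u ++ j :: w))); move: (mil t _) => f.
  elim: u (mdeg t)%:Z f => [|i u IH] d f /= hf hd.
    by rewrite (proj1 (hf j)) ?coefw0 //; lia.
  by apply: IH (proj2 (hf i)) _; lia.
Qed.

Lemma psi_nil w : psi [::] w = (all (eq_op 0%N) w)%:R.
Proof.
rewrite /psi /mil big_nil; elim: w => [|i w IH] //=.
by rewrite coef1 eq_sym; case: (0 == i)%N => //=; rewrite coefw0.
Qed.

(** A factor xi_0 = 1 raises e, the length of the monomial, without changing the functional; it pads
    the functionals that satisfy a sharper instability bound. *)
Lemma psi_cons0 t w : psi (0%N :: t) w = psi t w.
Proof. by rewrite /psi /mil big_cons xi0 mul1r. Qed.

Lemma psi_top t w : psi (map S t) ((mdeg t + size t)%N :: w) = psi t w.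
Proof.
have -> : (mdeg t + size t)%N = sumn [seq (2 ^ i)%N | i <- t].
  rewrite /mdeg; elim: t => //= i t <-.
  by have := expn_gt0 2 i; lia.
by rewrite /psi [LHS]/=; have [_ ->] := mil_top t (size w).
Qed.

Lemma mdegS t : mdeg (map S t) = (2 * mdeg t + size t)%N.
Proof.
rewrite /mdeg; elim: t => //= i t ->.
have e2 : (2 ^ i.+1 = 2 ^ i + 2 ^ i)%N by rewrite expnS mul2n addnn.
by have := expn_gt0 2 i; lia.
Qed.

Section Span.
Variable V : zmodType.
Hypothesis V2 : forall x : V, x + x = 0.

Lemma psi_sc_wordfun t (v : V) : wordfun (size t)%:Z (mdeg t)%:Z (fun w => sc (psi t w) v).
Proof.
case: (psi_wordfun t) => h1 h2 h3 h4; split=> [u w|u w a b ab|w hw|u j w h].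
- by rewrite h1.
- by rewrite h2 // (sc_suml V2); apply: eq_bigr => j _; rewrite -mulr_natr mulrC scM (sc_nat V2).
- by rewrite h3 // sc0.
- by rewrite h4 // sc0.
Qed.

Definition milsum (L : seq (seq nat * V)) (w : seq nat) : V :=
  \sum_(p <- L) sc (psi p.1 w) p.2.

Definition milfam (e d : int) (L : seq (seq nat * V)) :=
  all (fun p => ((size p.1)%:Z == e) && ((mdeg p.1)%:Z == d)) L.

Lemma milsum_wordfun e d L : milfam e d L -> wordfun e d (milsum L).
Proof.
move=> h; rewrite (_ : milsum L = fun w => \sum_(p <- L)
    if ((size p.1)%:Z == e) && ((mdeg p.1)%:Z == d) then sc (psi p.1 w) p.2 else 0); last first.
  apply/funext => w; rewrite /milsum big_seq [RHS]big_seq; apply: eq_bigr => p hp.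
  by rewrite (allP h p hp).
apply: wordfun_sum => p; case: andP => [[/eqP <- /eqP <-]|_]; first exact: psi_sc_wordfun.
exact: wordfun0.
Qed.

Definition mil_lift (L : seq (seq nat * V)) := [seq (map S p.1, p.2) | p <- L].

Lemma mil_lift_fam e d L : milfam e d L -> milfam e (2 * d + e) (mil_lift L).
Proof.
move=> /allP h; apply/allP => _ /mapP[p /h /andP[/eqP e1 /eqP e2] ->] /=.
by rewrite size_map mdegS e1 eqxx /=; apply/eqP; lia.
Qed.

Lemma mil_lift_top e d L (j : nat) w : milfam e d L -> j%:Z = d + e ->
  milsum (mil_lift L) (j :: w) = milsum L w.
Proof.
move=> /allP h hj; rewrite /milsum big_map big_seq [RHS]big_seq; apply: eq_bigr => p.
move=> /h /andP[/eqP e1 /eqP e2] /=; move: hj; rewrite -e1 -e2 => hj.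
have -> : j = (mdeg p.1 + size p.1)%N by apply/eqP; rewrite -eqz_nat hj PoszD.
by rewrite psi_top.
Qed.

(** Induction on d + e. If d + e = 2 j, the functional w |-> G (j :: w) is a combination of
    monomials, and raising their indices by one gives a combination that agrees with G on all words
    beginning with j. The difference satisfies the bound for e - 1, and its monomials are padded
    with xi_0. *)
Lemma wordfun_span e d (G : seq nat -> V) : wordfun e d G ->
  exists2 L, milfam e d L & forall w, G w = milsum L w.
Proof.
have [n hn] : exists n : nat, d + e < n%:Z by exists (absz (d + e)).+1; lia.
elim: n e d G hn => [|n IH] e d G hn hG.
  by exists [::] => // w; rewrite (wordfun_inst0 w hG) ?/milsum ?big_nil //; lia.
case: (ltP (d + e) n%:Z) => hn'; first exact: IH.
have {hn hn'} hn : d + e = n by lia.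
case: n hn IH => [|n] hn IH.
  have E w : G w = sc (all (eq_op 0%N) w)%:R (G [::]).
    elim: w => [|[|i] w IHw]; rewrite ?sc1 //.
      by rewrite (wf_zero hG [::]).
    by rewrite sc0; apply: (wf_inst hG (u := [::])) => /=; lia.
  case: (eqVneq d 0) => d0; last first.
    exists [::] => // w; rewrite E /milsum big_nil (wf_deg hG) ?scr0 //.
    by rewrite eq_sym.
  exists [:: ([::], G [::])]; first by rewrite /milfam /= !andbT /mdeg /= d0 eqxx andbT; apply/eqP; lia.
  by move=> w; rewrite /milsum big_seq1 psi_nil E.
have [L' hL' top] : exists2 L', milfam e d L' & forall (j : nat) w, 2 * j%:Z = d + e ->
    G (j :: w) = milsum L' (j :: w).
  case: (boolP (odd n.+1)) => on.
    exists [::] => // j w hj; exfalso; move: on.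
    have -> : n.+1 = j.*2 by lia.
    by rewrite odd_double.
  have [j ej] : exists j : nat, n.+1 = j.*2 by exists n.+1./2; rewrite even_halfK.
  have [|L h1 h2] := IH e (d - j%:Z) (fun w => G (j :: w)) _ (wordfun_cons j hG); first by lia.
  exists (mil_lift L).
    by have := mil_lift_fam h1; have -> : 2 * (d - j%:Z) + e = d by lia.
  move=> i w hi; have -> : i = j by lia.
  by rewrite (mil_lift_top w h1) ?h2 //; lia.
pose G1 w := G w + milsum L' w.
have hG1 : wordfun e d G1 by apply: wordfunD hG (milsum_wordfun hL').
have [||L1 h1 h2] := IH (e - 1) d G1; first by lia.
  by apply: (wordfun_drop hG1) => j w hj; rewrite /G1 top // V2.
exists ([seq (0%N :: p.1, p.2) | p <- L1] ++ L').
  rewrite /milfam all_cat -/(milfam e d L') hL' andbT; apply/allP => _ /mapP[p hp ->] /=.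
  have /andP[/eqP e1 /eqP e2] := allP h1 p hp.
  by rewrite /mdeg /= -/(mdeg p.1) e2 eqxx andbT; apply/eqP; lia.
move=> w; rewrite /milsum big_cat big_map /=.
under eq_bigr => p _ do rewrite psi_cons0.
by rewrite -/(milsum L1 w) -/(milsum L' w) -h2 /G1 -addrA V2 addr0.
Qed.

(** Once G is a combination of Milnor monomials, raising all their indices by one gives G'. *)
Lemma wordfun_lift e d (G : seq nat -> V) : wordfun e d G ->
  exists2 G', wordfun e (2 * d + e) G' &
    forall (j : nat) w, j%:Z = d + e -> G' (j :: w) = G w.
Proof.
move=> /wordfun_span [L hL E]; exists (milsum (mil_lift L)).
  exact/milsum_wordfun/mil_lift_fam.
by move=> j w hj; rewrite E (mil_lift_top w hL).
Qed.

End Span.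

(** * The filtration of the relations by instability *)

(* [Qrel] for [susp k M], read on M itself: see [reg_Qrel]. *)
Inductive Qrelk (M : sqspace) (k : int) : forall s, FQn s M -> Prop :=
| Qrelk_zero s : Qrelk k (0 : FQn s M)
| Qrelk_add s (u v : FQn s M) : Qrelk k u -> Qrelk k v -> Qrelk k (u + v)
| Qrelk_unstable s (i n : int) (z : FQn s M) :
    homog n z -> i < n + k -> @Qrelk M k s.+1 (Qop _ i z)
| Qrelk_Adem s (a b : int) (z : FQn s M) :
    @Qrelk M k s.+2 (Qop _ a (Qop _ b z)
       - \sum_(i <- window (`|a| + `|b|).+1)
            Qop _ (a + b - i) (Qop _ i z) *+ binz (i - b - 1) (2 * i - a))
| Qrelk_Q s (i : int) (u : FQn s M) : Qrelk k u -> @Qrelk M k s.+1 (Qop _ i u).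

Section Relk.
Variable M : sqspace.

Lemma Qrelk_sum k s (I : Type) (r : seq I) (P : pred I) (F : I -> FQn s M) :
  (forall i, P i -> Qrelk k (F i)) -> Qrelk k (\sum_(i <- r | P i) F i).
Proof. by move=> h; apply: big_ind => //; [exact: Qrelk_zero|exact: Qrelk_add]. Qed.

Lemma Qrelk_sc k s c (u : FQn s M) : Qrelk k u -> Qrelk k (sc c u).
Proof. by rewrite /sc; case: ifP => // _ _; apply: Qrelk_zero. Qed.

Lemma Qrelk_AdemF k s (a b : int) (z : FQn s M) :
    @Qrelk M k s.+2 (Qop _ a (Qop _ b z)
       - \sum_(i <- window (`|a| + `|b|).+1)
            sc (binF (i - b - 1) (2 * i - a)) (Qop _ (a + b - i) (Qop _ i z))).
Proof.
have := Qrelk_Adem k a b z; congr Qrelk; congr (_ - _); apply: eq_bigr => i _.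
by apply: sc_bin; exact: (@addxx (FQn s.+2 M)).
Qed.

Lemma Qrelk_pr k s n (u : FQn s M) : Qrelk k u -> Qrelk k (grpr n u).
Proof.
move=> h; elim: h n => {s u} [s n|s u v _ hu _ hv n|s i m z hz im n|s a b z n|s i u _ hu n].
- rewrite raddf0; exact: Qrelk_zero.
- rewrite raddfD; exact: Qrelk_add.
- rewrite grpr_Qop -hz prpr; case: eqP => [_|_].
    by rewrite hz; apply: Qrelk_unstable hz im.
  rewrite raddf0; exact: Qrelk_zero.
- set w := window _.
  suff -> : grpr n (Qop _ a (Qop _ b z) - \sum_(i <- w)
      Qop _ (a + b - i) (Qop _ i z) *+ binz (i - b - 1) (2 * i - a)) =
    Qop _ a (Qop _ b (grpr (n - a - b) z)) - \sum_(i <- w)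
      Qop _ (a + b - i) (Qop _ i (grpr (n - a - b) z)) *+ binz (i - b - 1) (2 * i - a).
    exact: Qrelk_Adem.
  rewrite raddfB !grpr_Qop raddf_sum; congr (_ - _); apply: eq_bigr => i _.
  by rewrite raddfMn !grpr_Qop; congr (Qop _ _ (Qop _ _ (grpr _ _)) *+ _); lia.
- rewrite grpr_Qop; exact: Qrelk_Q.
Qed.

Lemma Qrelk_mono k k' s (u : FQn s M) : k <= k' -> Qrelk k u -> Qrelk k' u.
Proof.
move=> kk; elim=> {s u} [s|s u v _ hu _ hv|s i m z hz im|s a b z|s i u _ hu].
- exact: Qrelk_zero.
- exact: Qrelk_add.
- by apply: (Qrelk_unstable hz); lia.
- exact: Qrelk_Adem.
- exact: Qrelk_Q.
Qed.

Lemma homog_pr n (N : sqspace) (x : N) : homog n (grpr n x).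
Proof. by rewrite /homog prpr eqxx. Qed.

Lemma homog_Qop n i s (z : FQn s M) : homog n z -> @homog (FQn s.+1 M) (n + i) (Qop _ i z).
Proof. by move=> h; rewrite /homog [LHS]grpr_Qop addrK h. Qed.

Lemma Qop_window s i (z : FQn s M) : exists N,
  Qop _ i z = \sum_(n <- window N) Qop _ i (grpr n z) :> FQn s.+1 M.
Proof. by have [N e] := pr_window z; exists N; rewrite {1}e raddf_sum. Qed.

(** There are finitely many terms Q^i z with z homogeneous, and each is unstable once the bound is
    large. *)
Lemma Qrelk_large k s (u : FQn s.+1 M) : exists m : nat, Qrelk (k + m%:Z) u.
Proof.
have sumk (r : seq int) (F : int -> FQn s.+1 M) : (forall n, exists m : nat, Qrelk (k + m%:Z) (F n)) ->
    exists m : nat, Qrelk (k + m%:Z) (\sum_(n <- r) F n).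
  move=> h; elim: r => [|n r [m hm]].
    by exists 0%N; rewrite big_nil; apply: Qrelk_zero.
  have [m' hm'] := h n; exists (m + m')%N; rewrite big_cons; apply: Qrelk_add.
    by apply: Qrelk_mono hm'; lia.
  by apply: Qrelk_mono hm; lia.
have [N ->] := FQ_gen u; apply: (sumk) => i.
have [N' ->] := Qop_window i (coef u i); apply: sumk => n.
exists (absz (i - n - k)%R).+1; apply: (Qrelk_unstable (homog_pr n _)); lia.
Qed.

Lemma Q0_supp k s (u : FQn s M) : finsupp (fun i => grpr (i - k) u).
Proof. by have [N h] := pr_bnd u; exists (N + `|k|)%N => i hi; apply: h; lia. Qed.

Lemma Q0_add k s : zmod_morphism (fun u : FQn s M => FQ_mk (Q0_supp k u) : FQn s.+1 M).
Proof. by move=> u v; apply: FQ_eq => n; rewrite /= raddfB. Qed.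

Definition Q0 k s : {additive FQn s M -> FQn s.+1 M} := additive_of (@Q0_add k s).

Lemma coefQ0 k s (u : FQn s M) i : coef (Q0 k s u) i = grpr (i - k) u.
Proof. by []. Qed.

Lemma Q0_homog k s n (z : FQn s M) : homog n z -> Q0 k s z = Qop _ (n + k) z.
Proof.
move=> h; apply: FQ_eq => i; rewrite coefQ0 -h prpr h coefQ.
by have -> : (i - k == n) = (i == n + k) by lia.
Qed.

Lemma Q0_window k s (u : FQn s M) : exists N,
  Q0 k s u = \sum_(n <- window N) Qop _ (n + k) (grpr n u).
Proof.
have [N e] := pr_window u; exists N; rewrite {1}e raddf_sum; apply: eq_bigr => n _.
by rewrite (Q0_homog _ (homog_pr n u)).
Qed.

Lemma Qrelk_Q0 k s (u : FQn s M) : Qrelk k u -> Qrelk k (Q0 k s u).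
Proof.
move=> h; have [N ->] := Q0_window k u; apply: Qrelk_sum => n _.
exact/Qrelk_Q/Qrelk_pr.
Qed.

(** In the Adem expansion of Q^i Q^b w with b = n + k, the terms Q^(i + b - j) Q^j w with 2 j < i
    have coefficient 0, those with 2 j > i are unstable, and the one with 2 j = i is Q_0 Q^j w. *)
Lemma QQ0_homog k s i n (w : FQn s M) : homog n w ->
  exists w' : FQn s.+1 M, Qrelk k (Qop _ i (Q0 k s w) + Q0 k s.+1 w' : FQn s.+2 M).
Proof.
move=> hw; rewrite (Q0_homog k hw); set b := n + k.
pose T j : FQn s.+2 M := sc (binF (j - b - 1) (2 * j - i)) (Qop _ (i + b - j) (Qop _ j w)).
have hT j : 2 * j != i -> Qrelk k (T j).
  move=> ji; case: (ltP (2 * j - i) 0) => h.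
    by rewrite /T binF_neg // sc0; apply: Qrelk_zero.
  by apply/Qrelk_sc/(Qrelk_unstable (homog_Qop j hw)); rewrite /b; lia.
suff [w' hw'] : exists w' : FQn s.+1 M,
    Qrelk k (\sum_(j <- window (`|i| + `|b|).+1) T j + Q0 k s.+1 w').
  exists w'; have := Qrelk_add (Qrelk_AdemF k i b w) hw'.
  by rewrite addrA subrK.
case: (boolP (has (fun j => 2 * j == i) (window (`|i| + `|b|).+1))) => [/hasP[j jw /eqP ji]|h].
  exists (Qop _ j w); rewrite (Q0_homog k (homog_Qop j hw)).
  rewrite (bigD1_seq j) ?window_uniq //= {1}/T ji subrr binF0 sc1.
  have -> : i + b - j = n + j + k by rewrite /b; lia.
  rewrite addrAC (@addxx (FQn s.+2 M)) add0r; apply: Qrelk_sum => j' jj'; apply: hT.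
  by apply: contraNN jj' => /eqP e; apply/eqP; lia.
exists 0; rewrite raddf0 addr0 big_seq; apply: Qrelk_sum => j jw; apply: hT.
by apply: contraNN h => h; apply/hasP; exists j.
Qed.

Lemma QQ0 k s i (w : FQn s M) :
  exists w' : FQn s.+1 M, Qrelk k (Qop _ i (Q0 k s w) + Q0 k s.+1 w' : FQn s.+2 M).
Proof.
have [N ->] := pr_window w; elim: (window N) => [|n r [w1 h1]].
  by exists 0; rewrite big_nil !raddf0 addr0; apply: Qrelk_zero.
have [w2 h2] := QQ0_homog k i (homog_pr n w).
exists (w2 + w1); rewrite big_cons !raddfD /= addrACA; exact: Qrelk_add.
Qed.

(** The case of a relation under an outer Q^i is [QQ0]: modulo the relations, Q^i preserves the
    image of Q_0. *)
Lemma Qrelk_succ k s (u : FQn s M) : Qrelk (k + 1) u ->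
  match s return FQn s M -> Prop with
  | 0%N => fun u => u = 0
  | s'.+1 => fun u => exists w, Qrelk k (u + Q0 k s' w)
  end u.
Proof.
elim=> {s u} [[|s]|[|s] u v _ hu _ hv|s i m z hz im|s a b z|s i u _ hu] //.
- by exists 0; rewrite raddf0 addr0; apply: Qrelk_zero.
- by rewrite hu hv addr0.
- have [w1 h1] := hu; have [w2 h2] := hv; exists (w1 + w2).
  by rewrite raddfD addrACA; apply: Qrelk_add.
- case: (ltP i (m + k)) => h.
    by exists 0; rewrite raddf0 addr0; apply: Qrelk_unstable hz h.
  exists z; rewrite (Q0_homog k hz); have -> : i = m + k by lia.
  by rewrite (@addxx (FQn s.+1 M)); apply: Qrelk_zero.
- by exists 0; rewrite raddf0 addr0; apply: Qrelk_Adem.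
- case: s u hu => [|s] u hu.
    by exists 0; rewrite hu !raddf0 addr0; apply: Qrelk_zero.
  have [w hw] := hu; have [w' hw'] := QQ0 k i w; exists w'.
  have := Qrelk_add (Qrelk_Q i hw) hw'; congr Qrelk.
  by rewrite raddfD -addrA [X in _ + X]addrA (@addxx (FQn s.+2 M)) add0r.
Qed.

End Relk.

Arguments Q0 {M} k s.

(** * Pairing words in the Q^i with functionals on words in the Sq^i *)

Section Pairing.
Variables (M : sqspace) (B : nat) (N n : int).

Definition lead (G : seq nat -> 'F_2) (j : int) (w : seq nat) : 'F_2 :=
  if j is Posz j then G (j :: w) else 0.

(* Evaluates G on the word 2^(s-1) N - i_1, ..., N - i_s when I = (i_1, ..., i_s): this
   substitution turns the Adem relations among the Q^i into those among the Sq^i. *)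
Fixpoint pairing s (G : seq nat -> 'F_2) : FQn s M -> M :=
  match s return FQn s M -> M with
  | 0%N => fun u => sc (G [::]) (grpr n u)
  | s'.+1 => fun u => \sum_(j < B) pairing (lead G j%:Z) (coef u ((2 ^ s')%:Z * N - j%:Z))
  end.

Lemma pairing_zero s G : pairing G (0 : FQn s M) = 0.
Proof.
elim: s G => [|s IH] G /=; first by rewrite raddf0 scr0.
by rewrite big1 // => j _; rewrite IH.
Qed.

Lemma pairingD s G (u v : FQn s M) : pairing G (u + v) = pairing G u + pairing G v.
Proof.
elim: s G u v => [|s IH] G u v /=; first by rewrite raddfD scrD.
by rewrite -big_split; apply: eq_bigr => j _; rewrite IH.
Qed.

Lemma pairing_sum s G (I : Type) (r : seq I) (F : I -> FQn s M) :
  pairing G (\sum_(i <- r) F i) = \sum_(i <- r) pairing G (F i).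
Proof. by elim/big_rec2: _ => [|i y1 y2 _ <-]; rewrite ?pairing_zero ?pairingD. Qed.

Lemma pairing_sc s G c (u : FQn s M) : pairing G (sc c u) = sc c (pairing G u).
Proof. by rewrite /sc; case: ifP; rewrite ?pairing_zero. Qed.

Lemma pairing_eq s G G' (u : FQn s M) : (forall w, G w = G' w) -> pairing G u = pairing G' u.
Proof. by move=> h; congr pairing; apply/funext. Qed.

Lemma pairing_G0 s G (u : FQn s M) : (forall w, G w = 0) -> pairing G u = 0.
Proof.
elim: s G u => [|s IH] G u h /=; first by rewrite h sc0.
by rewrite big1 // => j _; apply: IH => w; apply: h.
Qed.

Lemma pairing_GD s G G' (u : FQn s M) : pairing (fun w => G w + G' w) u = pairing G u + pairing G' u.
Proof.
elim: s G G' u => [|s IH] G G' u /=; first by rewrite (scD (@addxx M)).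
by rewrite -big_split; apply: eq_bigr => j _; rewrite /= -IH.
Qed.

Lemma pairing_Gsum s (I : Type) (r : seq I) (c : I -> 'F_2) (G : I -> seq nat -> 'F_2) (u : FQn s M) :
  pairing (fun w => \sum_(i <- r) sc (c i) (G i w)) u = \sum_(i <- r) sc (c i) (pairing (G i) u).
Proof.
elim: r => [|i r IH]; first by rewrite big_nil pairing_G0 // => w; rewrite big_nil.
rewrite big_cons -IH.
rewrite (@pairing_eq _ _ (fun w => sc (c i) (G i w) + \sum_(j <- r) sc (c j) (G j w))).
  by rewrite pairing_GD /sc; case: ifP => _ //; rewrite pairing_G0.
by move=> w; rewrite big_cons.
Qed.

Definition bounded (G : seq nat -> 'F_2) := forall (j : nat) u w, (B <= j)%N -> G (u ++ j :: w) = 0.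

Lemma bounded_lead G j : bounded G -> bounded (lead G j).
Proof. by move=> h i u w hi; case: j => [j|j] //=; rewrite -cat_cons h. Qed.

Lemma pairing_Qop s G i (z : FQn s M) : bounded G ->
  pairing G (Qop _ i z : FQn s.+1 M) = pairing (lead G ((2 ^ s)%:Z * N - i)) z.
Proof.
move=> hG /=; set A := (2 ^ s)%:Z * N.
case: (boolP (0 <= A - i < B%:Z)) => h.
  have [j ej] : exists j : nat, A - i = j by exists (absz (A - i)%R); lia.
  have hj : (j < B)%N by lia.
  rewrite (bigD1 (Ordinal hj)) //= big1 ?addr0 => [|k /eqP kj]; last first.
    case: eqP => [e|_]; last exact: pairing_zero.
    by case: kj; apply: val_inj => /=; lia.
  by case: eqP => [_|]; [rewrite ej|lia].
rewrite big1 => [|k _]; last first.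
  by have hk := ltn_ord k; case: eqP => [e|_]; [lia|exact: pairing_zero].
rewrite pairing_G0 // => w; rewrite /lead; case e: (A - i) => [j|j] //.
by apply: (hG j [::]); lia.
Qed.

Lemma pairing_deg s G d m (z : FQn s M) : homog m z ->
  (forall w, (sumn w)%:Z != d -> G w = 0) -> d + m != (2 ^ s)%:Z * N - N + n ->
  pairing G z = 0.
Proof.
elim: s G d m z => [|s IH] G d m z hz hG hd /=.
  case: (eqVneq 0 d) => d0; last by rewrite hG ?sc0.
  rewrite -hz prpr; case: eqP => [e|_]; last by rewrite scr0.
  by exfalso; move: hd; rewrite -d0 e expn0 mul1r subrr !add0r eqxx.
apply: big1 => j _.
have hc : homog (m - ((2 ^ s)%:Z * N - j%:Z)) (coef z ((2 ^ s)%:Z * N - j%:Z)).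
  by rewrite /homog -[X in _ = coef X _]hz.
apply: (IH _ (d - j%:Z) _ _ hc) => [w hw|].
  by apply: hG; apply: contraNN hw => /= /eqP e; apply/eqP; lia.
apply: contraNN hd => /eqP e; apply/eqP; rewrite expnS; lia.
Qed.

End Pairing.

Lemma wordfun_bounded B e d G : wordfun e d G -> d < B%:Z -> bounded B G.
Proof.
move=> h hd j u w hj; apply: (wf_deg h); rewrite sumn_cat /=; apply/eqP; lia.
Qed.

Lemma wordfun_lead e d (G : seq nat -> 'F_2) j : wordfun e d G -> wordfun e (d - j) (lead G j).
Proof. by case: j => j h; [exact: wordfun_cons|exact: wordfun0]. Qed.

Lemma wordfun_weaken (V : zmodType) e e' d (G : seq nat -> V) : e <= e' ->
  wordfun e d G -> wordfun e' d G.
Proof. by move=> ee [h1 h2 h3 h4]; split=> // u j w h; apply: h4; lia. Qed.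

Lemma lead_adem e d (G : seq nat -> 'F_2) (a b : int) (s : seq int) w : wordfun e d G -> uniq s ->
  (forall j, 0 <= j -> binF (b - 1 - j) (a - 2 * j) != 0 -> j \in s) ->
  lead (lead G a) b w =
  \sum_(j <- s) sc (binF (b - 1 - j) (a - 2 * j)) (lead (lead G (a + b - j)) j w).
Proof.
move=> h us hs.
have E x y : lead (lead G x) y w = extz (fun x y => G [:: x, y & w]) x y.
  by case: x => x; case: y.
rewrite E (@extz_ext _ (fun x y => G [:: x, y & w]) addFF _ a b s us hs).
  by apply: eq_bigr => j _; rewrite E.
by move=> x y; apply: (wf_adem h [::] w).
Qed.

(** The value e = N - n - k makes instability of the Q^i with bound k correspond to instability of
    G, see [Qrelk_killed]. *)
Definition killed M k s (u : FQn s M) := forall B N n e d G, wordfun e d G ->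
  e = N - n - k -> d < B%:Z -> pairing B N n G u = 0.

Arguments killed {M} k {s} u.

Lemma Qrelk_killed M k s (u : FQn s M) : Qrelk k u -> killed k u.
Proof.
move=> h B N n; elim: h => {s u} [s|s u v _ hu _ hv|s i m z hz im|s a b z|s i u _ hu] e d G hG he hd.
- exact: pairing_zero.
- by rewrite pairingD (hu _ _ _ hG) // (hv _ _ _ hG) // addr0.
- have bG := wordfun_bounded hG hd; rewrite pairing_Qop //.
  set J := (2 ^ s)%:Z * N - i; have hJ := wordfun_lead J hG.
  case: (eqVneq (d - J + m) ((2 ^ s)%:Z * N - N + n)) => E; last first.
    exact: (pairing_deg _ hz (wf_deg hJ)).
  (* Equal degrees give d + e = J + 2^s N - m - k, and since J = 2^s N - i, the inequality i < m + k
     becomes d + e < 2 J. *)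
  apply: pairing_G0 => w; rewrite /lead; case eJ: J => [j|j] //.
  by apply: (wf_inst hG (u := [::])) => /=; move: E; rewrite eJ; rewrite /J in eJ; lia.
- have bG := wordfun_bounded hG hd.
  rewrite (opp2 (@addxx (FQn s.+2 M))) pairingD pairing_sum.
  under eq_bigr => i _ do rewrite (sc_bin (@addxx (FQn s.+2 M))) pairing_sc.
  pose A1 := (2 ^ s.+1)%:Z * N; pose A := (2 ^ s)%:Z * N.
  have E (x y : int) : pairing B N n G (Qop _ x (Qop _ y z) : FQn s.+2 M) =
      pairing B N n (lead (lead G (A1 - x)) (A - y)) z.
    by rewrite pairing_Qop // pairing_Qop //; apply: bounded_lead.
  rewrite E; under eq_bigr => i _ do rewrite E.
  rewrite -pairing_Gsum -pairing_GD; apply: pairing_G0 => w.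
  set W := window _.
  rewrite (@lead_adem e d G _ _ [seq A - i | i <- W] w hG).
  + rewrite big_map -big_split big1 // => i _ /=.
    have -> : A - b - 1 - (A - i) = i - b - 1 by lia.
    (* This doubling is the reason for the powers of 2 in [pairing]: it makes A1 - a - 2 (A - i)
       equal to 2 i - a. *)
    have eA : A1 = A + A by rewrite /A1 /A expnS; lia.
    have -> : A1 - a - 2 * (A - i) = 2 * i - a by rewrite eA; lia.
    have -> : A1 - a + (A - b) - (A - i) = A1 - (a + b - i) by lia.
    exact: addFF.
  + by rewrite map_inj_uniq ?window_uniq // => i j; lia.
  + move=> j _ hj; apply/mapP; exists (A - j); last by lia.
    apply: contraR hj => /Adem_window; rewrite /binF.
    have -> : A - b - 1 - j = A - j - b - 1 by lia.
    have eA : A1 = A + A by rewrite /A1 /A expnS; lia.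
    have -> : A1 - a - 2 * j = 2 * (A - j) - a by rewrite eA; lia.
    by move=> ->.
- have bG := wordfun_bounded hG hd; rewrite pairing_Qop //.
  case eJ: ((2 ^ s)%:Z * N - i) => [j|j]; last by apply: pairing_G0.
  by apply: (hu _ _ _ (wordfun_lead j hG)) => //; lia.
Qed.

Lemma pairing_boundE M B B' N n s G (u : FQn s M) : bounded B G -> bounded B' G ->
  pairing B N n G u = pairing B' N n G u.
Proof.
elim: s G u => [|s IH] G u h h' //=.
pose F j := pairing B N n (lead G j%:Z) (coef u ((2 ^ s)%:Z * N - j%:Z)).
rewrite (@big_ord_bound _ B B' F).
  by apply: eq_bigr => j _; apply: IH; apply: bounded_lead.
move=> j /orP[hj|hj]; apply: pairing_G0 => w; [exact: (h j [::])|exact: (h' j [::])].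
Qed.

Lemma pairing_Q0 M B N n k s e d (G G' : seq nat -> 'F_2) (u : FQn s M) :
  wordfun e d G' -> wordfun e (2 * d + e) G ->
  (forall (j : nat) w, j%:Z = d + e -> G (j :: w) = G' w) ->
  e = N - n - k -> 2 * d + e < B%:Z -> pairing B N n G (Q0 k s u) = pairing B N n G' u.
Proof.
move=> hG' hG top he hB; have bG := wordfun_bounded hG hB.
have [N' eu] := pr_window u; rewrite eu raddf_sum !pairing_sum; apply: eq_bigr => m _.
have hm := homog_pr m u; rewrite (Q0_homog k hm) pairing_Qop //.
set A := (2 ^ s)%:Z * N; set J := A - (m + k); have hJ := wordfun_lead J hG.
case: (eqVneq (d + m) (A - N + n)) => E; last first.
  rewrite [RHS](pairing_deg B hm (wf_deg hG') E); apply: (pairing_deg _ hm (wf_deg hJ)).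
  by apply: contraNN E => /eqP E; apply/eqP; rewrite /J in E; lia.
apply: pairing_eq => w; rewrite /lead; case eJ: J => [j|j].
  by apply: top; rewrite /J in eJ; lia.
by rewrite (wordfun_inst0 w hG') //; rewrite /J in eJ; lia.
Qed.

(** By [wordfun_lift], each functional G' that tests u comes from a functional G whose value on Q_0
    u is the value of G' on u. *)
Lemma killed_Q0 M k s (u : FQn s M) : killed k (Q0 k s u) -> killed k u.
Proof.
move=> h B N n e d G' hG' he hd; have [G hG top] := wordfun_lift addFF hG'.
pose B' := (absz (2 * d + e) + B).+1.
rewrite (@pairing_boundE _ B B'); last first.
- by apply: (wordfun_bounded hG'); rewrite /B'; lia.
- exact: (wordfun_bounded hG').
rewrite -(pairing_Q0 u hG' hG top he) ?(h _ _ _ _ _ _ hG) //; rewrite /B'; lia.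
Qed.

Lemma killed_mono M k k' s (u : FQn s M) : k <= k' -> killed k u -> killed k' u.
Proof.
move=> kk h B N n e d G hG he hd; apply: (h B N n (N - n - k) d G) => //.
by apply: wordfun_weaken hG; lia.
Qed.

Lemma killedD M k s (u v : FQn s M) : killed k u -> killed k v -> killed k (u + v).
Proof.
by move=> h h' B N n e d G hG he hd; rewrite pairingD (h _ _ _ _ _ _ hG) // (h' _ _ _ _ _ _ hG) // addr0.
Qed.

(** Descent from a bound k + m at which u is a relation. Lowering the bound by one leaves a term Q_0
    w; it is killed, hence so is w, which is shorter and therefore a relation by induction on the
    length. *)
Lemma killed_Qrelk M k s (u : FQn s M) : killed k u -> Qrelk k u.
Proof.
elim: s k u => [|s IH] k u hu.
  suff -> : u = 0 by apply: Qrelk_zero.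
  (* N = n + k makes e = 0, so the empty monomial reads off the component of degree n. *)
  apply: pr_sep => n; have := hu 1%N (n + k) n 0 0 (psi [::]) (psi_wordfun [::]).
  by rewrite /= psi_nil /= sc1 => ->; rewrite //; lia.
have [m hm] := Qrelk_large k u; elim: m hm => [|m IHm] hm; first by rewrite addr0 in hm.
apply: IHm; set k' := k + m%:Z.
have [|w hw] := @Qrelk_succ M k' s.+1 u; first by have -> : k' + 1 = k + m.+1%:Z by rewrite /k'; lia.
have kw : Qrelk k' w.
  apply: IH; apply: killed_Q0.
  have -> : Q0 k' s w = u + (u + Q0 k' s w) by rewrite addrA (@addxx (FQn s.+1 M)) add0r.
  apply: killedD; last exact: Qrelk_killed.
  by apply: killed_mono hu; rewrite /k'; lia.
have := Qrelk_add hw (Qrelk_Q0 kw).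
by rewrite -addrA (@addxx (FQn s.+1 M)) addr0.
Qed.

Lemma Q0_injective M k s (u : FQn s M) : Qrelk k (Q0 k s u) -> Qrelk k u.
Proof. by move=> h; apply/killed_Qrelk/killed_Q0/Qrelk_killed. Qed.

(** * The differential and acyclicity *)

Section Amap.
Variables (M N : sqspace) (f : {additive M -> N}).

Lemma amap_supp (u : FQ M) : finsupp (fun n => f (coef u n)).
Proof. by have [B h] := coef_supp u; exists B => n hn; rewrite h // raddf0. Qed.

Lemma amap_add : zmod_morphism (fun u => FQ_mk (amap_supp u) : FQ N).
Proof. by move=> u v; apply: FQ_eq => n; rewrite /= raddfB. Qed.

(** Needed besides [FQ_gmap] for maps that do not preserve degrees, such as [del] and the regradings
    below. *)
Definition amap : {additive FQ M -> FQ N} := additive_of amap_add.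

Lemma coef_amap u n : coef (amap u) n = f (coef u n). Proof. by []. Qed.

Lemma amap_Q i x : amap (Qop M i x) = Qop N i (f x).
Proof. by apply: FQ_eq => n; rewrite coef_amap !coefQ; case: eqP; rewrite ?raddf0. Qed.
End Amap.

Section Del.
Variable M : lfAmod.

Lemma del0_supp (x : M) : finsupp (fun n => SqZ (n + 1) x).
Proof.
have [N h] := lf_Sq_eq0 x; exists N => n hn.
by case e: (n + 1) => [i|i] //=; rewrite h //; lia.
Qed.

Lemma del0_add : zmod_morphism (fun x : M => FQ_mk (del0_supp x) : FQ M).
Proof.
move=> x y; apply: FQ_eq => n; rewrite Defs.coefB /=.
by case: (n + 1) => [i|i] /=; rewrite ?raddfB ?subrr.
Qed.

Definition del0 : {additive M -> FQ M} := additive_of del0_add.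

Lemma coef_del0 x n : coef (del0 x) n = SqZ (n + 1) x. Proof. by []. Qed.

Fixpoint del s : {additive FQn s M -> FQn s.+1 M} :=
  if s is s'.+1 then amap (del s') else del0.

Lemma del_Q s i (z : FQn s M) : del s.+1 (Qop _ i z) = Qop _ i (del s z).
Proof. exact: amap_Q. Qed.

Lemma del_pr s n (u : FQn s M) : grpr n (del s u) = del s (grpr (n + 1) u).
Proof.
elim: s n u => [|s IH] n u; apply: FQ_eq => i.
  rewrite [LHS]/= [RHS]/=; case e: (i + 1) => [r|r]; last exact: raddf0.
  by rewrite /= prSqE; congr (Sq _ (grpr _ _)); lia.
rewrite coef_amap; apply: etrans (IH (n - i) (coef u i)) _.
by congr (del s (grpr _ _)); lia.
Qed.

Lemma del_homog s n (u : FQn s M) : homog n u -> homog (n - 1) (del s u).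
Proof. by rewrite /homog del_pr subrK => ->. Qed.

Lemma del_Qrelk k s (u : FQn s M) : Qrelk k u -> Qrelk (k + 1) (del s u).
Proof.
elim=> {s u} [s|s u v _ hu _ hv|s i m z hz im|s a b z|s i u _ hu].
- rewrite raddf0; exact: Qrelk_zero.
- rewrite raddfD; exact: Qrelk_add.
- rewrite del_Q; apply: (Qrelk_unstable (del_homog hz)); lia.
- rewrite raddfB raddf_sum !del_Q.
  under eq_bigr do rewrite raddfMn !del_Q.
  exact: Qrelk_Adem.
- rewrite del_Q; exact: Qrelk_Q.
Qed.

Lemma del_Q0 k s (u : FQn s M) : del s.+1 (Q0 k s u) = Q0 (k + 1) s.+1 (del s u).
Proof.
apply: FQ_eq => i; rewrite coef_amap !coefQ0 del_pr; congr (del s (grpr _ _)); lia.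
Qed.

Lemma Sq_bound (x : M) : exists N, forall i j : nat, (N <= i)%N || (N <= j)%N -> Sq j (Sq i x) = 0.
Proof.
have [N1 h1] := lf_Sq_eq0 x.
have [N2 h2] : exists N2, forall i j : nat, (i < N1)%N -> (N2 <= j)%N -> Sq j (Sq i x) = 0.
  elim: (N1) => [|m [N2 h2]]; first by exists 0%N.
  have [N3 h3] := lf_Sq_eq0 (Sq m x); exists (maxn N2 N3) => i j.
  rewrite ltnS leq_eqVlt geq_max => /orP[/eqP->|hi] /andP[j2 j3]; first exact: h3.
  exact: h2.
exists (N1 + N2)%N => i j; case: (leqP N1 i) => hi; first by rewrite h1 ?raddf0.
by case/orP => h; [lia|apply: h2; lia].
Qed.

(* The matrices that rewrite the products of two Sq^i, resp. of two Q^i, in terms of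
   admissible ones are transposes of each other, so that everything cancels. *)
Lemma koszul k (x : M) (D : nat) (s : seq int) : uniq s ->
  (forall j, 0 <= j <= D%:Z -> j \in s) ->
  Qrelk k (\sum_(j <- s) Qop _ (D%:Z - j - 1) (Qop _ (j - 1) (SqZ j (SqZ (D%:Z - j) x))) : FQn 2 M).
Proof.
move=> us hs; pose f j := SqZ j (SqZ (D%:Z - j) x).
pose E (b : int) (z : M) : FQn 2 M := Qop _ (D%:Z - b - 1) (Qop _ (b - 1) z).
have E0 b : E b 0 = 0 by rewrite /E !raddf0.
have Esum b (I : Type) (r : seq I) (F : I -> M) : E b (\sum_(i <- r) F i) = \sum_(i <- r) E b (F i).
  by rewrite /E !raddf_sum.
have Esc b c z : E b (sc c z) = sc c (E b z) by rewrite /E !sc_raddf.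
have f0 j : j \notin s -> f j = 0.
  move=> hj; rewrite /f; case: (ltP j 0) => j0; first exact: SqZ_neg.
  rewrite (@SqZ_neg M (D%:Z - j)) ?SqZ0 //.
  by rewrite ltNge; apply: contraNN hj => hj; apply: hs; lia.
pose c (b j : int) := binF (b - 1 - j) (D%:Z - b - 2 * j).
have cadm b j : D%:Z < 3 * b -> c b j != 0 -> 3 * j <= D%:Z.
  move=> hb; apply: contraR => hj; rewrite /c binF_neg //; lia.
(* The transposition: by C(m, k) = C(m, m - k), the coefficient of Sq^(D - j) Sq^j in Sq^(D - b)
   Sq^b is that of Q^(D - b - 1) Q^(b - 1) in the Adem relation for Q^(D - j - 1) Q^(j - 1). *)
have csym b j : j < b /\ c b j = binF (b - 1 - j) (2 * b - 1 - D%:Z + j) \/ b <= j.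
  case: (leP b j) => h; [by right|left; split=> //].
  have [m em] : exists m : nat, b - 1 - j = m by exists (absz (b - 1 - j)%R); lia.
  by rewrite /c em -[LHS](binF_sym m); congr binF; lia.
(* Expanding the inadmissible products, those with D < 3 b, collects at each admissible j one Adem
   relation among the Q^i applied to [f j]. *)
have -> : \sum_(j <- s) Qop _ (D%:Z - j - 1) (Qop _ (j - 1) (f j)) =
    \sum_(j <- s | 3 * j <= D%:Z) (E j (f j) + \sum_(b <- s | D%:Z < 3 * b) sc (c b j) (E b (f j)))
    :> FQn 2 M.
  rewrite (bigID (fun j => 3 * j <= D%:Z)) /= big_split /=; congr (_ + _).
  rewrite exchange_big /=.
  rewrite (eq_bigl (fun b => D%:Z < 3 * b)); last by move=> b; rewrite ltNge.
  apply: eq_bigr => b hb.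
  have -> : f b = \sum_(j <- s) sc (c b j) (f j).
    have [s' [us' hs' E']] := @steenrod_reduced M (lf_steenrod M) x D b hb.
    move/eqP: E'; rewrite subr_eq0 -/(f b) => /eqP ->.
    apply: big_uniq_supp => // j.
    case: (eqVneq (binF (b - 1 - j) (D%:Z - b - 2 * j)) 0) => [->|cj]; first by rewrite sc0 eqxx.
    move=> fj; rewrite hs' //=.
    by apply: contraR fj => fj; rewrite -/(f j) f0 ?scr0 ?eqxx.
  rewrite [LHS](_ : _ = E b (\sum_(j <- s) sc (c b j) (f j))) // Esum
      (bigID (fun j => 3 * j <= D%:Z)) /= [X in _ + X]big1 ?addr0.
    by apply: eq_bigr => j _; rewrite Esc.
  move=> j hj; rewrite Esc; case: (eqVneq (c b j) 0) => [->|/(cadm b j hb)]; first exact: sc0.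
  by rewrite (negPf hj).
apply: Qrelk_sum => j hj; case: (boolP (j \in s)) => js; last first.
  rewrite f0 // E0 add0r big1; first exact: Qrelk_zero.
  by move=> b _; rewrite E0 scr0.
have := @Qrelk_AdemF M k 0 (D%:Z - j - 1) (j - 1) (f j).
rewrite (opp2 (@addxx (FQn 2 M))) -/(E j (f j)); congr Qrelk; congr (_ + _).
pose F (b : int) := sc (binF (b - 1 - j) (2 * b - 1 - D%:Z + j)) (E b (f j)).
transitivity (\sum_(b <- [seq i + 1 | i <- window (absz (D%:Z - j - 1)%R + absz (j - 1)%R).+1]) F b).
  rewrite [RHS]big_map; apply: eq_bigr => i _.
  rewrite /F /E; congr (sc (binF _ _) (Qop _ _ (Qop _ _ _))); lia.
transitivity (\sum_(b <- s) F b); last first.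
  rewrite [RHS]big_mkcond /=; apply: eq_bigr => b _; rewrite /F.
  case: (csym b j) => [[jb <-]|h].
    case: ifP => // /negbT; rewrite -leNgt /c => hb.
    case: (ltP (D%:Z - b - 2 * j) 0) => h; first by rewrite binF_neg ?sc0.
    case: (ltP (b - 1 - j) (D%:Z - b - 2 * j)) => h'; last by lia.
    have [m em] : exists m : nat, b - 1 - j = m by exists (absz (b - 1 - j)%R); lia.
    have [r er] : exists r : nat, D%:Z - b - 2 * j = r by exists (absz (D%:Z - b - 2 * j)%R); lia.
    by rewrite em er binF_small ?sc0 //; lia.
  rewrite binF_neg ?sc0; last by lia.
  by case: ifP => // hb; exfalso; lia.
apply: big_uniq_supp => //; first by rewrite map_inj_uniq ?window_uniq // => u v; lia.
move=> b; rewrite /F.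
case: (eqVneq (binF (b - 1 - j) (2 * b - 1 - D%:Z + j)) 0) => [->|/eqP cb]; first by rewrite sc0 eqxx.
move=> Eb; apply/andP; split.
  apply/mapP; exists (b - 1); last by lia.
  apply: contraT => /Adem_window e; case: cb; rewrite /binF.
  have -> : b - 1 - j = b - 1 - (j - 1) - 1 by lia.
  have -> : 2 * b - 1 - D%:Z + j = 2 * (b - 1) - (D%:Z - j - 1) by lia.
  by rewrite e.
have j0 : 0 <= j.
  rewrite leNgt; apply: contraNN Eb => j0; by rewrite /f SqZ_neg // E0 scr0.
apply: hs; have h1 : 0 <= 2 * b - 1 - D%:Z + j.
  by rewrite leNgt; apply/negP => h; case: cb; rewrite binF_neg.
case: (csym b j) => [[_ ec]|]; last by lia.
have h2 : 0 <= D%:Z - b - 2 * j.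
  by rewrite leNgt; apply/negP => h; case: cb; rewrite -ec /c binF_neg.
by lia.
Qed.

Lemma del_del k s (u : FQn s M) : Qrelk k (del s.+1 (del s u)).
Proof.
elim: s u => [|s IH] u; last first.
  have [N ->] := FQ_gen u; rewrite !raddf_sum; apply: Qrelk_sum => n _.
  by rewrite !del_Q; apply: Qrelk_Q.
have [N hN] := Sq_bound u.
pose F (i j : nat) : FQn 2 M := Qop _ (i%:Z - 1) (Qop _ (j%:Z - 1) (Sq j (Sq i u))).
(* Nonzero terms have i, j < N, so restricting to i + j < 2 N loses nothing and allows a splitting
   by D = i + j. *)
have -> : del 1 (del 0 u) = \sum_(j < N + N) \sum_(i < N + N - j) F i j.
  transitivity (\sum_(j < N + N) \sum_(i < N + N) F i j); last first.
    apply: eq_bigr => j _; have hj := ltn_ord j.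
    apply: (@big_ord_bound _ _ _ (fun i => F i j)) => i hi.
    by rewrite /F hN ?raddf0 //; lia.
  apply: FQ_eq => n; apply: FQ_eq => m.
  rewrite Defs.coef_sum.
  have -> : coef (coef (del 1 (del 0 u)) n) m = SqZ (m + 1) (SqZ (n + 1) u) by [].
  pose c (i j : nat) : M := if (n == i%:Z - 1) && (m == j%:Z - 1) then Sq j (Sq i u) else 0.
  transitivity (\sum_(j < N + N) \sum_(i < N + N) c i j); last first.
    rewrite Defs.coef_sum; apply: eq_bigr => j _.
    rewrite !Defs.coef_sum; apply: eq_bigr => i _; rewrite /F coefQ /c.
    by case: eqP => _ //; rewrite coefQ.
  case en: (n + 1) => [i|i]; last first.
    by rewrite SqZ0 big1 // => j _; rewrite big1 // => i' _; rewrite /c; case: eqP => // e; lia.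
  case em: (m + 1) => [j|j]; last first.
    by rewrite big1 // => j' _; rewrite big1 // => i' _; rewrite /c andbC; case: eqP => // e; lia.
  rewrite /=; case: (boolP ((N <= i)%N || (N <= j)%N)) => h.
    rewrite hN // big1 // => j' _; rewrite big1 // => i' _; rewrite /c.
    case: eqP => //= e1; case: eqP => //= e2; apply: hN.
    have e3 : (i' : nat) = i by lia.
    have e4 : (j' : nat) = j by lia.
    by rewrite e3 e4.
  have hi : (i < N + N)%N by lia.
  have hj : (j < N + N)%N by lia.
  rewrite (bigD1 (Ordinal hj)) //= (bigD1 (Ordinal hi)) //= big1 => [|i' /eqP ii]; last first.
    by rewrite /c; case: eqP => //= e; case: ii; apply: val_inj => /=; lia.
  rewrite big1 => [|j' /eqP jj]; last first.
    by rewrite big1 // => i' _; rewrite /c andbC; case: eqP => //= e; case: jj; apply: val_inj => /=; lia.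
  by rewrite /c !addr0; case: eqP => [_|]; [case: eqP => //|]; lia.
rewrite -big_diag; apply: Qrelk_sum => D _.
have := @koszul k u D [seq j%:Z | j <- iota 0 D.+1].
rewrite big_map -[iota _ _]/(index_iota 0 D.+1) big_mkord.
have -> : \sum_(j < D.+1) Qop _ (D%:Z - j%:Z - 1) (Qop _ (j%:Z - 1) (SqZ j (SqZ (D%:Z - j%:Z) u))) =
   \sum_(j < D.+1) F (D - j)%N j :> FQn 2 M.
  apply: eq_bigr => j _; have hj := ltn_ord j.
  by have -> : D%:Z - j%:Z = (D - j)%N by lia.
apply; first by rewrite map_inj_uniq ?iota_uniq // => i j; lia.
by move=> j hj; apply/mapP; exists (absz j); rewrite ?mem_iota; lia.
Qed.

(* The hypothesis says that w is unstable up to a shift by k + 1 (see [unstP]), and for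
   homogeneous w the conclusion follows if w is the image of x under the largest Sq^i
   that can be nonzero on x: see [sq0_surj_homog]. *)
Definition sq0_surj := forall k (w : M), Qrelk (k + 1) (del 0 w) ->
  exists x : M, Qrelk k (del 0 x + Q0 k 0 w).

(* Descending induction on the instability bound at which u becomes a relation: at the
   next bound u is Q_0 w, where w is a cycle because Q_0 is injective, so that Q_0 w is a
   boundary by hypothesis. *)
Lemma acyclic_step s :
  (forall k (w : FQn s M), Qrelk (k + 1) (del s w) ->
     exists x : FQn s M, Qrelk k (del s x + Q0 k s w)) ->
  forall k (u : FQn s.+1 M), Qrelk (k + 1) (del s.+1 u) ->
  exists v : FQn s M, Qrelk k (u + del s v).
Proof.
move=> surj k u hu; have [m hm] := Qrelk_large k u.
elim: m u hu hm => [|m IHm] u hu hm.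
  by exists 0; rewrite raddf0 addr0; rewrite addr0 in hm.
set k' := k + m%:Z; have ek : k' + 1 = k + m.+1%:Z by rewrite /k'; lia.
rewrite -ek in hm; have [w hw] := Qrelk_succ hm.
have dw : Qrelk (k' + 1) (del s w).
  apply: Q0_injective; rewrite -del_Q0.
  have -> : del s.+1 (Q0 k' s w) = del s.+1 u + del s.+1 (u + Q0 k' s w).
    by rewrite raddfD addrA (@addxx (FQn s.+2 M)) add0r.
  apply: Qrelk_add (del_Qrelk hw); apply: Qrelk_mono hu; rewrite /k'; lia.
have [x hx] := surj k' w dw.
have hux : Qrelk k' (u + del s x).
  have := Qrelk_add hw hx; congr Qrelk.
  by rewrite [del s x + _]addrC addrA -[u + _ + _]addrA (@addxx (FQn s.+1 M)) addr0.
have [|v hv] := IHm _ _ hux.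
  by rewrite raddfD; apply: Qrelk_add => //; apply: del_del.
by exists (x + v); rewrite raddfD addrA.
Qed.

(** In positive length the hypothesis of [acyclic_step] comes from exactness one step earlier: if w
    is the boundary of v modulo relations, Q_0 w is that of Q_0 v, by [del_Q0]. *)
Lemma acyclic : sq0_surj -> forall s k (u : FQn s.+1 M), Qrelk (k + 1) (del s.+1 u) ->
  exists v : FQn s M, Qrelk k (u + del s v).
Proof.
move=> surj; elim=> [|s IH]; apply: acyclic_step => // k w /IH [v hv].
exists (Q0 (k - 1) s v); rewrite del_Q0 subrK -raddfD addrC; exact: Qrelk_Q0.
Qed.

End Del.

(** * Cofree modules *)

Lemma sum_window (M : sqspace) (y : M) B : (forall n, (B < `|n|)%N -> grpr n y = 0) ->
  \sum_(n <- window B) grpr n y = y.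
Proof.
move=> h; have [N e] := pr_window y; rewrite {2}e; apply: big_uniq_supp; rewrite ?window_uniq //.
move=> n hn; have nB : n \in window B by apply: contraR hn; rewrite mem_window -ltnNge => /h ->.
rewrite nB /=; apply: contraR hn; rewrite e raddf_sum => hn; rewrite big_seq big1 // => m hm.
by rewrite prpr; case: eqP => // e'; rewrite e' hm in hn.
Qed.

Section Rel1.
Variable M : sqspace.

(** Adem relations start in length 2; the value [True] there lets the induction run through all
    lengths. *)
Lemma Qrelk_low k s (u : FQn s M) : Qrelk k u ->
  match s return FQn s M -> Prop with
  | 0%N => fun u => u = 0
  | 1%N => fun u => forall i n, n + k <= i -> grpr n (coef u i) = 0
  | _ => fun _ => True
  end u.
Proof.
elim=> {s u} [[|[|s]]|[|[|s]] u v _ hu _ hv|[|s] i m z hz im|s a b z|[|s] i u _ hu] //.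
- by move=> i n _; rewrite /= raddf0.
- by rewrite hu hv addr0.
- by move=> i n h; rewrite Defs.coefD raddfD hu // hv // addr0.
- move=> j n h; rewrite coefQ; case: eqP => [e|_]; last exact: raddf0.
  rewrite -hz prpr; case: eqP => // e'; exfalso; lia.
- by move=> j n h; rewrite coefQ hu if_same raddf0.
Qed.

Lemma Qrelk1P k (u : FQ M) :
  @Qrelk M k 1 u <-> forall i n, n + k <= i -> grpr n (coef u i) = 0.
Proof.
split=> [/Qrelk_low //|h].
have [N ->] := @FQ_gen M u; apply: Qrelk_sum => i _.
have [N' ->] := @Qop_window M 0 i (coef u i); apply: Qrelk_sum => n _.
case: (leP (n + k) i) => hi; first by rewrite h // raddf0; apply: Qrelk_zero.
exact: (@Qrelk_unstable M k 0 i n _ (homog_pr n _)).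
Qed.
End Rel1.

Section Unst.
Variable M : lfAmod.

Definition unst (k : int) (w : M) := forall (r : nat) p, p + k < 2 * r%:Z -> Sq r (grpr p w) = 0.

(** For x of degree p, Q^(r - 1) (x Sq^r) is unstable for the bound k + 1 exactly when r - 1 < p - r
    + k + 1, that is, 2 r <= p + k + 1. *)
Lemma unstP k (w : M) : @Qrelk M (k + 1) 1 (del0 M w) <-> unst (k + 1) w.
Proof.
rewrite Qrelk1P; split=> h.
  move=> r p hp; rewrite -prSq.
  have := h (r%:Z - 1) (p - r%:Z); rewrite coef_del0 subrK /= => -> //; lia.
move=> i n hi; rewrite coef_del0; case e: (i + 1) => [r|r] /=; last by rewrite raddf0.
by rewrite prSqE h //; lia.
Qed.

Lemma unst_Sq k (w : M) c : unst k w -> unst k (Sq c w).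
Proof.
move=> h r p hp; rewrite prSqE; set y := grpr _ w.
case: (ltnP c r.*2) => cr; last by rewrite (h c) ?raddf0 //; lia.
have [_ ->//] := lf_steenrod M; rewrite big1 // => j _; have hj := ltn_ord j.
by rewrite (h (c + r - j)%N) ?raddf0 ?mul0rn //; lia.
Qed.

Lemma unst_pr k (w : M) n : unst k w -> unst k (grpr n w).
Proof.
move=> h r p hp; rewrite prpr; case: eqP => e; last by rewrite raddf0.
by apply: h; rewrite -e.
Qed.

Lemma unst_word k (w : M) u : unst k w -> unst k (word_act u w).
Proof. by elim: u w => //= i u IH w h; apply/IH/unst_Sq. Qed.

Lemma unst_neg k (w : M) p : unst k w -> p + k < 0 -> grpr p w = 0.
Proof.
move=> h hp; have [s0 _] := lf_steenrod M.
by rewrite -[LHS]s0; apply: h; lia.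
Qed.
End Unst.

Section LfCrit.
Variable M : lfAmod.

Fixpoint words (C m : nat) : seq (seq nat) :=
  if m is m'.+1 then [::] :: [seq i :: w | i <- iota 1 C, w <- words C m'] else [:: [::]].

Lemma words_mem C m w : (size w <= m)%N -> all (fun i => 0 < i <= C)%N w -> w \in words C m.
Proof.
elim: m w => [|m IH] [|i w] //=; rewrite ltnS inE => hs /andP[/andP[i1 i2] hw].
apply/allpairs_f; last exact: IH.
by rewrite mem_iota; lia.
Qed.

Lemma words_sum C w : (sumn w <= C)%N -> all (fun i => 0 < i)%N w -> w \in words C C.
Proof.
move=> hs hw; apply: words_mem.
  by elim: w C hs hw => //= i w IH C hs /andP[i0 hw]; have := IH (C - i)%N; lia.
apply/allP => i hi; rewrite (allP hw i hi) /=.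
by apply: leq_trans hs; elim: w hi {hw} => //= j w IH; rewrite inE => /orP[/eqP->|/IH]; lia.
Qed.

Lemma coind_word_act (f : coinduced M) u w :
  (word_act u f : coind_car M) w = (f : coind_car M) (u ++ w).
Proof. by elim: u f => //= i u IH f; rewrite IH. Qed.

(** Words with positive letters and sum at most C are finite in number, and the orbit of f lies in
    the F_2-span of their actions on f. *)
Lemma lf_elt_of_bound (f : coinduced M) (C : nat) :
  (forall u, (C < sumn u)%N -> (f : coind_car M) u = 0) -> lf_elt f.
Proof.
move=> hC.
pose S (ws : seq (seq nat)) : set (coinduced M) :=
  [set y | exists c : seq nat -> 'F_2, y = \sum_(u <- ws) sc (c u) (word_act u f)]%classic.
have finS ws : finite_set (S ws).
  elim: ws => [|u ws IH].
    apply: (sub_finite_set _ (finite_set1 (0 : coinduced M))) => y [c ->].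
    by rewrite big_nil.
  have fin2 : finite_set [set y : coinduced M | y = 0 \/ y = word_act u f]%classic.
    apply: (sub_finite_set _ (finite_set2 (0 : coinduced M) (word_act u f))).
    by move=> y /= [->|->]; [left|right].
  apply: sub_finite_set (finite_image2 (fun a b => a + b) fin2 IH).
  move=> y [c ->]; rewrite big_cons; exists (sc (c u) (word_act u f)).
    by rewrite /sc /=; case: ifP; [left|right].
  by exists (\sum_(v <- ws) sc (c v) (word_act v f)); first by exists c.
pose W := undup (words C C).
apply: (sub_finite_set _ (finS W)) => y.
have inS u : S W (word_act u f).
  pose v := [seq i <- u | (0 < i)%N].
  have ev : word_act u f = word_act v f.
    have dz (t : seq nat) (g : coinduced M) : word_act t g = word_act [seq i <- t | (0 < i)%N] g.
      elim: t g => [|[|i] t IH] g //; last exact: IH.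
      have [s0 _] := coinduced_steenrod M.
      by rewrite (_ : word_act (0%N :: t) g = word_act t (Sq 0 g)) // s0; exact: IH.
    exact: dz.
  case: (leqP (sumn v) C) => hv.
    exists (fun w => (w == v)%:R); rewrite ev.
    have vW : v \in W by rewrite mem_undup words_sum // filter_all.
    rewrite (bigD1_seq v) ?undup_uniq //= eqxx sc1 big1 ?addr0 // => w /negPf ->.
    exact: sc0.
  exists (fun _ => 0); rewrite big1 => [|w _]; last exact: sc0.
  apply: coind_eq => w; rewrite ev coind_word_act hC //.
  by rewrite sumn_cat; apply: leq_trans hv _; apply: leq_addr.
have S0 : S W 0 by exists (fun _ => 0); rewrite big1 // => w _; exact: sc0.
have SD a b : S W a -> S W b -> S W (a + b).
  move=> [c ->] [c' ->]; exists (fun u => c u + c' u); rewrite -big_split.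
  by apply: eq_bigr => u _; rewrite (scD (@addxx (coinduced M))).
elim=> [||a b _ ha _ hb|i a _ [c ->]] //.
- exact: (inS [::]).
- exact: SD.
- rewrite raddf_sum; apply: big_ind => // u _; rewrite sc_raddf.
  case: (F2P (c u)) => ->; first by rewrite sc0.
  by rewrite sc1; have := inS (rcons u i); rewrite /word_act foldl_rcons.
Qed.
End LfCrit.

Section CofreeSurj.
Variable M : lfAmod.

(** The values of w on all words are evaluations at the empty word of elements of its finite
    orbit. *)
Lemma cofree_val_bounded (w : cofree M) : exists B, forall u n, (B < `|n|)%N ->
  grpr n ((val w : coind_car M) u) = 0.
Proof.
have /finite_seqP [t et] := @lf_fin (cofree M) w.
have [B hB] : exists B : nat, forall y, y \in t ->
    forall n : int, (B < `|n|)%N -> grpr n (cofree_ev M y) = 0.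
  elim: (t) => [|m r [B hB]]; first by exists 0%N.
  have [B' hB'] := pr_bnd (cofree_ev M m); exists (maxn B B') => k.
  rewrite in_cons => /orP[/eqP->|kw] n hn; first by apply: hB'; lia.
  by apply: hB => //; lia.
exists B => u n hn; rewrite -cofree_ev_act; apply: hB hn.
have : [set z | cyclic w z]%classic (word_act u w).
  elim/last_ind: u => [|u i IH]; first exact: orbit_gen.
  by rewrite /word_act foldl_rcons; apply: orbit_Sq.
by rewrite et.
Qed.

Lemma val_homog (w : cofree M) p u n : homog p w -> n != p - wdeg u ->
  grpr n ((val w : coind_car M) u) = 0.
Proof.
move=> hw hn; rewrite -hw.
have -> : (val (grpr p w) : coind_car M) u = grpr (p - wdeg u) ((val w : coind_car M) u) by [].
by rewrite prpr (negPf hn).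
Qed.

(** For each n, the degree n part of the values of w is an unstable functional with e = n + k + 1
    and d = p - n. Its lift lives on words of degree 2 p + k + 1 - n and restricts to it after the
    letter p + k + 1. *)
Lemma sq0_surj_homog k (w : cofree M) p : homog p w -> unst (k + 1) w ->
  exists x : cofree M, [/\ homog (2 * p + k + 1) x,
    forall r : nat, r%:Z = p + k + 1 -> Sq r x = w &
    forall r : nat, p + k + 1 < r%:Z -> Sq r x = 0].
Proof.
move=> hw hu; pose W := (val w : coind_car M).
have [W1 W2 _] := coind_car_P W.
have [B hB] := cofree_val_bounded w.
have wG n : wordfun (n + k + 1) (p - n) (fun u => grpr n (W u)).
  split=> [u v|u v a b ab|u hu'|u j v hj].
  - by rewrite W1.
  - by rewrite W2 // raddf_sum; apply: eq_bigr => j _; rewrite raddfMn.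
  - apply: (val_homog hw); apply: contraNN hu' => /eqP e; apply/eqP; move: e; rewrite /wdeg; lia.
  - case: (eqVneq n (p - wdeg (u ++ j :: v))) => en; last exact: (val_homog hw).
    have -> : W (u ++ j :: v) = cofree_ev M (word_act v (Sq j (word_act u w))).
      by rewrite -cofree_ev_act act_cat.
    have h := unst_word u hu.
    have hm : grpr (p - wdeg u) (word_act u w) = word_act u w by rewrite act_pr hw.
    by rewrite -hm h ?act0 ?raddf0 //; move: en hj; rewrite /wdeg !sumn_cat /=; lia.
have /boolp.choice [H hH] : forall n, exists G : seq nat -> M,
    wordfun (n + k + 1) (2 * (p - n) + (n + k + 1)) G /\
    forall (j : nat) u, j%:Z = (p - n) + (n + k + 1) -> G (j :: u) = grpr n (W u).
  by move=> n; have [G hG top] := wordfun_lift (@addxx M) (wG n); exists G.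
pose q := 2 * p + k + 1.
pose X (u : seq nat) : M := \sum_(n <- window B) grpr n (H n u).
have Xdeg u n : n != q - wdeg u -> grpr n (X u) = 0.
  move=> hn; rewrite raddf_sum big1 // => m _; rewrite prpr; case: eqP => // e.
  have [h _] := hH m; rewrite (wf_deg h) ?raddf0 //.
  by apply: contraNN hn => /eqP e'; apply/eqP; rewrite e /q /wdeg e'; lia.
have cX : coind X.
  split=> [u v|u v a b ab|].
  - by apply: eq_bigr => n _; have [h _] := hH n; rewrite (wf_zero h).
  - rewrite /X; under [RHS]eq_bigr => j _ do rewrite -sumrMnl.
    rewrite exchange_big; apply: eq_bigr => n _; have [h _] := hH n.
    by rewrite (wf_adem h) // raddf_sum; apply: eq_bigr => j _; rewrite raddfMn.
  - exists `|q|%N => m hm u; apply: Xdeg; apply/eqP; lia.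
(* The summand at n vanishes unless u has sum q - n, and |n| <= B. *)
have lX : lf_sub (coinduced M) (coind_mk cX).
  apply: (@lf_elt_of_bound M _ (absz q + B)%N) => u hu'.
  apply: big1_seq => n /= hn; have [h _] := hH n; rewrite (wf_deg h) ?raddf0 //.
  by move: hn; rewrite mem_window => hn; apply/eqP; rewrite /q in hu'; lia.
pose x : cofree M := sub_mk _ _ lX.
exists x; split.
- apply: val_inj; apply: coind_eq => u.
  change (grpr (q - wdeg u) (X u) = X u).
  have [N e] := pr_window (X u); rewrite {2}e.
  case: (boolP (q - wdeg u \in window N)) => hq.
    rewrite (bigD1_seq _ hq (window_uniq N)) /= big1 ?addr0 // => n; exact: Xdeg.
  rewrite {1}e raddf_sum !big_seq !big1 // => n hn; last first.
    by rewrite prpr; case: eqP => // e'; rewrite e' hn in hq.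
  by apply: Xdeg; apply/eqP => e'; rewrite -e' hn in hq.
- move=> r er; apply: val_inj; apply: coind_eq => u.
  change (X (r :: u) = W u).
  rewrite -[RHS](@sum_window M _ B) => [|n hn]; last exact: hB.
  apply: eq_bigr => n _; have [_ top] := hH n.
  by rewrite top ?prpr ?eqxx //; lia.
- move=> r hr; apply: val_inj; apply: coind_eq => u.
  change (X (r :: u) = 0); apply: big1 => n _; have [h _] := hH n.
  by rewrite (wf_inst h (u := [::])) ?raddf0 //=; lia.
Qed.

Lemma cofree_sq0_surj : sq0_surj (cofree M).
Proof.
move=> k w /unstP hw.
have [N ->] := pr_window w; elim: (window N) => [|p r [x hx]].
  by exists 0; rewrite big_nil !raddf0 addr0; apply: Qrelk_zero.
have hp := homog_pr p w.
have [y [hy y1 y2]] := sq0_surj_homog hp (unst_pr p hw).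
exists (y + x); rewrite big_cons [del _ _ _]raddfD [Q0 k 0 _]raddfD addrACA; apply: Qrelk_add hx.
rewrite (@Q0_homog _ k 0 p) //; apply/Qrelk1P => i n hi.
rewrite Defs.coefD coef_del0 coefQ raddfD.
case: (eqVneq i (p + k)) => [->|ni].
  case e: (p + k + 1) => [r'|r'].
    by rewrite [SqZ _ _]y1 // -raddfD addxx raddf0.
  (* For p + k + 1 < 0 there is no bottom operation, but then instability of Sq^0 makes this
     component of w vanish. *)
  by rewrite (unst_neg hw) ?[SqZ _ _]/= ?raddf0 ?addr0 //; lia.
rewrite [X in _ + X]raddf0 addr0; case e: (i + 1) => [r'|r']; last first.
  by rewrite SqZ_neg // raddf0.
rewrite (_ : SqZ r' y = Sq r' y) // prSqE -hy prpr; case: eqP => e'; last by rewrite raddf0.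
by rewrite hy y2 //; lia.
Qed.

Lemma cofree_acyclic s k (u : FQn s.+1 (cofree M)) : Qrelk (k + 1) (del (cofree M) s.+1 u) ->
  exists v : FQn s (cofree M), Qrelk k (u + del (cofree M) s v).
Proof. exact: acyclic cofree_sq0_surj _ _ _. Qed.

End CofreeSurj.

(** * The complex R_* *)

Section Regrade.
Variables (k : int) (M : sqspace).

Definition reg0 : {additive susp k M -> M} :=
  @additive_of (susp k M) M (fun x => x) (fun _ _ => erefl).
Definition unreg0 : {additive M -> susp k M} :=
  @additive_of M (susp k M) (fun x => x) (fun _ _ => erefl).

(** The identity on coefficients, between types that differ only in their grading; the suspension
    becomes the shift k in the unstable relation. *)
Fixpoint reg s : {additive FQn s (susp k M) -> FQn s M} :=
  if s is s'.+1 then amap (reg s') else reg0.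
Fixpoint unreg s : {additive FQn s M -> FQn s (susp k M)} :=
  if s is s'.+1 then amap (unreg s') else unreg0.

Lemma regK s : cancel (reg s) (unreg s).
Proof. by elim: s => [|s IH] u //; apply: FQ_eq => n; rewrite !coef_amap IH. Qed.
Lemma unregK s : cancel (unreg s) (reg s).
Proof. by elim: s => [|s IH] u //; apply: FQ_eq => n; rewrite !coef_amap IH. Qed.

Lemma reg_Q s i z : reg s.+1 (Qop _ i z) = Qop _ i (reg s z).
Proof. exact: amap_Q. Qed.
Lemma unreg_Q s i z : unreg s.+1 (Qop _ i z) = Qop _ i (unreg s z).
Proof. exact: amap_Q. Qed.

Lemma reg_pr s n u : reg s (grpr n u) = grpr (n - k) (reg s u).
Proof.
elim: s n u => [|s IH] n u //; apply: FQ_eq => i.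
rewrite coef_amap; apply: etrans (IH _ _) _.
by congr (grpr _ (reg s _)); lia.
Qed.

Lemma unreg_homog s n z : homog n z -> homog (n + k) (unreg s z).
Proof.
by move=> h; apply: (can_inj (@regK s)); rewrite reg_pr addrK !unregK.
Qed.

Lemma reg_Qrel s (u : FQn s (susp k M)) : Qrel u <-> Qrelk k (reg s u).
Proof.
split.
  elim=> {s u} [s|s u v _ hu _ hv|s i m z hz im|s a b z|s i u _ hu].
  - rewrite raddf0; exact: Qrelk_zero.
  - rewrite raddfD; exact: Qrelk_add.
  - rewrite reg_Q; apply: (@Qrelk_unstable _ _ _ _ (m - k)); last by lia.
    by rewrite /homog -reg_pr hz.
  - rewrite raddfB raddf_sum !reg_Q.
    under eq_bigr do rewrite raddfMn !reg_Q.
    exact: Qrelk_Adem.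
  - rewrite reg_Q; exact: Qrelk_Q.
move=> h; rewrite -(regK u); elim: h => {s u} [s|s u v _ hu _ hv|s i m z hz im|s a b z|s i u _ hu].
- rewrite raddf0; exact: Qrel_zero.
- rewrite raddfD; exact: Qrel_add.
- by rewrite unreg_Q; apply: Qrel_unstable (unreg_homog hz) im.
- rewrite raddfB raddf_sum !unreg_Q.
  under eq_bigr do rewrite raddfMn !unreg_Q.
  exact: Qrel_Adem.
- rewrite unreg_Q; exact: Qrel_Q.
Qed.

End Regrade.

Lemma reg_dFQ (M : lfAmod) k k' (kk : k' = k + 1) s u :
  reg k' M s.+1 (dFQ M kk s u) = del M s (reg k M s u).
Proof.
elim: s u => [|s IH] u; apply: FQ_eq => n //.
exact: (IH (coef u n)).
Qed.

Lemma dFQ_dFQ (M : lfAmod) k k' k'' (kk : k' = k + 1) (kk' : k'' = k' + 1) s u :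
  Qrel (dFQ M kk' s.+1 (dFQ M kk s u)).
Proof. by apply/reg_Qrel; rewrite !reg_dFQ; apply: del_del. Qed.

(** For s = 0 the component at Q^n is the Adem formula for u Sq^r Sq^(n+1) with arbitrary r and n,
    admissible or not, which is [steenrod_ext]. *)
Lemma dFQ_Sq (M : lfAmod) k k' (kk : k' = k + 1) s r u :
  dFQ M kk s (Sq r u) = Sq r (dFQ M kk s u).
Proof.
elim: s r u => [|s IH] r u; apply: FQ_eq => n; last first.
  rewrite /= raddf_sum; apply: eq_bigr => j _; rewrite raddfMn; congr (_ *+ _).
  exact: IH.
rewrite FQ_SqE.
have E (y : M) i : coef (dFQ M kk 0 y) i = SqZ (i + 1) y by [].
apply: etrans (E _ _) _.
pose t : seq int := [seq j%:Z | j <- iota 0 r.+1].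
have ut : uniq t by rewrite map_inj_uniq ?iota_uniq // => i j; lia.
have ht j : 0 <= j -> binF (n + 1 - 1 - j) (r%:Z - 2 * j) != 0 -> j \in t.
  move=> j0 hj.
  have h : 0 <= r%:Z - 2 * j by rewrite leNgt; apply: contraNN hj => ?; rewrite binF_neg.
  by apply/mapP; exists (absz j); rewrite ?mem_iota; lia.
apply: etrans (@steenrod_ext M (lf_steenrod M) u r (n + 1) t ut ht) _.
rewrite big_map -[iota _ _]/(index_iota 0 r.+1) big_mkord; apply: eq_bigr => j _.
rewrite E addrK /=; congr (sc _ (Sq j (SqZ _ u))); lia.
Qed.

Lemma FQn_hom_id (M : sqspace) s (f : sqhom M M) (h : forall x, f x = x) (u : FQn s M) :
  FQn_hom s f u = u.
Proof. by elim: s u => [|s IH] u //=; apply: FQ_eq => n; apply: IH. Qed.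

Lemma FQn_hom_comp (L M N : sqspace) s (f : sqhom L M) (g : sqhom M N) (u : FQn s L) :
  FQn_hom s g (FQn_hom s f u) = FQn_hom s (hom_comp g f) u.
Proof. by elim: s u => [|s IH] u //=; apply: FQ_eq => n; apply: IH. Qed.

Lemma injective_acyclic (J : lfAmod) (hJ : injective_object J) k k' k''
    (kk : k' = k + 1) (kk' : k'' = k' + 1) s (u : FQn s.+1 (susp k' J)) :
  Qrel (dFQ J kk' s.+1 u) -> exists v : FQn s (susp k J), Qrel (u - dFQ J kk s v).
Proof.
have [r hr] := hJ J (cofree J) (cofree_emb J) (@SqHom J J (gidh J) (fun _ _ => erefl))
  (@cofree_emb_inj J).
move=> hu.
have [v hv] : exists v : FQn s (susp k (cofree J)),
    Qrel (FQn_hom s.+1 (lfsusp_hom k' (cofree_emb J)) u - dFQ (cofree J) kk s v).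
  have := @cofree_acyclic J s k' (reg _ _ _ (FQn_hom s.+1 (lfsusp_hom k' (cofree_emb J)) u)).
  case=> [|v hv].
    rewrite -(@reg_dFQ _ _ _ kk') -kk'; apply/reg_Qrel; rewrite -dFQ_nat.
    exact: FQn_hom_Qrel.
  exists (unreg k _ s v); apply/reg_Qrel; rewrite raddfB reg_dFQ unregK.
  by rewrite (opp2 (@addxx _)).
exists (FQn_hom s (lfsusp_hom k r) v).
have := FQn_hom_Qrel (lfsusp_hom k' r) hv; rewrite raddfB FQn_hom_comp -(dFQ_nat r kk).
by rewrite FQn_hom_id.
Qed.

(** * Local finiteness of the quotients *)

Section LocallyFinite.
Variables (st : Nishida_stable) (M : lfAmod) (s : nat).

Lemma qQ0 i (u : FQn s M) : Qrel_submod st s M u ->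
  (qclass (Qrel_submod st s.+1 M) \o Qop (FQn s M) i) u = 0.
Proof. by move=> h; apply/cls_eq0; apply: Qrel_Q. Qed.

Definition qQ i : {additive calR st s M -> calR st s.+1 M} := additive_of (quo_lift_add (qQ0 i)).

Lemma qQE i u : qQ i (qclass (Qrel_submod st s M) u) = qclass (Qrel_submod st s.+1 M) (Qop _ i u).
Proof. exact: (quo_liftE (qQ0 i)). Qed.

Lemma qQ_Sq r n (t : calR st s M) : Sq r (qQ n t) =
  \sum_(j < r.+1) sc (binF (n - r%:Z) (r%:Z - 2 * j%:Z)) (qQ (n - r%:Z + j%:Z) (Sq j t)).
Proof.
have [u <-] := cls_surj t; rewrite qQE.
apply: etrans (quo_SqE _ _ _) _; rewrite Sq_QopF raddf_sum; apply: eq_bigr => j _.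
rewrite sc_raddf; congr sc; apply: etrans (esym (qQE _ _)) _; congr (qQ _ _); exact: esym (quo_SqE _ _ _).
Qed.

Lemma qQ_low n B (t : calR st s M) : (forall m, (B < `|m|)%N -> grpr m t = 0) ->
  n < - B%:Z -> qQ n t = 0.
Proof.
move=> h hn; rewrite -(sum_window h) raddf_sum big_seq big1 // => m.
rewrite mem_window => hm; have [u <-] := cls_surj t.
rewrite [grpr m _]quo_prE qQE; apply/cls_eq0; apply: (Qrel_unstable (homog_pr m u)); lia.
Qed.

(** The orbit consists of sums of Q^m y with y in the orbit of t and |m| <= B: the Nishida relations
    never raise m, and for m < - B the unstable relation kills Q^m y. *)
Lemma qQ_lf i (t : calR st s M) : lf_elt t -> lf_elt (qQ i t).
Proof.
move=> ht; have /finite_seqP [T eT] := (ht : finite_set _).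
have inT y : cyclic t y -> y \in T.
  by move=> h; have : [set z | cyclic t z]%classic y by []; rewrite eT.
have [B0 hB0] : exists B : nat, forall y, y \in T ->
    forall n : int, (B < `|n|)%N -> grpr n y = 0.
  elim: (T) => [|m w [B hB]]; first by exists 0%N.
  have [B' hB'] := pr_bnd m; exists (maxn B B') => k.
  rewrite in_cons => /orP[/eqP->|kw] n hn; first by apply: hB'; lia.
  by apply: hB => //; lia.
pose B := (B0 + `|i|)%N.
pose S (w : seq int) : set (calR st s.+1 M) := [set z | exists2 g : int -> calR st s M,
  (forall m, cyclic t (g m)) & z = \sum_(m <- w) qQ m (g m)]%classic.
have finS w : finite_set (S w).
  elim: w => [|m w IH].
    apply: (sub_finite_set _ (finite_set1 (0 : calR st s.+1 M))) => z /= [g _ ->].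
    by rewrite big_nil.
  apply: sub_finite_set (finite_image2 (fun a b => qQ m a + b) ht IH).
  move=> z /= [g hg ->]; rewrite big_cons; exists (g m); first exact: hg.
  by exists (\sum_(j <- w) qQ j (g j)); [exists g|].
apply: (sub_finite_set _ (finS (window B))) => z /=.
have S0 : S (window B) 0.
  exists (fun _ => 0); first by move=> _; apply: orbit_zero.
  by rewrite big1 // => m _; rewrite raddf0.
have SD a b : S (window B) a -> S (window B) b -> S (window B) (a + b).
  move=> [g hg ->] [g' hg' ->]; exists (fun m => g m + g' m); first by move=> m; apply: orbit_add.
  by rewrite -big_split; apply: eq_bigr => m _; rewrite raddfD.
have S1 m y : m <= B%:Z -> cyclic t y -> S (window B) (qQ m y).
  move=> hm hy; case: (boolP (m \in window B)) => mB; last first.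
    rewrite (@qQ_low m B0) //; first exact: hB0 (inT _ hy).
    by move: mB; rewrite mem_window; rewrite /B in hm *; lia.
  exists (fun n => if n == m then y else 0).
    by move=> n; case: eqP => _; [|apply: orbit_zero].
  rewrite (bigD1_seq m mB (window_uniq B)) eqxx big1 => [|n /negPf ->]; first exact: (esym (addr0 _)).
  exact: raddf0.
elim=> [||a b _ ha _ hb|r a _ [g hg ->]] //.
- by apply: S1; [rewrite /B; lia|apply: orbit_gen].
- exact: SD.
- rewrite raddf_sum big_seq; apply: big_ind => // m hm; rewrite qQ_Sq.
  apply: big_ind => // j _; case: (leqP (2 * j) r) => hj; last by rewrite binF_neg ?sc0 //; lia.
  rewrite /sc; case: eqP => // _; apply: S1; last exact/orbit_Sq/hg.
  by move: hm; rewrite mem_window; lia.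
Qed.

End LocallyFinite.

Lemma calR_lf (st : Nishida_stable) s (M : lfAmod) : locally_finite (calR st s M).
Proof.
elim: s => [|s IH]; first exact: (@quo_lf M _ (@lf_fin M)).
move=> x; have [u <-] := cls_surj x; have [N ->] := FQ_gen u.
rewrite raddf_sum; apply: (@big_ind _ (@lf_elt (calR st s.+1 M))).
- exact: lf_elt0.
- exact: lf_eltD.
- by move=> i _; have := @qQ_lf st M s i (qclass _ (coef u i)) (IH _); rewrite qQE.
Qed.

Lemma R_complex_holds : R_is_complex.
Proof.
exists Nishida_stable_holds.
- move=> s M; apply: susp_steenrod; apply: quo_steenrod; apply: FQn_steenrod.
  exact: lf_steenrod (lfsusp _ M).
- by move=> s M; apply: susp_lf; apply: calR_lf.
- move=> s M i x; have [u <-] := cls_surj x.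
  rewrite [Sq i _]quo_SqE !dR_cls; apply: etrans (esym (quo_SqE _ _ _)).
  by rewrite dFQ_Sq.
- move=> s M x; have [u <-] := cls_surj x; rewrite !dR_cls.
  by apply/cls_eq0; apply: dFQ_dFQ.
Qed.

(** * Exactness of R_s *)

Section Split.
Variables A B C : sqspace.

Definition ker_submod (f : sqhom A B) : submod A.
Proof.
apply: (@Submod A (fun x => f x = 0)).
- by rewrite raddf0.
- by move=> x y hx hy; rewrite raddfD hx hy addr0.
- by move=> n x hx; rewrite ghom_pr hx raddf0.
- by move=> i x hx; rewrite hom_Sq hx raddf0.
Defined.

Lemma val_add (P : submod A) : zmod_morphism (fun x : subobj P => val x : A).
Proof. by []. Qed.

Lemma val_pr (P : submod A) n x :
  additive_of (@val_add P) (grpr n x) = grpr n (additive_of (@val_add P) x).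
Proof. by []. Qed.

Definition sub_incl (P : submod A) : grhom (subobj P) A := GrHom (@val_pr P).

Lemma graded_retraction (P : submod A) :
  exists r : grhom A (subobj P), forall x : subobj P, r (val x) = x.
Proof.
have [r hr] := @extend _ _ _ (sub_incl P) (gidh (subobj P)) val_inj.
by exists r.
Qed.

Lemma quo_factor (P : submod A) (f : grhom A B) : (forall x, P x -> f x = 0) ->
  exists g : grhom (quoobj P) B, forall x, g (qclass P x) = f x.
Proof.
move=> h; pose F : {additive quoobj P -> B} := additive_of (quo_lift_add h).
have FE x : F (qclass P x) = f x := quo_liftE h x.
have Fpr n (x : quoobj P) : F (grpr n x) = grpr n (F x).
  by have [y <-] := cls_surj x; rewrite FE -ghom_pr -FE; congr (F _); exact: quo_prE.
by exists (GrHom Fpr).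
Qed.

End Split.

(** Only exactness in the middle is assumed. With r a graded projection onto ker g, h inverts f on r
    y inside a complement of ker f, and k extends the map g y |-> y - r y from im g to C. *)
Lemma graded_splitting (A B C : sqspace) (f : sqhom A B) (g : sqhom B C) :
  (forall y, g y = 0 <-> exists x, y = f x) ->
  exists (h : grhom B A) (k : grhom C B), forall y, y = f (h y) + k (g y).
Proof.
move=> ex.
have [r hr] := graded_retraction (ker_submod g).
have [q hq] := graded_retraction (ker_submod f).
have rk y : g (val (r y)) = 0 := sub_carP (r y).
have r_id y : g y = 0 -> val (r y) = y.
  by move=> gy; rewrite -[in LHS](_ : val (sub_mk (ker_submod g) y gy) = y) // hr.
have q_id x : f x = 0 -> val (q x) = x.
  by move=> fx; rewrite -[in LHS](_ : val (sub_mk (ker_submod f) x fx) = x) // hq.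
have fq x : f (val (q x)) = 0 := sub_carP (q x).
have /boolp.choice [h hh] : forall y, exists x, f x = val (r y) /\ q x = 0.
  move=> y; have /ex [x ex'] := rk y; exists (x - val (q x)); split.
    by rewrite raddfB fq subr0.
  by rewrite raddfB hq subrr.
have uniq x x' : f x = f x' -> q x = 0 -> q x' = 0 -> x = x'.
  move=> e e1 e2; apply/eqP; rewrite -subr_eq0; apply/eqP.
  have e0 : f (x - x') = 0 by rewrite raddfB e subrr.
  by rewrite -(q_id _ e0) raddfB e1 e2 subrr.
have hB : zmod_morphism h.
  move=> x y; have [h1 h2] := hh x; have [h3 h4] := hh y; have [h5 h6] := hh (x - y).
  apply: uniq => //; first by rewrite h5 !raddfB h1 h3.
  by rewrite raddfB h2 h4 subrr.
have hpr n x : additive_of hB (grpr n x) = grpr n (additive_of hB x).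
  have [h1 h2] := hh x; have [h5 h6] := hh (grpr n x).
  apply: uniq => //=; first by rewrite h5 (ghom_pr f) h1 (ghom_pr r).
  by rewrite ghom_pr h2 raddf0.
have cB : zmod_morphism (fun y : B => y - val (r y)).
  by move=> x y; rewrite raddfB /= opprD addrACA -opprD.
have cpr n y : additive_of cB (grpr n y) = grpr n (additive_of cB y).
  by rewrite /= ghom_pr raddfB.
have [c hc] := @quo_factor _ _ (ker_submod g) (GrHom cpr)
  (fun y gy => etrans (congr1 (fun z => y - z) (r_id y gy)) (subrr y)).
have [i hi] := @quo_factor _ _ (ker_submod g) g (fun y gy => gy).
have inji : injective i.
  move=> x y; have [x' <-] := cls_surj x; have [y' <-] := cls_surj y; rewrite !hi => e.
  by apply/clsP; rewrite /= raddfB e subrr.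
have [k hk] := extend c inji.
exists (GrHom hpr), k => y; have [h1 _] := hh y.
rewrite (_ : f (GrHom hpr y) = val (r y)) // -hi hk hc.
by rewrite (_ : GrHom cpr y = y - val (r y)) // addrC subrK.
Qed.

(** The maps of a graded splitting do not commute with the Sq^i, but the unstable and Adem relations
    involve only the grading. *)
Fixpoint FQn_gmap s (M N : sqspace) (f : grhom M N) : grhom (FQn s M) (FQn s N) :=
  if s is s'.+1 then FQ_gmap (FQn_gmap s' f) else f.

Lemma FQn_gmapQ (M N : sqspace) (f : grhom M N) s i z :
  FQn_gmap s.+1 f (Qop _ i z) = Qop _ i (FQn_gmap s f z).
Proof. exact: FQ_gmapQ. Qed.

Lemma FQn_gmap_Qrel (M N : sqspace) (f : grhom M N) s (u : FQn s M) :
  Qrel u -> Qrel (FQn_gmap s f u).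
Proof.
elim=> {s u} [s|s u v _ hu _ hv|s i m z hz im|s a b z|s i u _ hu].
- rewrite raddf0; exact: Qrel_zero.
- rewrite raddfD; exact: Qrel_add.
- rewrite FQn_gmapQ; apply: Qrel_unstable im.
  by rewrite /homog -ghom_pr hz.
- rewrite raddfB raddf_sum !FQn_gmapQ.
  under eq_bigr do rewrite raddfMn !FQn_gmapQ.
  exact: Qrel_Adem.
- rewrite FQn_gmapQ; exact: Qrel_Q.
Qed.

Lemma FQn_splitting (A B C : sqspace) (f : sqhom A B) (g : sqhom B C)
    (h : grhom B A) (k : grhom C B) s (u : FQn s B) :
  (forall y, y = f (h y) + k (g y)) ->
  u = FQn_hom s f (FQn_gmap s h u) + FQn_gmap s k (FQn_hom s g u).
Proof.
move=> e; elim: s u => [|s IH] u; first exact: e.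
by apply: FQ_eq => n; rewrite Defs.coefD; apply: IH.
Qed.

Lemma FQn_retraction (A B : sqspace) (f : sqhom A B) (h : grhom B A) s (u : FQn s A) :
  (forall x, h (f x) = x) -> FQn_gmap s h (FQn_hom s f u) = u.
Proof.
by move=> e; elim: s u => [|s IH] u; [exact: e|apply: FQ_eq => n; apply: IH].
Qed.

Lemma FQn_hom0 (A B : sqspace) (f : sqhom A B) s (u : FQn s A) :
  (forall x, f x = 0) -> FQn_hom s f u = 0.
Proof. by move=> e; elim: s u => [|s IH] u; [exact: e|apply: FQ_eq => n; apply: IH]. Qed.

Section RExact.
Variables (st : Nishida_stable) (A B C : lfAmod) (f : sqhom A B) (g : sqhom B C) (s : nat).

Lemma Rmap_inj : injective f -> injective (Rmap st s f).
Proof.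
move=> fi x y; have [u <-] := cls_surj x; have [v <-] := cls_surj y.
rewrite !Rmap_cls => /clsP; rewrite -raddfB => h; apply/clsP.
have [r hr] := @extend _ _ _ f (gidh A) fi.
have := @FQn_gmap_Qrel _ _ (susp_ghom (s%:Z - 1) r) s _ h.
by rewrite FQn_retraction.
Qed.

Lemma Rmap_exact : (forall y, g y = 0 <-> exists x, y = f x) ->
  forall z, Rmap st s g z = 0 <-> exists x, z = Rmap st s f x.
Proof.
move=> ex; have [h [k hk]] := graded_splitting ex.
pose h' := susp_ghom (s%:Z - 1) h; pose k' := susp_ghom (s%:Z - 1) k.
have hk' u := @FQn_splitting _ _ _ (lfsusp_hom (s%:Z - 1) f) (lfsusp_hom (s%:Z - 1) g) h' k' s u hk.
move=> z; split=> [|[x ->]].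
  have [u <-] := cls_surj z; rewrite Rmap_cls => /cls_eq0 hu.
  exists (qclass _ (FQn_gmap s h' u)); rewrite Rmap_cls; apply/clsP.
  by rewrite {1}(hk' u) addrAC subrr add0r; apply: (FQn_gmap_Qrel k' hu).
have [v <-] := cls_surj x; rewrite !Rmap_cls FQn_hom_comp FQn_hom0 ?raddf0 // => w.
by apply/ex; exists w.
Qed.

End RExact.

(** * Double complexes *)

(** Allows the zigzag comparison to be built as a relation, without linear choices of
    representatives. *)
Lemma rel_hom (M N : sqspace) (G : M -> N -> Prop) :
  (forall x, exists y, G x y) -> (forall y, G 0 y -> y = 0) ->
  (forall x y x' y', G x y -> G x' y' -> G (x - x') (y - y')) ->
  (forall n x y, G x y -> G (grpr n x) (grpr n y)) ->
  (forall i x y, G x y -> G (Sq i x) (Sq i y)) ->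
  exists phi : sqhom M N, forall x, G x (phi x).
Proof.
move=> tot fun0 GB Gpr GSq.
have uni x y y' : G x y -> G x y' -> y = y'.
  move=> h h'; apply/eqP; rewrite -subr_eq0; apply/eqP/fun0.
  by rewrite -(subrr x); apply: GB.
have [f hf] := boolp.choice tot.
have fB : zmod_morphism f by move=> x y; apply: (uni (x - y)) => //; apply: GB.
have fpr n x : additive_of fB (grpr n x) = grpr n (additive_of fB x).
  by apply: (uni (grpr n x)); [apply: hf|apply: (Gpr n) (hf x)].
have fSq i x : GrHom fpr (Sq i x) = Sq i (GrHom fpr x).
  by apply: (uni (Sq i x)); [apply: hf|apply: (GSq i) (hf x)].
by exists (SqHom fSq).
Qed.

Lemma inj_surj_bij (S T : Type) (f : S -> T) :
  injective f -> (forall y, exists x, f x = y) -> bijective f.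
Proof.
move=> fi fs; have [g hg] := boolp.choice fs.
by exists g => // x; apply: fi; rewrite hg.
Qed.

(* Exact rows and columns augmented by A and B; the squares commute, which is the
   same as anticommuting in characteristic 2. *)
Record double_complex (A B : complex) := DoubleComplex {
  dcobj :> nat -> nat -> sqspace;
  dcv : forall p q, sqhom (dcobj p q) (dcobj p.+1 q);
  dch : forall p q, sqhom (dcobj p q) (dcobj p q.+1);
  dca : forall p, sqhom (A p) (dcobj p 0);
  dcb : forall q, sqhom (B q) (dcobj 0 q);
  dc_hv : forall p q z, dch p.+1 q (dcv p q z) = dcv p q.+1 (dch p q z);
  dc_av : forall p x, dca p.+1 (cd A p x) = dcv p 0 (dca p x);
  dc_bh : forall q y, dcb q.+1 (cd B q y) = dch 0 q (dcb q y);
  dca_inj : forall p, injective (dca p);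
  dcb_inj : forall q, injective (dcb q);
  dch0 : forall p z, dch p 0 z = 0 <-> exists x, z = dca p x;
  dchS : forall p q z, dch p q.+1 z = 0 <-> exists w, z = dch p q w;
  dcv0 : forall q z, dcv 0 q z = 0 <-> exists y, z = dcb q y;
  dcvS : forall p q z, dcv p.+1 q z = 0 <-> exists w, z = dcv p q w }.

Arguments dcv {A B d p q}.
Arguments dch {A B d p q}.
Arguments dca {A B d p}.
Arguments dcb {A B d q}.

Section Zigzag.
Variables (A B : complex) (D : double_complex A B).

(** The tail-recursive addition makes the index at (q + 1, p) convertible to the one at (q, p + 1),
    so the recursion needs no casts. *)
Fixpoint zig q : forall p, A (NatTrec.add q p) -> D p q -> Prop :=
  match q with
  | 0%N => fun p x z => z = dca x
  | q'.+1 => fun p x z => exists2 c : D p q', @zig q' p.+1 x (dcv c) & z = dch c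
  end.

Lemma zig_sub q p x z x' z' : @zig q p x z -> @zig q p x' z' -> zig (x - x') (z - z').
Proof.
elim: q p x z x' z' => [|q IH] p x z x' z' /=; first by move=> -> ->; rewrite raddfB.
move=> [c hc ->] [c' hc' ->]; exists (c - c'); last by rewrite raddfB.
by rewrite raddfB; apply: IH.
Qed.

Lemma zig_pr q p n x z : @zig q p x z -> zig (grpr n x) (grpr n z).
Proof.
elim: q p x z => [|q IH] p x z /=; first by move=> ->; rewrite ghom_pr.
move=> [c hc ->]; exists (grpr n c); last by rewrite ghom_pr.
by rewrite ghom_pr; apply: IH.
Qed.

Lemma zig_Sq q p i x z : @zig q p x z -> zig (Sq i x) (Sq i z).
Proof.
elim: q p x z => [|q IH] p x z /=; first by move=> ->; rewrite hom_Sq.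
move=> [c hc ->]; exists (Sq i c); last by rewrite hom_Sq.
by rewrite hom_Sq; apply: IH.
Qed.

Lemma zig_h q p x z : @zig q p x z -> dch z = 0.
Proof.
by case: q x z => [|q] x z /=; [move=> ->; apply/dch0; exists x|move=> [c _ ->]; apply/dchS; exists c].
Qed.

Lemma zig_v q p x z : cd A _ x = 0 -> @zig q p x z -> dcv z = 0.
Proof.
case: q x z => [|q] x z /= dx; first by move=> ->; rewrite -dc_av dx raddf0.
by move=> [c /zig_h hc ->]; rewrite -dc_hv.
Qed.

Lemma zig_ex q p x : cd A _ x = 0 -> exists z, @zig q p x z.
Proof.
elim: q p x => [|q IH] p x dx /=; first by exists (dca x).
have [w hw] := IH p.+1 x dx.
have /dcvS [c e] := @zig_v q p.+1 x w dx hw.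
by exists (dch c); exists c; rewrite -?e.
Qed.

Lemma zig_surj q p (z : D p q) : dcv z = 0 -> dch z = 0 ->
  exists2 x, cd A _ x = 0 & @zig q p x z.
Proof.
elim: q p z => [|q IH] p z vz hz.
  have /dch0 [x e] := hz; exists x => //.
  by apply: (@dca_inj _ _ D); rewrite dc_av -e vz raddf0.
have /dchS [c e] := hz.
have [||x dx hx] := IH p.+1 (dcv c); first by apply/dcvS; exists c.
  by rewrite dc_hv -e vz.
by exists x => //; exists c.
Qed.

(** Where the zigzags that start at a boundary end. On the edge p = 0, where nothing maps in by
    [dcv], the boundaries of B take over. *)
Definition null q p : D p q -> Prop :=
  match p with
  | p'.+1 => fun z => exists2 c : D p' q, dch c = 0 & z = dcv c
  | 0%N => match q with
    | 0%N => fun z => z = 0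
    | q'.+1 => fun z => exists y : B q', z = dcb (cd B q' y)
    end
  end.

Lemma zig_boundary q p x z : is_boundary x -> @zig q p x z -> null z.
Proof.
elim: q p x z => [|q IH] p x z /=.
  case: p x z => [|p] /= x z; first by move=> -> ->; rewrite raddf0.
  move=> [y ->] ->; exists (dca y); last exact: dc_av.
  by apply/dch0; exists y.
move=> bx [c hc ->]; have [c0 hc0 e] := IH _ _ _ bx hc.
have e0 : dcv (c - c0) = 0 by rewrite raddfB e subrr.
have ec : dch c = dch (c - c0) by rewrite raddfB hc0 subr0.
rewrite ec; move: (c - c0) e0 => w; clear; case: p w => [|p] w /=.
  by move/dcv0 => [y ->]; exists y; rewrite dc_bh.
move/dcvS => [e ->]; exists (dch e); last by rewrite dc_hv.
by apply/dchS; exists e.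
Qed.

Lemma null_boundary q p x z : @zig q p x z -> null z -> is_boundary x.
Proof.
elim: q p x z => [|q IH] p x z /=.
  case: p x z => [|p] /= x z ->.
    by move=> e; apply: (@dca_inj _ _ D); rewrite e raddf0.
  move=> [c /dch0 [x0 ->] e]; exists x0; apply: (@dca_inj _ _ D).
  by rewrite e dc_av.
move=> [c hc ->] nz; apply: IH hc _ => /=; clear x z.
case: p c nz => [|p] c /= [c0].
  move=> e; exists (c - dcb c0); first by rewrite raddfB e dc_bh subrr.
  have /dcv0 e0 : exists y, dcb c0 = dcb y :> D 0 q by exists c0.
  by rewrite raddfB e0 subr0.
move/dchS => [w ->] e; exists (c - dcv w); first by rewrite raddfB e dc_hv subrr.
have /dcvS e0 : exists y, dcv w = dcv y :> D p.+1 q by exists w.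
by rewrite raddfB e0 subr0.
Qed.

Lemma null_dcb s (y : B s) : null (dcb y : D 0 s) <-> is_boundary y.
Proof.
case: s y => [|s] y /=.
  by split=> [e|->]; [apply: (@dcb_inj _ _ D); rewrite e raddf0|rewrite raddf0].
split=> -[w e]; exists w; first exact: (@dcb_inj _ _ D).
by rewrite e.
Qed.

Definition zigrel s (X : homology A (NatTrec.add s 0)) (Y : homology B s) : Prop :=
  exists x y, [/\ qclass (boundaries A _) x = X, qclass (boundaries B s) y = Y & zig (val x) (dcb (val y))].

Lemma zigrel_sub s X Y X' Y' : @zigrel s X Y -> @zigrel s X' Y' -> zigrel (X - X') (Y - Y').
Proof.
move=> [x [y [<- <- h]]] [x' [y' [<- <- h']]]; exists (x - x'), (y - y').
by split; rewrite ?raddfB //; apply: zig_sub.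
Qed.

Lemma zigrel_eq0 s X Y : @zigrel s X Y -> (X = 0 <-> Y = 0).
Proof.
move=> [x [y [<- <- h]]]; split=> /cls_eq0 b; apply/cls_eq0.
  by apply/null_dcb; apply: zig_boundary h.
by apply: null_boundary h _; apply/null_dcb.
Qed.

(** The clause on [zigrel] characterizes phi, and naturality is deduced from it. *)
Lemma zigzag_iso s : exists phi : sqhom (homology A (NatTrec.add s 0)) (homology B s),
  is_iso phi /\ forall X, zigrel X (phi X).
Proof.
have [||||| phi hphi] := @rel_hom _ _ (@zigrel s).
- move=> X; have [x <-] := cls_surj X.
  have [z hz] := zig_ex (sub_carP x).
  have /dcv0 [y e] := zig_v (sub_carP x) hz.
  have dy : cd B s y = 0.
    by apply: (@dcb_inj _ _ D); rewrite dc_bh -e (zig_h hz) raddf0.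
  exists (qclass (boundaries B s) (sub_mk (cycles B s) y dy)), x, (sub_mk (cycles B s) y dy).
  by split=> //; rewrite /= -e.
- by move=> Y h; apply/(zigrel_eq0 h).
- exact: zigrel_sub.
- move=> n X Y [x [y [<- <- h]]]; exists (grpr n x), (grpr n y).
  by split; [exact: esym (quo_prE _ _ _)|exact: esym (quo_prE _ _ _)|have := zig_pr n h; rewrite -ghom_pr].
- move=> i X Y [x [y [<- <- h]]]; exists (Sq i x), (Sq i y).
  by split; [exact: esym (quo_SqE _ _ _)|exact: esym (quo_SqE _ _ _)|have := zig_Sq i h; rewrite -hom_Sq].
exists phi; split=> //; apply: inj_surj_bij => [X X' e|Y].
  apply/eqP; rewrite -subr_eq0; apply/eqP/(zigrel_eq0 (hphi (X - X'))).
  by rewrite raddfB e subrr.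
have [y <-] := cls_surj Y.
have [||x dx hx] := @zig_surj s 0 (dcb (val y)); first by apply/dcv0; exists (val y).
  have dy : cd B s (val y) = 0 := sub_carP y.
  by rewrite -dc_bh dy raddf0.
exists (qclass (boundaries A _) (sub_mk (cycles A _) x dx)); set X := qclass _ _.
have h : zigrel X (qclass (boundaries B s) y) by exists (sub_mk (cycles A _) x dx), y.
have h0 := zigrel_sub (hphi X) h.
apply/eqP; rewrite -subr_eq0; apply/eqP/(zigrel_eq0 h0); exact: subrr.
Qed.

End Zigzag.

Section ZigNat.
Variables (A B A' B' : complex) (D : double_complex A B) (D' : double_complex A' B').
Variables (fA : cmap A A') (fB : cmap B B') (fD : forall p q, D p q -> D' p q).
Hypothesis fDv : forall p q (z : D p q), fD (dcv z) = dcv (fD z).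
Hypothesis fDh : forall p q (z : D p q), fD (dch z) = dch (fD z).
Hypothesis fDa : forall p (x : A p), fD (dca x) = dca (fA p x).
Hypothesis fDb : forall q (y : B q), fD (dcb y) = dcb (fB q y).

Lemma zig_nat q p x (z : D p q) : zig x z -> zig (fA _ x) (fD z).
Proof.
elim: q p x z => [|q IH] p x z /=; first by move=> ->.
by move=> [c hc ->]; exists (fD c); rewrite ?fDh // -fDv; apply: IH.
Qed.

Lemma zigrel_nat s X Y : @zigrel _ _ D s X Y ->
  zigrel D' (homology_map fA _ X) (homology_map fB s Y).
Proof.
move=> [x [y [<- <- h]]].
exists (sub_hom (@cmap_cycles _ _ fA _) x), (sub_hom (@cmap_cycles _ _ fB _) y); split.
- exact: esym (quo_funE _ _).
- exact: esym (quo_funE _ _).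
- by rewrite /= -fDb; apply: zig_nat.
Qed.

End ZigNat.

(** The elements that satisfy the instability condition already form a submodule, by [unst_Sq]. *)
Lemma in_OmegaP (M : lfAmod) (x : M) : in_Omega x <-> unst 0 x.
Proof.
split=> [[N /unstable_subP uN Nx] r p hp|h].
  by apply: (uN p r); [apply: sub_in_pr|apply: homog_pr|rewrite addr0 in hp].
have uD (y z : M) : unst 0 y -> unst 0 z -> unst 0 (y + z).
  by move=> hy hz r p hp; rewrite !raddfD hy // hz // addr0.
have u0 : unst 0 (0 : M) by move=> r p _; rewrite !raddf0.
pose N := @Submod M (@unst M 0) u0 uD
  (fun n x => @unst_pr M 0 x n) (fun i x => @unst_Sq M 0 x i).
exists N => //; apply/unstable_subP => n i y hy hn ni.
by rewrite -hn hy // addr0.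
Qed.

(** * The double complex R_p(I_q) of an injective resolution *)

Section ResolutionComplex.
Variables (C : R_is_complex) (M : lfAmod) (I : inj_resolution M).
Notation st := (Rstable C).

Section Augmentation.
Variable J : lfAmod.

Definition Omega_R_fun (x : Omega J) : R_ st 0 J :=
  qclass (Qrel_submod st 0 (lfsusp (0%:Z - 1) J)) (val x : FQn 0 (lfsusp (0%:Z - 1) J)).

Lemma Omega_R_add : zmod_morphism Omega_R_fun.
Proof. by move=> x y; rewrite /Omega_R_fun -raddfB. Qed.

Lemma Omega_R_pr n x :
  additive_of Omega_R_add (grpr n x) = grpr n (additive_of Omega_R_add x).
Proof.
apply: etrans (esym (quo_prE _ _ _)).
(* R_0 is the suspension of calR_0 applied to the desuspension, so the two shifts cancel. *)
have {1}-> : n = n - 1 - (0%:Z - 1) by lia.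
by [].
Qed.

Lemma Omega_R_Sq i x : GrHom Omega_R_pr (Sq i x) = Sq i (GrHom Omega_R_pr x).
Proof. exact: esym (quo_SqE _ _ _). Qed.

Definition Omega_R : sqhom (Omega J) (R_ st 0 J) := SqHom Omega_R_Sq.

Lemma Omega_R_inj : injective Omega_R.
Proof.
move=> x y /clsP /reg_Qrel /Qrelk_low e; apply: val_inj.
by apply/eqP; rewrite -subr_eq0; apply/eqP.
Qed.

Lemma Omega_R_ker (z : R_ st 0 J) : dR st 0 J z = 0 <-> exists y, z = Omega_R y.
Proof.
have key (w : J) : dR st 0 J (qclass (Qrel_submod st 0 (lfsusp (0%:Z - 1) J)) w) = 0 <-> in_Omega w.
  rewrite in_OmegaP (_ : 0 = (0%:Z - 1) + 1) // -unstP dR_cls cls_eq0.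
  have := @reg_Qrel (1%:Z - 1) J 1 (dFQ J (deg_succ 0) 0 w).
  by rewrite reg_dFQ.
split=> [|[y ->]]; last exact/key/(sub_carP y).
have [w <-] := cls_surj z => /key h.
by exists (sub_mk (Omega_sub J) w h).
Qed.

End Augmentation.

Lemma R_acyclic (J : lfAmod) s (z : R_ st s.+1 J) : injective_object J ->
  dR st s.+1 J z = 0 <-> exists w, z = dR st s J w.
Proof.
move=> hJ; split=> [|[w ->]]; last exact: dR_dR.
have [u <-] := cls_surj z; rewrite dR_cls => /cls_eq0 hu.
have [v hv] := injective_acyclic hJ (deg_succ s) hu.
by exists (qclass _ v); rewrite dR_cls; apply/clsP.
Qed.

Lemma Omega_R_nat (J J' : lfAmod) (f : sqhom J J') x :
  Rmap st 0 f (Omega_R J x) = Omega_R J' (Omega_map f x).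
Proof. exact: Rmap_cls. Qed.

Definition R_double : double_complex (Rcomplex C M) (Omega_complex I).
Proof.
apply: (@DoubleComplex (Rcomplex C M) (Omega_complex I) (fun p q => R_ st p (I q))
  (fun p q => cd (Rcomplex C (I q)) p) (fun p q => Rmap st p (ires_d I q))
  (fun p => Rmap st p (ires_aug I)) (fun q => Omega_R (I q))).
- by move=> p q z; apply: Rmap_d.
- by move=> p x; apply: Rmap_d.
- by move=> q y; apply: esym (Omega_R_nat _ _).
- by move=> p; apply/Rmap_inj/ires_aug_inj.
- by move=> q; apply: Omega_R_inj.
- by move=> p; apply/Rmap_exact/ires_exact0.
- by move=> p q; apply/Rmap_exact/ires_exact.
- by move=> q; apply: Omega_R_ker.
- by move=> p q z; apply/R_acyclic/ires_inj.
Defined.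
End ResolutionComplex.

Lemma FQn_hom_ext s (M N : sqspace) (f g : sqhom M N) (u : FQn s M) :
  (forall x, f x = g x) -> FQn_hom s f u = FQn_hom s g u.
Proof. by move=> e; elim: s u => [|s IH] u; [exact: e|apply: FQ_eq => n; apply: IH]. Qed.

Lemma Rmap_square (st : Nishida_stable) s (A B C D : lfAmod) (f : sqhom A B) (g : sqhom B D)
    (f' : sqhom A C) (g' : sqhom C D) x : (forall y, g (f y) = g' (f' y)) ->
  Rmap st s g (Rmap st s f x) = Rmap st s g' (Rmap st s f' x).
Proof.
move=> e; have [u <-] := cls_surj x; rewrite !Rmap_cls !FQn_hom_comp.
by rewrite (@FQn_hom_ext s _ _ _ (hom_comp (lfsusp_hom _ g') (lfsusp_hom _ f'))).
Qed.

(** The index has the form produced by [zig]; rewriting it to s in the whole closed statement avoids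
    transporting maps between types. *)
Lemma homology_R_Omega (C : R_is_complex) (s : nat) :
  exists phi : forall (M : lfAmod) (I : inj_resolution M),
          sqhom (homology (Rcomplex C M) (NatTrec.add s 0)) (homology (Omega_complex I) s),
        (forall (M : lfAmod) (I : inj_resolution M), is_iso (phi M I)) /\
        (forall (M N : lfAmod) (f : sqhom M N) (I : inj_resolution M)
            (J : inj_resolution N) (F : res_map f I J)
            (x : homology (Rcomplex C M) (NatTrec.add s 0)),
          phi N J (homology_map (Rcmap C f) (NatTrec.add s 0) x) =
          homology_map (Omega_cmap F) s (phi M I x)).
Proof.
pose phi M (I : inj_resolution M) := cid (zigzag_iso (R_double C I) s).
exists (fun M I => sval (phi M I)); split=> [M I|M N f I J F x].
  by have [] := svalP (phi M I).
have [_ h] := svalP (phi M I); have [_ h'] := svalP (phi N J).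
have k := @zigrel_nat _ _ _ _ (R_double C I) (R_double C J) (Rcmap C f) (Omega_cmap F)
  (fun p q => Rmap (Rstable C) p (F q)) _ _ _ _ s _ _ (h x).
apply/eqP; rewrite -subr_eq0; apply/eqP.
apply: (zigrel_eq0 (zigrel_sub (h' _) (k _ _ _ _))).1; last exact: subrr.
- by move=> p q z; apply: Rmap_d.
- by move=> p q z; apply: Rmap_square => y; apply: rmap_d.
- by move=> p z; apply: Rmap_square => y; apply: rmap_aug.
- by move=> q y; apply: Omega_R_nat.
Qed.

Theorem theorem1p16 :
  exists C : R_is_complex,
    forall s : nat,
      exists phi : forall (M : lfAmod) (I : inj_resolution M),
          sqhom (homology (Rcomplex C M) s) (homology (Omega_complex I) s),
        (forall (M : lfAmod) (I : inj_resolution M), is_iso (phi M I)) /\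
        (forall (M N : lfAmod) (f : sqhom M N) (I : inj_resolution M)
            (J : inj_resolution N) (F : res_map f I J)
            (x : homology (Rcomplex C M) s),
          phi N J (homology_map (Rcmap C f) s x) =
          homology_map (Omega_cmap F) s (phi M I x)).
Proof.
exists R_complex_holds => s; have := homology_R_Omega R_complex_holds s.
by rewrite NatTrec.addE addn0.
Qed.
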